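(* Let $\alpha>0$ and $n=\lceil\alpha\rceil$. Let $G\subseteq\mathbb{R}$ be an open set and let $f:(a,b]\times G\to\mathbb{R}$ be a function such that $t\mapsto f(t,x)$ belongs to $L^1_\psi(a,b)$ for every $x\in G$. Assume that $f$ satisfies a Lipschitz condition with respect to its second variable, i.e. there is $L>0$ with $|f(t,x)-f(t,y)|\le L|x-y|$ for all $t\in(a,b]$ and $x,y\in G$. Let $a_1,\dots,a_n\in\mathbb{R}$. Then the Cauchy problem $$\begin{cases}{}^{RL}D_a^{\alpha,\psi}u(t)=f(t,u(t)),\quad t\in[a,b],\\ {}^{RL}D_a^{\alpha-k,\psi}u(a)=a_k,\ k=1,\dots,n-1,\qquad \lim_{t\to a}I_a^{n-\alpha,\psi}u(t)=a_n,\end{cases}$$ admits a unique solution $u\in L^\alpha_\psi(a,b)$, where $L^\alpha_\psi(a,b)=\{\varphi\in L^1_\psi(a,b):\ {}^{RL}D_a^{\alpha,\psi}\varphi\in L^1_\psi(a,b)\}$.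
   Context: Let $0\le a<b<\infty$. The function $\psi$ is non-negative, continuous and increasing on $(a,b]$, of class $C^n(a,b]$, with $\psi'(t)\neq0$ for all $t\in(a,b]$; $\psi(a):=\lim_{t\to a^+}\psi(t)$. $L^1_\psi(a,b)$ is the set of (classes of) measurable functions $u$ on $[a,b]$ with $\int_a^b|u(s)|\psi'(s)\,ds<\infty$. Write $\varrho=\frac{1}{\psi'}\frac{d}{dt}$. $AC^m_\psi[a,b]$ is the set of functions $w$ on $[a,b]$ such that $\varrho^{m-1}w$ is (extends to) an absolutely continuous function on $[a,b]$. For $\gamma>0$ and $u\in L^1_\psi(a,b)$, $$I_a^{\gamma,\psi}u(t)=\frac1{\Gamma(\gamma)}\int_a^t\frac{\psi'(s)u(s)}{(\psi(t)-\psi(s))^{1-\gamma}}\,ds,$$ and $I_a^{0,\psi}u=u$. For $\gamma>0$ and $m=\lceil\gamma\rceil$, ${}^{RL}D_a^{\gamma,\psi}u=\varrho^m I_a^{m-\gamma,\psi}u$; for $u\in L^1_\psi(a,b)$, having ${}^{RL}D_a^{\gamma,\psi}u\in L^1_\psi(a,b)$ is understood to mean that $I_a^{m-\gamma,\psi}u$ (has a representative that) belongs to $AC^m_\psi[a,b]$. The differential equation is understood for a.e. $t$, and values at $a$ as limits $t\to a^+$.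
   Formalization: Added hypothesis: for every Lipschitz, integrable prolongation of f to (a,b]×ℝ, solutions of the Cauchy problem take values in G a.e. (automatic if G=ℝ). Without it existence fails: α=1, ψ=id, G=(0,1), f=0, a_1=2. It holds whenever a solution exists. *)

(* Defs.v *)
From HB Require Import structures.
From mathcomp Require Export all_boot all_order all_algebra.
From mathcomp Require Export all_classical all_reals all_analysis.
Export Order.TTheory GRing.Theory Num.Theory.
Export numFieldNormedType.Exports.

Set Implicit Arguments.
Unset Strict Implicit.
Unset Printing Implicit Defensive.

Local Open Scope classical_set_scope.
Local Open Scope ring_scope.

Definition Gamma {R : realType} (x : R) : R :=
  \int[@lebesgue_measure R]_(t in `]0, +oo[) (t `^ (x - 1) * expR (- t)).

(* Meaningful for x >= 0. *)
Definition nceil {R : realType} (x : R) : nat := `|Num.ceil x|%N.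

(* The disjoint intervals are listed from left to right. *)
Definition absolutely_continuous {R : realType} (a b : R) (F : R -> R) : Prop :=
  forall e : R, 0 < e -> exists2 d : R, 0 < d &
    forall (N : nat) (x y : nat -> R),
      (forall i, (i < N)%N -> a <= x i /\ x i <= y i /\ y i <= b) ->
      (forall i, (i.+1 < N)%N -> y i <= x i.+1) ->
      \sum_(i < N) (y i - x i) < d ->
      \sum_(i < N) `|F (y i) - F (x i)| < e.

(* Class C^n on the half-open interval ]a, b]: the derivatives are taken on
   ]a, b[ and extend continuously to b, which amounts to using one-sided
   derivatives at b. *)
Definition class_C {R : realType} (a b : R) (n : nat) (g : R -> R) : Prop :=
  [/\ {within `]a, b], continuous g},
      forall k, (k < n)%N ->
        {in `]a, b[, forall t, derivable (derive1n k g) t 1} &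
      forall k, (0 < k <= n)%N ->
        {in `]a, b[, continuous (derive1n k g)} /\
        cvg (derive1n k g t @[t --> b^'-])].

(* The fourth clause is the convention psi(a) := lim psi at a+; in the last
   one, the left limit is the value of psi' at b. *)
Definition kernel_function {R : realType} (a b : R) (n : nat) (psi : R -> R)
    : Prop :=
  [/\ {in `]a, b], forall t, 0 <= psi t},
      {in `]a, b] &, {homo psi : s t / s < t}},
      class_C a b n psi,
      psi t @[t --> a^'+] --> psi a &
      {in `]a, b[, forall t, derive1 psi t != 0} /\
      lim (derive1 psi t @[t --> b^'-]) != 0].

Section RiemannLiouville.
Context {R : realType} (a b : R) (psi : R -> R).
Notation mu := (@lebesgue_measure R).

(* The measurable structure of R is the Borel one; being a.e. equal to a Borel
   function is Lebesgue measurability. *)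
Definition L1psi (u : R -> R) : Prop :=
  exists v : R -> R,
    [/\ measurable_fun `[a, b] v,
        \forall t \ae mu, t \in `[a, b] -> u t = v t &
        (\int[mu]_(s in `]a, b[) (`|v s| * derive1 psi s)%:E < +oo)%E].

Definition rho (w : R -> R) (t : R) : R := derive1 w t / derive1 psi t.

(* For m >= 1; only the values of w on ]a, b[ matter. *)
Definition ACpsi (m : nat) (w : R -> R) : Prop :=
  (forall k, (k < m.-1)%N ->
     {in `]a, b[, forall t, derivable (iter k rho w) t 1}) /\
  exists2 F : R -> R, absolutely_continuous a b F &
    {in `]a, b[, iter m.-1 rho w =1 F}.

Definition RLint (gamma : R) (u : R -> R) (t : R) : R :=
  if gamma == 0 then u t else
  (Gamma gamma)^-1 *
  \int[mu]_(s in `]a, t[) (derive1 psi s * u s / (psi t - psi s) `^ (1 - gamma)).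

Definition AC_representative (m : nat) (g w : R -> R) : Prop :=
  ACpsi m w /\ \forall t \ae mu, t \in `]a, b[ -> w t = g t.

(* The representative in AC^m of I^(m - gamma) u, where m is the ceiling of
   gamma > 0. When m >= 1 such a representative is continuous on ]a, b[, hence
   its values there do not depend on the choice. *)
Definition RLint_rep (gamma : R) (u : R -> R) : R -> R :=
  let m := nceil gamma in
  let g := RLint (m%:R - gamma) u in
  xget g [set w | AC_representative m g w].

Definition RLderiv (gamma : R) (u : R -> R) : R -> R :=
  iter (nceil gamma) rho (RLint_rep gamma u).

Definition Lalpha (alpha : R) (u : R -> R) : Prop :=
  let m := nceil alpha in
  [/\ L1psi u,
      exists w, AC_representative m (RLint (m%:R - alpha) u) w &
      L1psi (RLderiv alpha u)].

Definition cauchy_solution (alpha : R) (G : set R) (f : R -> R -> R)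
    (c : nat -> R) (u : R -> R) : Prop :=
  let n := nceil alpha in
  [/\ Lalpha alpha u,
      \forall t \ae mu, t \in `]a, b[ -> G (u t),
      \forall t \ae mu, t \in `]a, b[ -> RLderiv alpha u t = f t (u t),
      forall k, (0 < k < n)%N ->
        RLderiv (alpha - k%:R) u t @[t --> a^'+] --> c k &
      RLint_rep alpha u t @[t --> a^'+] --> c n].

Definition lipschitz_in_second (G : set R) (f : R -> R -> R) (L : R) : Prop :=
  forall t x y, t \in `]a, b] -> G x -> G y ->
    `|f t x - f t y| <= L * `|x - y|.

(* f is only given on ]a, b] x G, so f(t, u(t)) makes sense only while u(t) is
   in G. The solution is confined to G when, however f is prolonged to
   ]a, b] x R with the same regularity, the solutions of the prolonged Cauchy
   problem have their values in G. This always holds for G = R.  It cannot be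
   dispensed with: for alpha = 1, psi = id, G = ]0, 1[ and f = 0, there is no
   solution with value 2 at a. *)
Definition confined (alpha : R) (G : set R) (f : R -> R -> R) (L : R)
    (c : nat -> R) : Prop :=
  forall F : R -> R -> R,
    (forall t x, t \in `]a, b] -> G x -> F t x = f t x) ->
    (forall x, L1psi (F ^~ x)) -> lipschitz_in_second setT F L ->
    forall u, cauchy_solution alpha setT F c u ->
      \forall t \ae mu, t \in `]a, b[ -> G (u t).

End RiemannLiouville.

(* Main.v *)
From HB Require Import structures.
Require Import Defs.
From mathcomp Require Import measurable_realfun ring lra.

Set Implicit Arguments.
Unset Strict Implicit.
Unset Printing Implicit Defensive.

Local Open Scope classical_set_scope.
Local Open Scope ring_scope.

(* Write beta = n - alpha, and work with the densities V = psi' u, which live in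
   L^1(a, b). The equation D^alpha u = f(., u) with the prescribed initial values
   says that I^beta u is the n-fold psi-primitive of f(., u) with constants c n,
   ..., c 1. By the Beta integral, composing Abel operators of orders beta and
   1 - beta gives ordinary integration; hence the Abel equation I^beta u = W is
   uniquely solvable for such W, and the Cauchy problem becomes a fixed-point
   equation for V in L^1. Volterra operators with an Abel kernel have small norm
   in L^1 weighted by exp(-lam psi) for lam large, so the fixed point exists and
   is unique.
   To pass between functions with an absolutely continuous iterated psi-derivative
   and iterated primitives of L^1 functions, one needs that an absolutely
   continuous function is the integral of an integrable function: its total
   variation is absolutely continuous, and Radon-Nikodym applies to the
   Lebesgue-Stieltjes measures of two nondecreasing functions.
   When G is not the whole line, f is extended by the McShane formula; confinement
   makes the solutions of both problems coincide, and shows that G is nonempty. *)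

(** * Absolutely continuous functions have an integrable density *)

(** Nothing controls $\psi'$ near $a$; in terms of $V = \psi' u$ this weight disappears into
    Lebesgue measure, and every operator becomes one with kernel $\psi'(t)(\psi(t)-\psi(s))^{g-1}$
    on a single space. The prescribed limit $c_n$ of $I^\beta u$ contributes a multiple of
    $(\psi-\psi(a))^{-\beta}$ to $u$, so for $\beta > 0$ and $c_n \neq 0$ solutions are unbounded
    near $a$: a sup-norm argument is excluded, and $L^1$ is the natural space. The Abel equation is
    solved without differentiating anything, since its right-hand side already has the form $c_n +
    \int_a^t Y$: the operator of order $1-\beta$ is applied to $Y$, and $c_n$ is treated as a point
    mass at $a$. The outermost factor thus always has order $1-\beta > 0$, and it alone has to
    contract; the order-one factors inside it only must not expand. Initial values refer to a
    representative picked by choice. Any such representative is shown to be an iterated primitive,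
    hence continuous, so the choice does not affect its values on the open interval. *)

Fixpoint itvs_from {R : realType} (b z : R) (s : seq (R * R)) : Prop :=
  if s is p :: s' then [/\ z <= p.1, p.1 <= p.2 & itvs_from b p.2 s']
  else z <= b.

(** With lists of endpoint pairs, an interval is refined by concatenating a partition of it; this is
    the operation behind the passage to the total variation. *)
Definition seq_absolutely_continuous {R : realType} (a b : R) (F : R -> R) :=
  forall e : R, 0 < e -> exists2 d : R, 0 < d & forall s, itvs_from b a s ->
    \sum_(p <- s) (p.2 - p.1) < d -> \sum_(p <- s) `|F p.2 - F p.1| < e.

Section absolute_continuity.
Context {R : realType}.
Implicit Types (a b x y z : R) (l : seq R) (F G : R -> R) (s : seq (R * R)).

Lemma itvs_from_le b z s : itvs_from b z s -> z <= b.
Proof.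
elim: s z => [//|p s IH] z /= [zp pp /IH]; exact/le_trans/(le_trans zp).
Qed.

Lemma itvs_fromW b z z' s : z' <= z -> itvs_from b z s -> itvs_from b z' s.
Proof.
case: s => [|p s] /=; first exact: le_trans.
by move=> zz' [zp pp ps]; split => //; exact: le_trans zp.
Qed.

Lemma itvs_from_nth b z s (i : nat) : itvs_from b z s -> (i < size s)%N ->
  [/\ z <= (nth (0, 0) s i).1, (nth (0, 0) s i).1 <= (nth (0, 0) s i).2 &
      (nth (0, 0) s i).2 <= b].
Proof.
elim: s z i => [//|p s IH] z [|i] /= [zp pp ps] is_.
  by split => //; exact: itvs_from_le ps.
have [h1 h2 h3] := IH _ i ps is_.
by split => //; apply: le_trans h1; exact: le_trans pp.
Qed.

Lemma itvs_from_nthS b z s (i : nat) : itvs_from b z s -> (i.+1 < size s)%N ->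
  (nth (0, 0) s i).2 <= (nth (0, 0) s i.+1).1.
Proof.
elim: s z i => [//|p s IH] z [|i] /= [zp pp ps] is_.
  by case: s ps is_ {IH} => //= q s [].
exact: IH ps is_.
Qed.

Lemma absolutely_continuous_seq a b F :
  absolutely_continuous a b F -> seq_absolutely_continuous a b F.
Proof.
move=> acF e e0; have [d d0 Fd] := acF e e0; exists d => // s abs sd.
have := Fd (size s) (fun i => (nth (0, 0) s i).1) (fun i => (nth (0, 0) s i).2).
rewrite -(big_mkord xpredT (fun i => (nth (0, 0) s i).2 - (nth (0, 0) s i).1)).
rewrite -(big_mkord xpredT
  (fun i => `|F (nth (0, 0) s i).2 - F (nth (0, 0) s i).1|)).
rewrite -(big_nth (0, 0) xpredT (fun p => p.2 - p.1)).
rewrite -(big_nth (0, 0) xpredT (fun p => `|F p.2 - F p.1|)); apply => //.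
- by move=> i is_; have [] := itvs_from_nth abs is_.
- by move=> i is_; exact: itvs_from_nthS abs is_.
Qed.

Lemma seq_absolutely_continuousB a b F G :
  seq_absolutely_continuous a b F -> seq_absolutely_continuous a b G ->
  seq_absolutely_continuous a b (F \- G).
Proof.
move=> acF acG e e0; have e20 : 0 < e / 2 by rewrite divr_gt0.
have [d d0 Fd] := acF _ e20; have [d' d0' Gd] := acG _ e20.
exists (Num.min d d'); first by rewrite lt_min d0.
move=> s abs; rewrite lt_min => /andP[/(Fd _ abs) Fs /(Gd _ abs) Gs].
rewrite (splitr e); apply: le_lt_trans (ltrD Fs Gs); rewrite -big_split /=.
apply: ler_sum => p _.
have -> : (F \- G) p.2 - (F \- G) p.1 = (F p.2 - F p.1) - (G p.2 - G p.1).
  by rewrite /=; ring.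
exact: ler_normB.
Qed.

Lemma itvs_from_partition b z x y l s : itv_partition x y l -> z <= x ->
  itvs_from b y s -> itvs_from b z (pairmap pair x l ++ s).
Proof.
elim: l z x => [|t l IH] z x /=.
  by move=> /itv_partition_nil -> zy; exact: itvs_fromW.
move=> ptl zx ys; have := ptl => -[/= /andP[xt _] _].
split => //; first exact: ltW.
by apply: IH ys => //; exact: itv_partition_cons ptl.
Qed.

Lemma sum_pairmap_length x y l : itv_partition x y l ->
  \sum_(p <- pairmap pair x l) (p.2 - p.1) = y - x.
Proof.
elim: l x => [|t l IH] x /=.
  by move=> /itv_partition_nil ->; rewrite big_nil subrr.
by move=> /itv_partition_cons/IH; rewrite big_cons /= => ->; lra.
Qed.

Lemma sum_pairmap_variation x y l F : itv_partition x y l ->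
  \sum_(p <- pairmap pair x l) `|F p.2 - F p.1| = variation x y F l.
Proof.
elim: l x => [|t l IH] x /=.
  by move=> _; rewrite variation_nil big_nil.
move=> p; have /IH := itv_partition_cons p; rewrite big_cons /= => ->.
by rewrite /variation /= big_nat_recl.
Qed.

Lemma variation_lt_bounded a b F (d : R) x y :
  (forall s, itvs_from b a s -> \sum_(p <- s) (p.2 - p.1) < d ->
    \sum_(p <- s) `|F p.2 - F p.1| < 1) ->
  a <= x -> y <= b -> y - x < d -> bounded_variation x y F.
Proof.
move=> Fd ax yb xyd; exists 1 => _ [l pl <-].
rewrite -(sum_pairmap_variation F pl) ltW// Fd//.
  by rewrite -[pairmap _ _ _]cats0; exact: itvs_from_partition pl _ _.
by rewrite (sum_pairmap_length pl).
Qed.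

(** The variation is at most 1 on any interval shorter than the [d] attached to 1, and finitely many
    such intervals cover [[a, b]]; total variation is additive. *)
Lemma seq_absolutely_continuous_bounded_variation a b F : a <= b ->
  seq_absolutely_continuous a b F -> bounded_variation a b F.
Proof.
move=> ab acF; have [d d0 Fd] := acF 1 ltr01.
(* Steps of length [d / 2] keep the strict bound by [d]; the cap at [b] makes the walk stop
   there. *)
pose x k := Num.min b (a + k%:R * (d / 2)).
have ax k : a <= x k.
  by rewrite le_min ab lerDl mulr_ge0// divr_ge0// ltW.
have xb k : x k <= b by rewrite ge_min lexx.
have TVx k : total_variation a (x k) F \is a fin_num.
  elim: k => [|k IH].
    by rewrite /x mul0r addr0 min_r// total_variationxx.
  have xx : x k <= x k.+1.
    by rewrite /x le_min ge_min lexx /= ge_min lerD2l ler_pM2r ?ler_nat ?leqnSn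
      ?orbT// divr_gt0.
  rewrite (total_variationD F (ax k) xx) fin_numD IH /=.
  apply/(bounded_variationP F xx)/(variation_lt_bounded Fd) => //.
  rewrite /x -natr1; case: (leP b (a + (k%:R + 1) * (d / 2))) => h1;
    case: (leP b (a + k%:R * (d / 2))) => h2; lra.
apply/(bounded_variationP F ab).
have := TVx (Num.bound ((b - a) / (d / 2))).
rewrite /x min_l//; rewrite addrC -lerBlDr -ler_pdivrMr ?divr_gt0//.
by rewrite ltW// archi_boundP// divr_ge0// ?subr_ge0// divr_ge0// ltW.
Qed.

End absolute_continuity.

Section total_variation_absolute_continuity.
Context {R : realType}.
Implicit Types (a b x y z : R) (l : seq R) (F G : R -> R) (s : seq (R * R)).

Lemma total_variation_approx a b F (e : R) : a <= b -> 0 < e ->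
  bounded_variation a b F ->
  exists2 l, itv_partition a b l &
    fine (total_variation a b F) - e < variation a b F l.
Proof.
move=> ab e0 bvF; have fTV := (bounded_variationP F ab).1 bvF.
have [_ /= [_ [l pl <-] <-]] := ub_ereal_sup_adherent e0 fTV.
by rewrite -/(total_variation a b F) -(fineK fTV) -EFinB lte_fin; exists l.
Qed.

(** Each interval is replaced by a partition that nearly realises the total variation on it, at a
    cost of [e] per interval. The total length is unchanged, so the smallness condition on [s]
    passes to [s']. *)
Lemma itvs_from_total_variation a b F (e : R) z s : 0 < e ->
  bounded_variation a b F -> a <= z -> itvs_from b z s ->
  exists s', [/\ itvs_from b z s',
    \sum_(p <- s') (p.2 - p.1) = \sum_(p <- s) (p.2 - p.1) &
    \sum_(p <- s) (fine (total_variation a p.2 F) -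
                   fine (total_variation a p.1 F)) <=
    \sum_(p <- s') `|F p.2 - F p.1| + (size s)%:R * e].
Proof.
move=> e0 bvF; elim: s z => [|[x y] s IH] z az /=.
  by exists [::]; rewrite !big_nil mul0r addr0.
move=> [zx xy ys]; have ax := le_trans az zx; have ay := le_trans ax xy.
have yb := itvs_from_le ys.
have [s' [ys' Es' sIH]] := IH _ ay ys.
have bvay := bounded_variationl ay yb bvF.
have bvxy := bounded_variationr ax xy bvay.
have [l pl ll] := total_variation_approx xy e0 bvxy.
exists (pairmap pair x l ++ s'); split.
- exact: itvs_from_partition pl zx ys'.
- by rewrite big_cat big_cons /= (sum_pairmap_length pl) Es'.
- rewrite big_cat big_cons /= (sum_pairmap_variation F pl).
  rewrite (total_variationD F ax xy) fineD; last 2 first.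
    exact/(bounded_variationP F ax)/(bounded_variationl ax xy bvay).
    exact/(bounded_variationP F xy).
  rewrite -natr1; lra.
Qed.

Lemma fine_total_variation_le a b F x y : bounded_variation a b F ->
  a <= x -> x <= y -> y <= b ->
  `|F y - F x| <=
    fine (total_variation a y F) - fine (total_variation a x F).
Proof.
move=> bvF ax xy yb; have ay := le_trans ax xy.
have bvay := bounded_variationl ay yb bvF.
have fTV := (bounded_variationP F xy).1 (bounded_variationr ax xy bvay).
rewrite (total_variationD F ax xy) fineD //; last first.
  exact/(bounded_variationP F ax)/(bounded_variationl ax xy bvay).
rewrite addrAC subrr add0r -lee_fin fineK//; exact: total_variation_ge.
Qed.

Lemma seq_absolutely_continuous_total_variation a b F : a <= b ->
  seq_absolutely_continuous a b F ->
  seq_absolutely_continuous a b (fun x => fine (total_variation a x F)).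
Proof.
move=> ab acF e e0; have bvF := seq_absolutely_continuous_bounded_variation ab acF.
have e20 : 0 < e / 2 by rewrite divr_gt0.
have [d d0 Fd] := acF _ e20; exists d => // s abs sd.
(* The approximation errors add up to [size s] times [e'], at most [e / 2]; the successor covers the
   empty list. *)
pose e' := e / 2 / (size s).+1%:R.
have e'0 : 0 < e' by rewrite !divr_gt0.
have [s' [abs' Es' TVs]] := itvs_from_total_variation e'0 bvF (lexx a) abs.
rewrite -Es' in sd; have {Fd abs' sd}Fs' := Fd _ abs' sd.
have -> : \sum_(p <- s) `|fine (total_variation a p.2 F) -
    fine (total_variation a p.1 F)| = \sum_(p <- s)
    (fine (total_variation a p.2 F) - fine (total_variation a p.1 F)).
  rewrite !(big_nth (0, 0)) !big_nat; apply: eq_bigr => i /andP[_ is_].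
  have [h1 h2 h3] := itvs_from_nth abs is_.
  by rewrite ger0_norm// (le_trans _ (fine_total_variation_le bvF h1 h2 h3)).
apply: le_lt_trans TVs _; rewrite (splitr e) ltr_leD//.
rewrite /e' mulrCA ger_pMr// ler_pdivrMr// mul1r ler_nat.
exact: leqnSn.
Qed.

End total_variation_absolute_continuity.

Section absolutely_continuous_density.
Context {R : realType}.
Notation mu := (@lebesgue_measure R).
Implicit Types (a b x y : R) (G : R -> R).

Lemma itvs_from_iota b z (x y : nat -> R) (k m : nat) :
  (forall i, x i <= y i) -> (forall i, y i <= x i.+1) -> z <= x k ->
  x (k + m)%N <= b ->
  itvs_from b z [seq (x i, y i) | i <- iota k m].
Proof.
move=> xy yx; elim: m k z => [|m IH] k z /= zk kb.
  by rewrite addn0 in kb; exact: le_trans kb.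
by split => //; apply: IH; rewrite ?yx// addSnnS.
Qed.

Lemma cell_of_point (x : nat -> R) (t : R) n : x 0%N < t -> t <= x n ->
  exists2 i, (i < n)%N & x i < t <= x i.+1.
Proof.
move=> x0; elim: n => [|n IH] tn; first by have := lt_le_trans x0 tn; rewrite ltxx.
have [/IH[i i_n it]|nt] := leP t (x n); first by exists i => //; exact: ltnW.
by exists n => //; rewrite nt.
Qed.

(** The open set is exhausted from inside by finite unions of grid cells. Absolute continuity of [G]
    bounds the [nu]-measure of each such union, and continuity from below passes to the limit. *)
Lemma open_measure_le a b (d e : R) G
    (nu : {measure set (measurableTypeR R) -> \bar R}) (U : set R) :
  a < b ->
  (forall x y, a <= x -> x <= y -> y <= b -> nu `]x, y]%classic = (G y - G x)%:E) ->
  (forall s, itvs_from b a s -> \sum_(p <- s) (p.2 - p.1) < d ->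
    \sum_(p <- s) `|G p.2 - G p.1| < e) ->
  open U -> (mu U < d%:E)%E -> (nu (U `&` `]a, b]%classic) <= e%:E)%E.
Proof.
move=> ab nuE Gd oU Ud.
have mU : measurable U by exact: open_measurable.
pose h N : R := (b - a) / N.+1%:R.
have h0 N : 0 < h N by rewrite divr_gt0 ?subr_gt0.
pose x N i : R := a + i%:R * h N.
have xS N i : x N i.+1 = x N i + h N by rewrite /x -natr1; ring.
have x0 N : x N 0%N = a by rewrite /x mul0r addr0.
have xN N : x N N.+1 = b.
  rewrite /x /h mulrCA divff ?mulr1; last by rewrite pnatr_eq0.
  by rewrite addrC subrK.
have x_mono N i j : (i <= j)%N -> x N i <= x N j.
  by move=> ij; rewrite lerD2l ler_pM2r// ler_nat.
(* A cell that is not inside [U] is collapsed to an empty interval, so the family stays indexed by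
   the whole grid and ordered. *)
pose y N i := if `[< `]x N i, x N i.+1]%classic `<=` U >] then x N i.+1 else x N i.
have xy N i : x N i <= y N i by rewrite /y; case: ifP; rewrite // xS lerDl ltW.
have yx N i : y N i <= x N i.+1 by rewrite /y; case: ifP; rewrite // xS lerDl ltW.
pose V N := \big[setU/set0]_(i < N.+1) `]x N i, y N i]%classic.
have tV N : trivIset setT (fun i : 'I_N.+1 => `]x N i, y N i]%classic).
  apply/trivIsetP => i j _ _ ij; rewrite -subset0 => t /= [].
  rewrite !in_itv/= => /andP[it ti] /andP[jt tj].
  have {ij} : (i : nat) != j by [].
  rewrite neq_ltn => /orP[] ij; have := x_mono N _ _ ij => xij.
    by have := le_lt_trans (le_trans ti (le_trans (yx N i) xij)) jt; rewrite ltxx.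
  by have := le_lt_trans (le_trans tj (le_trans (yx N j) xij)) it; rewrite ltxx.
have mC N (i : 'I_N.+1) : measurable (`]x N i, y N i]%classic : set R).
  exact: measurable_itv.
have mV N : measurable (V N) by apply: bigsetU_measurable.
have VU N : V N `<=` U.
  move=> t; rewrite /V -(bigcup_mkord N.+1 (fun i => `]x N i, y N i]%classic)) => -[i _] /=.
  rewrite /y; case: asboolP => [+|_]; first by apply.
  by rewrite in_itv/= => /andP[/lt_le_trans h1 /h1]; rewrite ltxx.
have abs N : itvs_from b a [seq (x N i, y N i) | i <- iota 0 N.+1].
  by apply: itvs_from_iota => //; rewrite ?add0n ?xN ?x0.
have nuV N : (nu (V N) <= e%:E)%E.
  rewrite /V measure_semi_additive_ord//; last exact: mV.
  have -> : (\sum_(i < N.+1) nu `]x N i, y N i]%classic =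
      (\sum_(p <- [seq (x N i, y N i) | i <- iota 0 N.+1]) (G p.2 - G p.1))%:E)%E.
    rewrite big_map -[iota _ _]/(index_iota 0 N.+1) big_mkord -sumEFin.
    apply: eq_bigr => i _ /=; rewrite nuE//.
      by rewrite -(x0 N) x_mono.
    by rewrite (le_trans (yx N i))// -(xN N) x_mono.
  rewrite lee_fin ltW// (le_lt_trans (ler_norm _))// (le_lt_trans (ler_norm_sum _ _ _))//.
  apply: Gd => //; rewrite -lte_fin; apply: le_lt_trans Ud.
  have -> : ((\sum_(p <- [seq (x N i, y N i) | i <- iota 0 N.+1]) (p.2 - p.1))%:E
      = mu (V N))%E.
    rewrite /V measure_semi_additive_ord//; last exact: mV.
    rewrite big_map -[iota _ _]/(index_iota 0 N.+1) big_mkord -sumEFin.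
    apply: eq_bigr => i _ /=; rewrite lebesgue_measure_itv/= lte_fin.
    case: ltP => // yx'; have -> : y N i = x N i by apply/eqP; rewrite eq_le xy yx'.
    by rewrite subrr.
  by rewrite le_measure ?inE//; exact: mV.
(* The sets [V N] need not increase with [N], but their tail intersections do. A point of [U] lies
   in all [V N] with a mesh smaller than its distance to the complement of [U]. *)
pose W M := \bigcap_(N in [set N | (M <= N)%N]) V N.
have mW M : measurable (W M) by apply: bigcap_measurable => //; exists M => /=.
have UW : U `&` `]a, b]%classic `<=` \bigcup_M W M.
  move=> t [Ut]; rewrite /= in_itv/= => /andP[a_t t_b].
  have /nbhs_ballP[r /= r0 rU] : nbhs t U by exact: open_nbhs_nbhs.
  exists (Num.bound ((b - a) / r)) => // N /= rN.
  have hr : h N < r.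
    rewrite /h ltr_pdivrMr// mulrC -ltr_pdivrMr//.
    rewrite (lt_le_trans (archi_boundP _)) ?ler_nat ?(leq_trans rN)//.
    by rewrite divr_ge0// ?subr_ge0 ltW.
  have [|//|i iN /andP[it ti]] := @cell_of_point (x N) t N.+1; rewrite ?x0 ?xN//.
  rewrite /V -(bigcup_mkord N.+1 (fun i => `]x N i, y N i]%classic)); exists i => //=.
  have -> : y N i = x N i.+1.
    rewrite /y; case: asboolP => // -[] s /=.
    rewrite in_itv/= => /andP[h1 h2]; apply: rU => /=.
    rewrite /ball/= ltr_distlC; move: hr it ti h1 h2; rewrite xS; lra.
  by rewrite in_itv/= it.
have ndW : nondecreasing_seq W.
  move=> M N MN; apply/subsetPset => t WM K /= NK; apply: WM => /=.
  exact: leq_trans NK.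
have nuW := @nondecreasing_cvg_mu _ _ _ nu _ mW
  (bigcup_measurable (fun M _ => mW M)) ndW.
apply: (@le_trans _ _ (nu (\bigcup_M W M))).
  rewrite le_measure ?inE//; first exact: measurableI.
  exact: (bigcup_measurable (fun M _ => mW M)).
have <- : limn (nu \o W) = nu (\bigcup_M W M) by exact/cvg_lim.
apply: lime_le; first by apply/cvg_ex; eexists; exact: nuW.
near=> M; apply: le_trans (nuV M); rewrite le_measure ?inE//; last by move=> t; apply => /=.
  exact: mW.
exact: mV.
Unshelve. all: by end_near. Qed.

End absolutely_continuous_density.

Section absolutely_continuous_density.
Context {R : realType}.
Notation mu := (@lebesgue_measure R).
Implicit Types (a b x y : R) (F G : R -> R).

Lemma nondecreasing_stieltjes a b G : a < b ->
  {in `[a, b] &, nondecreasing_fun G} -> seq_absolutely_continuous a b G ->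
  exists nu : {measure set (measurableTypeR R) -> \bar R},
    forall x y, a <= x -> x <= y -> y <= b ->
      nu `]x, y]%classic = (G y - G x)%:E.
Proof.
move=> ab ndG acG.
(* Clamping to [[a, b]] extends [G] by constants to the line. The clamp is nondecreasing and
   1-Lipschitz, so [G \o k] is nondecreasing and inherits right continuity from the absolute
   continuity of [G]. *)
pose k x := Num.max a (Num.min b x).
have ka x : a <= k x by rewrite le_max lexx.
have kb x : k x <= b by rewrite ge_max ge_min lexx (ltW ab).
have k_id x : a <= x -> x <= b -> k x = x.
  by move=> ax xb; rewrite /k (min_r xb) (max_r ax).
have k_mono x y : x <= y -> k x <= k y.
  move=> xy; rewrite {1}/k ge_max ka /= le_max; apply/orP; right.
  by rewrite le_min !ge_min lexx xy orbT.
have k_lip x y : x <= y -> k y - k x <= y - x.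
  move=> xy; rewrite lerBlDr {1}/k ge_max; apply/andP; split.
    by have := ka x; lra.
  rewrite ge_min; apply/orP; have [xb|bx] := leP x b.
    have : x <= k x by rewrite le_max le_min lexx xb orbT.
    by right; lra.
  have : b <= k x by rewrite le_max le_min lexx (ltW bx) orbT.
  by left; lra.
have ndGk : {homo G \o k : x y / x <= y}.
  by move=> x y xy; apply: ndG; rewrite ?in_itv/= ?ka ?kb// k_mono.
have rcGk : right_continuous (G \o k).
  move=> x; apply/cvgrPdist_lt => e e0; have [d d0 Gd] := acG _ e0.
  near=> y; have xy : x <= y by near: y; exact: nbhs_right_ge.
  have yd : y - x < d.
    by rewrite ltrBlDl; near: y; apply: nbhs_right_lt; rewrite ltrDl.
  have := Gd [:: (k x, k y)]; rewrite !big_seq1 /= distrC; apply.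
    by split; [exact: ka|exact: k_mono|exact: kb].
  exact: le_lt_trans (k_lip _ _ xy) yd.
pose g : cumulative R R := HB.pack (G \o k) (isCumulative.Build R _ R (G \o k) ndGk rcGk).
exists (lebesgue_stieltjes_measure g) => x y ax xy yb.
transitivity (wlength g `]x, y]%classic).
  exact: (@measurable_mu_extE _ _ _ (wlength g) _ (is_ocitv x y)).
by rewrite wlength_itv_bnd//= !k_id// (le_trans ax, le_trans xy).
Unshelve. all: by end_near. Qed.

(** The Stieltjes measure, restricted to []a, b]] to be finite, is dominated by Lebesgue measure: a
    null set lies in open sets of arbitrarily small measure, to which [open_measure_le] applies. *)
Lemma nondecreasing_absolutely_continuous_density a b G : a < b ->
  {in `[a, b] &, nondecreasing_fun G} -> seq_absolutely_continuous a b G ->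
  exists2 g : R -> R, mu.-integrable setT (EFin \o g) &
    forall t, a <= t <= b -> G t = G a + \int[mu]_(s in `]a, t]) g s.
Proof.
move=> ab ndG acG; have [nu nuE] := nondecreasing_stieltjes ab ndG acG.
have mab : measurable (`]a, b]%classic : set (measurableTypeR R)).
  exact: measurable_itv.
have nuoo : (nu `]a, b]%classic < +oo)%E by rewrite nuE ?ltry// ltW.
pose nu' := mfrestr mab nuoo.
have nudom : nu' `<< mu.
  apply/null_content_dominatesP => A mA muA0.
  apply/eqP; rewrite eq_le measure_ge0 andbT; apply/lee_addgt0Pr => e e0.
  rewrite add0e; have [d d0 Gd] := acG _ e0.
  have muAoo : (mu A < +oo)%E by rewrite muA0.
  have [U [oU AU UA]] := lebesgue_regularity_outer mA muAoo d0.
  have Ud : (mu U < d%:E)%E.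
    have mU : measurable U by exact: open_measurable.
    apply: le_lt_trans UA; rewrite -[leRHS]add0e -muA0 -measureU//.
    - by rewrite le_measure ?inE//; [exact: measurableU _ (measurableD _ _)|
        move=> t Ut; have [At|At] := pselect (A t); [left|right]].
    - exact: measurableD.
    - by rewrite setDIK.
  apply: le_trans (open_measure_le ab nuE Gd oU Ud).
  have mU : measurable U by exact: open_measurable.
  by rewrite /nu'/= /mfrestr /mrestr le_measure ?inE//;
    [exact: measurableI|exact: measurableI|exact: setSI].
have [f [_ ffin intf fE]] := @radon_nikodym_sigma_finite _ _ _ mu nu' nudom.
have fEg : EFin \o (fine \o f) = f by apply/funext => t /=; rewrite fineK.
exists (fine \o f); first by rewrite fEg.
move=> t /andP[a_t t_b]; rewrite /Rintegral.
have := fE `]a, t]%classic (measurable_itv _).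
rewrite /nu'/= /mfrestr /mrestr setIidl; last by apply: subset_itvl; rewrite bnd_simp.
rewrite nuE// => nut.
under eq_integral do rewrite fineK//.
by rewrite -nut /= addrC subrK.
Qed.

Lemma absolutely_continuous_density a b F : a < b ->
  absolutely_continuous a b F ->
  exists2 g : R -> R, mu.-integrable setT (EFin \o g) &
    forall t, a <= t <= b -> F t = F a + \int[mu]_(s in `]a, t]) g s.
Proof.
move=> ab /absolutely_continuous_seq acF.
have bvF := seq_absolutely_continuous_bounded_variation (ltW ab) acF.
pose T x := fine (total_variation a x F).
have acT := seq_absolutely_continuous_total_variation (ltW ab) acF.
have ndT : {in `[a, b] &, nondecreasing_fun T}.
  move=> x y; rewrite !in_itv/= => /andP[ax _] /andP[_ yb] xy.
  by rewrite -subr_ge0 (le_trans _ (fine_total_variation_le bvF ax xy yb)).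
(* Jordan decomposition $F = T - (T - F)$: an increment of [F] never exceeds that of its total
   variation [T]. *)
have ndTF : {in `[a, b] &, nondecreasing_fun (T \- F)}.
  move=> x y; rewrite !in_itv/= => /andP[ax _] /andP[_ yb] xy.
  have := fine_total_variation_le bvF ax xy yb.
  move=> /(le_trans (ler_norm _)); rewrite -/(T x) -/(T y); lra.
have acTF := seq_absolutely_continuousB acT acF.
have [g intg gE] := nondecreasing_absolutely_continuous_density ab ndT acT.
have [h inth hE] := nondecreasing_absolutely_continuous_density ab ndTF acTF.
exists (g \- h).
  by have := integrableB measurableT intg inth; apply: eq_integrable.
move=> t abt; rewrite RintegralB//.
- by have := gE _ abt; have := hE _ abt; rewrite /T /=; lra.
- exact: integrableS intg.
- exact: integrableS inth.
Qed.

End absolutely_continuous_density.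

(** * Integrals up to null sets, and primitives *)

Section ae_integral.
Context d (T : measurableType d) (R : realType) (mu : {measure set T -> \bar R}).
Local Open Scope ereal_scope.
Import HBNNSimple.

(** The integral is a supremum over simple functions below [f]. Setting such a function to 0 on [N]
    keeps its integral and puts it below [g] everywhere, so neither [f] nor [g] has to be
    measurable. *)
Lemma ge0_le_integral_negligible (f g : T -> \bar R) (N : set T) :
  (forall x, 0 <= f x) -> (forall x, 0 <= g x) -> measurable N -> mu N = 0 ->
  (forall x, ~ N x -> f x <= g x) -> \int[mu]_x f x <= \int[mu]_x g x.
Proof.
move=> f0 g0 mN N0 fg; rewrite !ge0_integralTE//.
apply: ge_ereal_sup => _ [h /= hf <-].
pose h' := proj_nnsfun h (measurableC mN).
have -> : sintegral mu h = sintegral mu h'.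
  rewrite -!integralT_nnsfun; apply: ge0_ae_eq_integral => //.
  - exact/measurable_EFinP.
  - exact/measurable_EFinP.
  - by move=> x _; rewrite lee_fin; exact: fun_ge0.
  - by move=> x _; rewrite lee_fin; exact: fun_ge0.
  exists N; split => // x /= /not_implyP[_]; apply: contra_notP => Nx.
  by rewrite /= mindicE mem_set//= mulr1.
apply: ereal_sup_ubound; exists h' => // x /=; rewrite mindicE.
have [xN|xN] := boolP (x \in ~` N); last by rewrite mulr0.
by rewrite mulr1 (le_trans (hf x))// fg//; rewrite inE in xN.
Qed.

(* Unlike [ae_eq_integral], no measurability is needed. *)
Lemma eq_integral_ae (D : set T) (f g : T -> \bar R) :
  {ae mu, forall x, D x -> f x = g x} ->
  \int[mu]_(x in D) f x = \int[mu]_(x in D) g x.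
Proof.
move=> [N [mN N0 fgN]]; rewrite integral_mkcond [RHS]integral_mkcond.
have fgE x : ~ N x -> (f \_ D) x = (g \_ D) x.
  move=> Nx; rewrite !patchE; case: ifPn => // xD.
  apply: contrapT => fg; apply: Nx; apply: fgN => /= fg'.
  by apply: fg; apply: fg'; exact: set_mem.
rewrite integralE [RHS]integralE; congr (_ - _); apply/eqP; rewrite eq_le;
  by apply/andP; split; apply: (@ge0_le_integral_negligible _ _ N) => // x Nx;
     rewrite ?funeposE ?funenegE fgE.
Qed.

Lemma eq_Rintegral_ae (D : set T) (f g : T -> R) :
  {ae mu, forall x, D x -> f x = g x} ->
  (\int[mu]_(x in D) f x = \int[mu]_(x in D) g x)%R.
Proof.
move=> fg; congr fine; apply: eq_integral_ae.
by apply: filterS fg => x /[apply] ->.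
Qed.

End ae_integral.

(* Instance resolution does not find [ae_filter_ringOfSetsType] for Lebesgue measure. *)
#[export] Instance ae_lebesgue_filter (R : realType) :
  Filter (nbhs (almost_everywhere (@lebesgue_measure R))).
Proof. exact: ae_filter_ringOfSetsType. Qed.

(** * Differentiating integrals and integrating derivatives *)

Section ftc.
Context {R : realType}.
Notation mu := (@lebesgue_measure R).
Implicit Types (a b c t x y : R) (f g h F : R -> R).

Lemma eq_in_oo_derive a b F f : {in `]a, b[, F =1 f} ->
  {in `]a, b[, forall t, derive1 F t = derive1 f t /\
                         (derivable F t 1 <-> derivable f t 1)}.
Proof.
move=> Ff t tab.
have nFf : {near t, F =1 f}.
  near=> s; apply: Ff; near: s; exact: near_in_itvoo.
split; first by rewrite !derive1E; apply: near_eq_derive.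
split; apply: near_eq_derivable => //.
by near=> s; apply/esym; near: s.
Unshelve. all: by end_near. Qed.

Lemma derivable_cst_add c F t : derivable F t 1 ->
  derivable (fun s => c + F s) t 1 /\ derive1 (fun s => c + F s) t = derive1 F t.
Proof.
move=> dF; have dc : derivable (cst c : R -> R) t 1 by exact: derivable_cst.
split; first exact: (derivableD dc dF).
by rewrite !derive1E (deriveD dc dF) derive_cst add0r.
Qed.

(** Lebesgue's differentiation theorem, applied to the extension of [g] by 0, which is integrable on
    the line. *)
Lemma integral_derive_ae a b g (F := fun t => \int[mu]_(s in `]a, t[) g s) :
  mu.-integrable `]a, b[ (EFin \o g) ->
  {ae mu, forall t, t \in `]a, b[ -> derivable F t 1 /\ derive1 F t = g t}.
Proof.
move=> intg; pose h := g \_ `]a, b[.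
have inth : mu.-integrable setT (EFin \o h).
  by rewrite -restrict_EFin; apply/integrable_restrict => //=; rewrite setTI.
have /lebesgue_differentiation : locally_integrable setT h.
  by apply: open_integrable_locally => //; exact: openT.
apply: filterS => t ht tab.
have /andP[a_t tb] : a < t < b by move: tab; rewrite in_itv.
have := @FTC1_lebesgue_pt _ h (BRight a) t b tb _ _ ht.
have -> : h t = g t by rewrite /h patchE mem_set.
move=> [||dF F't].
- exact: integrableS inth.
- by rewrite lte_fin.
have HF : {in `]a, b[, F =1 (fun y => \int[mu]_(s in `]a, y]) h s)}.
  move=> y; rewrite in_itv/= => /andP[ay yb]; rewrite /F -Rintegral_itv_bndo_bndc//.
    apply: eq_Rintegral => s; rewrite inE/= in_itv/= => /andP[as_ sy].
    by rewrite /h patchE mem_set//= in_itv/= as_ (lt_trans sy).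
  exact: integrableS inth.
have [-> HF'] := eq_in_oo_derive HF tab.
split; [exact: (HF'.2 dF)|exact: F't].
Qed.

End ftc.

Section ftc.
Context {R : realType}.
Notation mu := (@lebesgue_measure R).
Implicit Types (a b c t x y : R) (f g h F v W : R -> R).

Lemma integral_itvB_oo a b g x y : mu.-integrable `]a, b[ (EFin \o g) ->
  a <= x -> x <= y -> y <= b ->
  \int[mu]_(s in `]a, y[) g s - \int[mu]_(s in `]a, x[) g s =
  \int[mu]_(s in `[x, y[) g s.
Proof.
move=> intg ax xy yb.
have [<-|ax'] := eqVneq a x.
  rewrite [X in _ - X](_ : _ = 0) ?subr0.
    by rewrite -Rintegral_itv_obnd_cbnd//; apply: integrableS intg => //;
      apply: subset_itvl.
  by rewrite set_itvoo0// Rintegral_set0.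
have axlt : a < x by rewrite lt_neqAle ax' ax.
rewrite [X in _ - X]Rintegral_itv_bndo_bndc; last first.
  by apply: integrableS intg => //; apply: subset_itvl; rewrite bnd_simp (le_trans xy).
have [xy'|] := ltP x y; last first.
  move=> yx; have -> : x = y by apply/eqP; rewrite eq_le xy yx.
  rewrite -Rintegral_itv_bndo_bndc ?subrr ?set_itvco0 ?Rintegral_set0//.
  by apply: integrableS intg => //; apply: subset_itvl; rewrite bnd_simp.
rewrite Rintegral_itvB ?bnd_simp ?ltW//.
  rewrite Rintegral_itv_obnd_cbnd//; apply: integrableS intg => //.
  by apply: subset_itv; rewrite bnd_simp.
by apply: integrableS intg => //; apply: subset_itvl; rewrite bnd_simp.
Qed.

Lemma absolutely_continuous_integral a b c g : mu.-integrable `]a, b[ (EFin \o g) ->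
  absolutely_continuous a b (fun t => c + \int[mu]_(s in `]a, t[) g s).
Proof.
move=> intg e e0; pose h := g \_ `]a, b[.
have inth : mu.-integrable setT (EFin \o h).
  by rewrite -restrict_EFin; apply/integrable_restrict => //=; rewrite setTI.
have [d [d0 hd]] := integral_normr_continuous inth e0.
exists d => // N x y xyab yx xyd.
(* Half-open intervals stay disjoint when consecutive ones share an endpoint. *)
pose D := \big[setU/set0]_(i < N) (`[x i, y i[%classic : set R).
have x_mono i j : (i < j)%N -> (j < N)%N -> y i <= x j.
  elim: j => // j IH; rewrite ltnS leq_eqVlt => /predU1P[->|ij] jN; first exact: yx.
  apply: le_trans (yx _ jN); apply: (le_trans (IH ij (ltnW jN))).
  by have [_ []] := xyab _ (ltnW jN).
have tD : trivIset setT (fun i : 'I_N => `[x i, y i[%classic : set R).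
  apply/trivIsetP => i j _ _ ij; rewrite -subset0 => t /= [].
  rewrite !in_itv/= => /andP[it ti] /andP[jt tj].
  have {ij} : (i : nat) != j by [].
  rewrite neq_ltn => /orP[] ij.
    by have := lt_le_trans (lt_le_trans ti (x_mono _ _ ij (ltn_ord j))) jt; rewrite ltxx.
  by have := lt_le_trans (lt_le_trans tj (x_mono _ _ ij (ltn_ord i))) it; rewrite ltxx.
have mC (i : 'I_N) : measurable (`[x i, y i[%classic : set R).
  exact: measurable_itv.
have mD : measurable D by apply: bigsetU_measurable => i _; exact: mC.
have muD : (mu D < d%:E)%E.
  rewrite /D measure_semi_additive_ord//.
  rewrite (eq_bigr (fun i : 'I_N => (y i - x i)%:E)) ?sumEFin ?lte_fin//.
  move=> i _; have [_ [xy _]] := xyab i (ltn_ord i).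
  rewrite /= lebesgue_measure_itv/= lte_fin -EFinB.
  by case: ltgtP xy => // ->; rewrite subrr.
apply: le_lt_trans (hd _ mD muD).
have -> : \int[mu]_(s in D) `|h s| = \sum_(i < N) \int[mu]_(s in `[x i, y i[) `|h s|.
  have inthN A : measurable A -> mu.-integrable A (EFin \o (fun s => `|h s|)).
    by move=> mA; apply: integrable_norm; exact: integrableS inth.
  rewrite /Rintegral /D integral_bigsetU_EFin//.
  - rewrite -sum_fine// => i _; apply: integrable_fin_num => //.
    by apply: inthN; exact: measurable_itv.
  - exact: index_enum_uniq.
  - exact: sub_trivIset tD.
  - exact: (measurable_int mu (inthN _ mD)).
apply: ler_sum => i _; have [ax [xy yb]] := xyab i (ltn_ord i).
rewrite opprD addrACA subrr add0r (integral_itvB_oo intg ax xy yb).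
have sub_ab : `]x i, y i[ `<=` `]a, b[.
  by apply: subset_itv; rewrite bnd_simp.
have -> : \int[mu]_(s in `[x i, y i[) g s = \int[mu]_(s in `]x i, y i[) h s.
  rewrite -Rintegral_itv_obnd_cbnd//; last exact: integrableS intg.
  by apply: eq_Rintegral => s; rewrite inE/= => /sub_ab sab; rewrite /h patchE mem_set.
have intxy A : measurable A -> mu.-integrable A (EFin \o h).
  by move=> mA; exact: integrableS inth.
apply: le_trans (le_normr_Rintegral _ (intxy _ (measurable_itv _))) _ => //.
rewrite -Rintegral_itv_obnd_cbnd//.
by apply: integrable_norm; exact: intxy.
Qed.

Lemma absolutely_continuous_continuous a b F : a < b -> absolutely_continuous a b F ->
  {within `[a, b], continuous F}.
Proof.
move=> ab /absolutely_continuous_seq acF; apply/subspace_continuousP => x.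
rewrite /= in_itv/= => /andP[ax xb]; apply/cvgrPdist_lt => e e0.
have [d d0 Fd] := acF _ e0.
rewrite /prop_near1 /= nbhs_simpl /within/=; near=> y => yab.
move: yab; rewrite in_itv/= => /andP[ay yb].
have xyd : `|x - y| < d by near: y; apply/nbhs_ballP; exists d.
have [xy|yx] := leP x y.
  have := Fd [:: (x, y)]; rewrite !big_seq1 /= distrC; apply => //.
  by rewrite -[ltLHS]ger0_norm ?subr_ge0// distrC.
have := Fd [:: (y, x)]; rewrite !big_seq1 /=; apply => //.
  by split => //; exact: ltW.
by rewrite -[ltLHS]ger0_norm ?subr_ge0// ltW.
Unshelve. all: by end_near. Qed.

Lemma integral_cvg_at_right a b c g : a < b -> mu.-integrable `]a, b[ (EFin \o g) ->
  (c + \int[mu]_(s in `]a, t[) g s) @[t --> a^'+] --> c.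
Proof.
move=> ab intg.
have := absolutely_continuous_continuous ab (absolutely_continuous_integral c intg).
move=> /(continuous_within_itvP _ ab)[_ + _].
by rewrite set_itvoo0// Rintegral_set0 addr0.
Qed.

Lemma derivable_ftc a b W v : a < b ->
  {in `]a, b[, forall t, derivable W t 1 /\ derive1 W t = v t} ->
  {in `]a, b[, continuous v} -> mu.-integrable `]a, b[ (EFin \o v) ->
  exists c, {in `]a, b[, forall t, W t = c + \int[mu]_(s in `]a, t[) v s}.
Proof.
move=> ab dW cv intv; pose I t := \int[mu]_(s in `]a, t[) v s.
have WI x y : a < x -> x < y -> y < b -> W y - W x = I y - I x.
  move=> ax xy yb; have xyab t : x <= t <= y -> t \in `]a, b[.
    by move=> /andP[xt ty]; rewrite in_itv/= (lt_le_trans ax)// (le_lt_trans ty).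
  have /(congr1 fine) : (\int[mu]_(t in `[x, y]) (v t)%:E = (W y)%:E - (W x)%:E)%E.
    apply: continuous_FTC2 => //.
    - apply/(continuous_within_itvP _ xy); split.
      + move=> t; rewrite in_itv/= => /andP[xt ty]; apply: cv; apply: xyab.
        by rewrite !ltW.
      + by apply: cvg_at_right_filter; apply: cv; apply: xyab; rewrite lexx ltW.
      + by apply: cvg_at_left_filter; apply: cv; apply: xyab; rewrite lexx ltW.
    - have cW t : x <= t <= y -> {for t, continuous W}.
        move=> /xyab/dW[/derivable1_diffP dWt _]; exact: differentiable_continuous.
      split.
      + move=> t; rewrite in_itv/= => /andP[xt ty].
        by have [] := dW t (xyab t _); rewrite ?ltW.
      + by apply: cvg_at_right_filter; apply: cW; rewrite lexx ltW.
      + by apply: cvg_at_left_filter; apply: cW; rewrite lexx ltW.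
    - move=> t; rewrite in_itv/= => /andP[xt ty].
      by have [] := dW t (xyab t _); rewrite ?ltW.
  rewrite [in X in _ = X -> _]/= => <-.
  rewrite /I (integral_itvB_oo intv); [|exact: ltW..].
  rewrite Rintegral_itv_bndo_bndc//.
  apply: integrableS intv => // t /=; rewrite in_itv /= => /andP[xt ty].
  by apply: xyab; rewrite xt (ltW ty).
(* No limit of [W] at [a] is known beforehand, so the constant is read off at the midpoint. *)
pose m := (a + b) / 2; exists (W m - I m) => t; rewrite in_itv/= => /andP[a_t tb].
have am : a < m by rewrite midf_lt.
have mb : m < b by rewrite midf_lt.
rewrite -/(I t); have [mt|tm|<-] := ltgtP m t; last lra.
- by have := WI _ _ am mt tb; lra.
- by have := WI _ _ a_t tm mb; lra.
Qed.

Lemma continuous_integral_derive a b c v :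
  {in `]a, b[, continuous v} -> mu.-integrable `]a, b[ (EFin \o v) ->
  {in `]a, b[, forall t, derivable (fun t => c + \int[mu]_(s in `]a, t[) v s) t 1 /\
    derive1 (fun t => c + \int[mu]_(s in `]a, t[) v s) t = v t}.
Proof.
move=> cv intv t tab; have := tab; rewrite in_itv/= => /andP[a_t tb].
pose u := (t + b) / 2; have tu : t < u by rewrite midf_lt.
have ub : u < b by rewrite midf_lt.
have intvu : mu.-integrable [set` Interval (BRight a) (BRight u)] (EFin \o v).
  by apply: integrableS intv => //; apply: subset_itvl; rewrite bnd_simp.
have /= := continuous_FTC1 tu intvu.
rewrite lte_fin => /(_ a_t (cv _ tab))[dI I't].
have HF : {in `]a, b[, (fun y => \int[mu]_(s in `]a, y[) v s) =1
                       (fun y => \int[mu]_(s in `]a, y]) v s)}.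
  move=> y; rewrite in_itv/= => /andP[ay yb]; rewrite Rintegral_itv_bndo_bndc//.
  by apply: integrableS intv => //; apply: subset_itvl; rewrite bnd_simp ltW.
have [e1 e2] := eq_in_oo_derive HF tab.
have [dcI cI't] := derivable_cst_add c (e2.2 dI).
by split; [exact: dcI|rewrite cI't e1].
Qed.

End ftc.

Section ge0_ftc_oo.
Context {R : realType}.
Notation mu := (@lebesgue_measure R).
Implicit Types (a b c t x y : R) (f g h F v W : R -> R).

Lemma continuous_oo_measurable a b f : {in `]a, b[, continuous f} ->
  measurable_fun `]a, b[ f.
Proof.
move=> cf; apply: open_continuous_measurable_fun; first exact: interval_open.
by move=> x /set_mem /= xab; apply: cf.
Qed.

(** The derivative [f] may blow up at both ends. The classical theorem holds on compact
    subintervals, and positivity of [f] allows monotone convergence. The integral is extended-real,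
    so the equality also gives integrability. *)
Lemma ge0_ftc_oo a b (la lb : R) f F : a < b ->
  {in `]a, b[, forall t, [/\ 0 <= f t, derivable F t 1 & derive1 F t = f t]} ->
  {in `]a, b[, continuous f} ->
  F t @[t --> a^'+] --> la -> F t @[t --> b^'-] --> lb ->
  (\int[mu]_(t in `]a, b[) (f t)%:E = (lb - la)%:E)%E.
Proof.
move=> ab dF cf Fa Fb.
(* The denominator [n + 3] makes [d n] at most a third of the length, so the inner interval is never
   degenerate. *)
pose d (n : nat) : R := (b - a) / (n + 2).+1%:R.
have d0 n : 0 < d n by rewrite divr_gt0 ?subr_gt0.
have dmid n : a + d n < b - d n.
  have : d n * 3 <= b - a.
    rewrite /d mulrAC ler_pdivrMr// ler_pM2l ?subr_gt0//.
    by rewrite ler_nat addnC.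
  by have := d0 n; lra.
have dnd n m : (n <= m)%N -> d m <= d n.
  move=> nm; rewrite ler_pM2l ?subr_gt0// lef_pV2 ?posrE//.
  by rewrite ler_nat ltnS leq_add2r.
have d_cvg : d n @[n --> \oo] --> 0.
  rewrite -[X in _ --> X](mulr0 (b - a)); apply: cvgM; first exact: cvg_cst.
  have := @cvg_harmonic R; rewrite -(cvg_shiftn 2); exact.
pose K n : set R := `[a + d n, b - d n]%classic.
have Kab n : K n `<=` `]a, b[.
  move=> t; rewrite /K/= !in_itv/= => /andP[ht1 ht2].
  have := d0 n; move: ht1 ht2 => ht1 ht2 dn0; apply/andP; split; lra.
have KE : \bigcup_n K n = `]a, b[%classic.
  apply/seteqP; split; first by move=> t [n _]; exact: Kab.
  move=> t /=; rewrite in_itv/= => /andP[a_t tb].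
  have e0 : 0 < Num.min (t - a) (b - t) by rewrite lt_min !subr_gt0 a_t.
  have /cvgrPdist_lt/(_ _ e0)[n _ dn] := d_cvg.
  exists n => //; have := dn n (leqnn n).
  rewrite sub0r normrN gtr0_norm// lt_min => /andP[h1 h2].
  by rewrite /K/= in_itv/=; lra.
have intK n : (\int[mu]_(t in K n) (f t)%:E = (F (b - d n))%:E - (F (a + d n))%:E)%E.
  have xyab t : a + d n <= t <= b - d n -> t \in `]a, b[.
    by move=> h; apply: (Kab n); rewrite /K/= in_itv.
  have xy := dmid n.
  have cF t : a + d n <= t <= b - d n -> {for t, continuous F}.
    move=> /xyab/dF[_ /derivable1_diffP dFt _]; exact: differentiable_continuous.
  apply: continuous_FTC2 => //.
  - apply/(continuous_within_itvP _ xy); split.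
    + move=> t; rewrite in_itv/= => /andP[xt ty]; apply: cf; apply: xyab.
      by rewrite !ltW.
    + by apply: cvg_at_right_filter; apply: cf; apply: xyab; rewrite lexx ltW.
    + by apply: cvg_at_left_filter; apply: cf; apply: xyab; rewrite lexx ltW.
  - split.
    + move=> t; rewrite in_itv/= => /andP[xt ty].
      have /xyab/dF[] // : a + d n <= t <= b - d n by rewrite !ltW.
    + by apply: cvg_at_right_filter; apply: cF; rewrite lexx ltW.
    + by apply: cvg_at_left_filter; apply: cF; rewrite lexx ltW.
  - move=> t; rewrite in_itv/= => /andP[xt ty].
    have /xyab/dF[] // : a + d n <= t <= b - d n by rewrite !ltW.
have mf := continuous_oo_measurable cf.
have ndK : nondecreasing_seq K.
  move=> n m nm; apply/subsetPset; apply: subset_itv; rewrite bnd_simp.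
    by rewrite lerD2l dnd.
  by rewrite lerD2l lerN2 dnd.
have mK i : measurable (K i) by exact: measurable_itv.
have cvgK : ((F (b - d n))%:E - (F (a + d n))%:E @[n --> \oo] -->
    \int[mu]_(x in \bigcup_i K i) (f x)%:E)%E.
  rewrite -(eq_cvg _ _ intK); apply: (@ge0_nondecreasing_set_cvg_integral _ (measurableTypeR R)) => //.
    by move=> n; apply/measurable_EFinP; apply: measurable_funS mf.
  by move=> n t /Kab/dF[+ _ _]; rewrite lee_fin.
rewrite -KE; apply: (cvg_unique _ cvgK) => //.
rewrite EFinB; apply: cvgeB => //.
- apply: cvg_EFin; first exact: nearW.
  apply: ((cvg_at_leftP F b lb).1 Fb); split.
    by move=> n; rewrite ltrBlDr ltrDl.
  by rewrite -[X in _ --> X](subr0 b); apply: cvgB => //; exact: cvg_cst.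
- apply: cvg_EFin; first exact: nearW.
  apply: ((cvg_at_rightP F a la).1 Fa); split.
    by move=> n; rewrite ltrDl.
  by rewrite -[X in _ --> X](addr0 a); apply: cvgD => //; exact: cvg_cst.
Unshelve. all: by end_near. Qed.

End ge0_ftc_oo.

(** * The Beta integral *)

Lemma Rintegral_gt0 d (T : measurableType d) (R : realType)
    (mu : {measure set T -> \bar R}) (D : set T) (f : T -> R) :
  measurable D -> mu.-integrable D (EFin \o f) -> (forall x, D x -> 0 < f x) ->
  (0 < mu D)%E -> 0 < \int[mu]_(x in D) f x.
Proof.
move=> mD intf f0 D0; rewrite lt_neqAle; apply/andP; split; last first.
  by apply: Rintegral_ge0 => x /f0/ltW.
apply/eqP => /esym f_eq0.
have {f_eq0} : (\int[mu]_(x in D) `|(f x)%:E| = 0)%E.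
  transitivity (\int[mu]_(x in D) (f x)%:E)%E.
    by apply: eq_integral => x; rewrite inE/= => /f0 h; rewrite gtr0_norm.
  by rewrite -(fineK (integrable_fin_num _ intf))//; congr EFin.
move=> /ae_eq_integral_abs [//| |N [mN N0 sN]]; first exact: measurable_int intf.
have : (mu D <= mu N)%E.
  rewrite le_measure ?inE// => x /= xD; apply: sN => /= /(_ xD)/eqP.
  by rewrite eqe gt_eqF// f0.
by rewrite N0 leNgt D0.
Qed.

Section powR_calculus.
Context {R : realType}.
Notation mu := (@lebesgue_measure R).
Implicit Types (a b c g t x y p : R).

Lemma powR_continuous p x : 0 < x -> {for x, continuous (fun y => y `^ p)}.
Proof.
move=> x0; apply: differentiable_continuous; apply/derivable1_diffP.
by apply: derivable_powR; rewrite in_itv/= x0.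
Qed.

(** Integrand of the Beta function at $(g, 1-g)$. The two exponents add up to $-1$, which makes the
    integral invariant under affine changes of the interval. *)
Definition beta_integrand (g x : R) := (1 - x) `^ (g - 1) * x `^ (- g).

Lemma beta_integrand_continuous g : {in `]0, 1[, continuous (beta_integrand g)}.
Proof.
move=> x; rewrite in_itv/= => /andP[x0 x1].
apply: cvgM; last exact: powR_continuous.
apply: (@continuous_comp _ _ _ (fun y : R => 1 - y) (fun y : R => y `^ (g - 1))).
  by apply: continuousB; [exact: cst_continuous|exact: cvg_id].
by apply: powR_continuous; rewrite subr_gt0.
Qed.

Lemma beta_integrand_gt0 g x : x \in `]0, 1[ -> 0 < beta_integrand g x.
Proof.
rewrite in_itv/= => /andP[x0 x1].
by rewrite mulr_gt0// powR_gt0// subr_gt0.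
Qed.

Lemma integral_powR p : 0 < p ->
  (\int[mu]_(x in `]0%R, 1%R[) (x `^ (p - 1))%:E = (p^-1)%:E)%E.
Proof.
move=> p0; rewrite (@ge0_ftc_oo _ 0 1 0 p^-1 _ (fun x => p^-1 * x `^ p))//.
- by rewrite subr0.
- move=> x; rewrite in_itv/= => /andP[x0 x1]; split; first exact: powR_ge0.
    by apply: derivableM => //; apply: derivable_powR; rewrite in_itv/= x0.
  rewrite derive1E deriveZ/=; last by apply: derivable_powR; rewrite in_itv/= x0.
  have [_ ->] := is_derive1_powR p x0.
  by rewrite /GRing.scale/= mulrA mulVf ?mul1r// gt_eqF.
- by move=> x; rewrite in_itv/= => /andP[x0 _]; exact: powR_continuous.
- rewrite -[X in _ --> X](mulr0 p^-1); apply: cvgM; first exact: cvg_cst.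
  exact: powR_cvg0.
- rewrite -[X in _ --> X](mulr1 p^-1); apply: cvgM; first exact: cvg_cst.
  by apply: cvg_at_left_filter; have := @powR_continuous p 1 ltr01;
     rewrite /prop_for/continuous_at powR1.
Qed.

Lemma integral_powR_onem p : 0 < p ->
  (\int[mu]_(x in `]0%R, 1%R[) ((1 - x) `^ (p - 1))%:E = (p^-1)%:E)%E.
Proof.
move=> p0; rewrite (@ge0_ftc_oo _ 0 1 (- p^-1) 0 _ (fun x => - p^-1 * (1 - x) `^ p))//.
- by rewrite sub0r opprK.
- move=> x; rewrite in_itv/= => /andP[x0 x1].
  have x10 : 0 < 1 - x by rewrite subr_gt0.
  have D : is_derive x 1 (fun y : R => 1 - y) (- 1).
    by rewrite -[X in is_derive _ _ _ X]add0r; apply: is_deriveB.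
  have := @is_derive1_comp R (fun y => y `^ p) (fun y => 1 - y) x _ _
    (is_derive1_powR p x10) D.
  move=> [dF F'x]; split; first exact: powR_ge0.
    exact: (derivableM (derivable_cst _ _ _) dF).
  rewrite derive1E deriveZ//= F'x /GRing.scale/=.
  by rewrite mulrN1 mulrNN mulrA mulVf ?mul1r// gt_eqF.
- move=> x; rewrite in_itv/= => /andP[x0 x1].
  apply: (@continuous_comp _ _ _ (fun y : R => 1 - y) (fun y : R => y `^ (p - 1))).
    by apply: continuousB; [exact: cst_continuous|exact: cvg_id].
  by apply: powR_continuous; rewrite subr_gt0.
- rewrite -[X in _ --> X](mulr1 (- p^-1)); apply: cvgM; first exact: cvg_cst.
  apply: cvg_at_right_filter.
  have : {for 0, continuous (fun x : R => (1 - x) `^ p)}.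
    apply: (@continuous_comp _ _ _ (fun y : R => 1 - y) (fun y : R => y `^ p)).
      by apply: continuousB; [exact: cst_continuous|exact: cvg_id].
    by apply: powR_continuous; rewrite subr0.
  by rewrite /prop_for/continuous_at/= subr0 powR1.
- rewrite -[X in _ --> X](mulr0 (- p^-1)); apply: cvgM; first exact: cvg_cst.
  apply: (@cvg_comp _ _ _ (fun x : R => 1 - x) (fun y : R => y `^ p) _ (0^'+)); last exact: powR_cvg0.
  move=> P [e /= e0 eP]; exists e => //= x /= xe x1; apply: eP => /=.
    by rewrite sub0r normrN.
  by rewrite subr_gt0.
Qed.

(** Multiply by $1 = x + (1-x)$: the factor $x$ absorbs the singularity at 0 and the factor $1-x$
    the one at 1, leaving in each term a single integrable power. *)
Lemma beta_integrand_le g x : 0 < g < 1 -> x \in `]0, 1[ ->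
  beta_integrand g x <= (1 - x) `^ (g - 1) + x `^ ((1 - g) - 1).
Proof.
move=> /andP[g0 g1]; rewrite in_itv/= => /andP[x0 x1].
have y0 : 0 < 1 - x by rewrite subr_gt0.
have -> : 1 - g - 1 = - g by ring.
rewrite /beta_integrand; set u := (1 - x) `^ (g - 1); set v := x `^ (- g).
have u0 : 0 <= u by exact: powR_ge0.
have v0 : 0 <= v by exact: powR_ge0.
have e1 q : 1 `^ q = 1 :> R by rewrite powR1.
have xv : x * v <= 1.
  rewrite /v (_ : - g = 1 - g - 1); last by ring.
  rewrite (mulr_powRB1 (ltW x0)) ?subr_gt0//.
  by rewrite -[leRHS](e1 (1 - g)) ge0_ler_powR ?nnegrE ?ler01// ?subr_ge0 ltW.
have yu : (1 - x) * u <= 1.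
  rewrite /u (mulr_powRB1 (ltW y0))//.
  by rewrite -[leRHS](e1 g) ge0_ler_powR ?nnegrE ?ler01 ?(ltW g0) ?(ltW y0)// gerBl ltW.
have -> : u * v = u * (x * v) + v * ((1 - x) * u) by ring.
by rewrite lerD// ler_piMr.
Qed.

Lemma beta_integrand_integrable g : 0 < g < 1 ->
  mu.-integrable `]0, 1[ (EFin \o beta_integrand g).
Proof.
move=> /[dup] g01 /andP[g0 g1].
have mf := continuous_oo_measurable (@beta_integrand_continuous g).
apply/integrableP; split; first exact/measurable_EFinP.
apply: (@le_lt_trans _ _ (\int[mu]_(x in `]0%R, 1%R[)
    (((1 - x) `^ (g - 1))%:E + (x `^ ((1 - g) - 1))%:E))%E).
  apply: ge0_le_integral => //.
  - by apply/measurable_EFinP; apply: measurableT_comp => //; exact: mf.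
  - apply: emeasurable_funD; apply/measurable_EFinP.
      apply: measurable_funTS; apply: (measurableT_comp (measurable_powR (g - 1))).
      exact: measurable_funB.
    by apply: measurable_funTS; exact: measurable_powR.
  - move=> x x01; rewrite -EFinD lee_fin gtr0_norm ?beta_integrand_gt0//.
    exact: beta_integrand_le.
rewrite ge0_integralD//.
- by rewrite integral_powR_onem// integral_powR ?subr_gt0// ltry.
- by move=> x _; rewrite lee_fin powR_ge0.
- apply/measurable_EFinP; apply: measurable_funTS.
  apply: (measurableT_comp (measurable_powR (g - 1))); exact: measurable_funB.
- by move=> x _; rewrite lee_fin powR_ge0.
- by apply/measurable_EFinP; apply: measurable_funTS; exact: measurable_powR.
Qed.

End powR_calculus.

(** * Abel kernels *)

(** What the analysis retains of [kernel_function]. Nothing is required of $\psi'$ at the endpoints,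
    where it may vanish or blow up. *)
Definition C1_increasing {R : realType} (a b : R) (psi : R -> R) : Prop :=
  [/\ {in `[a, b] &, {homo psi : s t / s < t}},
      {in `]a, b[, forall t, derivable psi t 1 /\ 0 < derive1 psi t},
      {in `]a, b[, continuous (derive1 psi)},
      psi t @[t --> a^'+] --> psi a &
      psi t @[t --> b^'-] --> psi b].

Lemma kernel_function_C1_increasing {R : realType} (a b : R) n (psi : R -> R) :
  a < b -> (0 < n)%N -> kernel_function a b n psi -> C1_increasing a b psi.
Proof.
move=> ab n0 [psi0 psi_lt [cpsi dpsi dnpsi] psia [dpsi0 _]].
have cw : psi t @[t --> b^'-] --> psi b.
  pose m := (a + b) / 2.
  have am : a < m by rewrite midf_lt.
  have mb : m < b by rewrite midf_lt.
  have : {within `[m, b], continuous psi}.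
    by apply: continuous_subspaceW cpsi; apply: subset_itvr; rewrite bnd_simp.
  by move=> /(continuous_within_itvP _ mb)[].
have psi_a t : a < t -> t <= b -> psi a < psi t.
  move=> a_t tb; pose m := (a + t) / 2.
  have am : a < m by rewrite midf_lt.
  have mt : m < t by rewrite midf_lt.
  (* The limit at [a] only yields a weak inequality; strictness comes from an intermediate point. *)
  apply: (@le_lt_trans _ _ (psi m)); last first.
    by apply: psi_lt; rewrite // in_itv/= ?a_t ?am// ltW// (lt_le_trans mt).
  have cpsia : cvg (psi t @[t --> a^'+]) by apply/cvg_ex; exists (psi a).
  rewrite -(cvg_lim _ psia)//; apply: limr_le => //; near=> s.
  have am' : a < s by near: s; exact: nbhs_right_gt.
  have sm : s < m by near: s; exact: nbhs_right_lt.
  by apply/ltW/psi_lt => //; rewrite in_itv/= ?am' ?am/= ltW// ?(lt_trans sm)//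
    (lt_le_trans mt).
have d1 : {in `]a, b[, forall t, derivable psi t 1}.
  by move=> t tab; exact: (dpsi 0%N n0 t tab).
split; [| | |exact: psia|exact: cw].
- move=> s t; rewrite !in_itv/= => /andP[a_s sb] /andP[a_t tb] st.
  have [as_|] := ltP a s.
    by apply: psi_lt => //; rewrite in_itv/= ?as_ ?sb// (lt_trans as_)// tb.
  move=> sa; have -> : s = a by apply/eqP; rewrite eq_le sa a_s.
  by apply: psi_a => //; exact: le_lt_trans st.
- move=> t tab; split; first exact: d1.
  rewrite lt_neqAle eq_sym dpsi0//=.
  apply: (@incr_derive1_ge0 _ psi `]a, b[%classic); last first.
  - by apply: open_nbhs_nbhs; split => //; exact: interval_open.
  - move=> x y; rewrite !inE/= !in_itv/= => /andP[ax xb] /andP[ay yb].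
    by apply: psi_lt; rewrite in_itv/= ?ax ?ay ltW.
  - by move=> x; rewrite inE => /interior_subset; exact: d1.
- have := dnpsi 1%N; rewrite n0 => /(_ isT)[].
  by rewrite derive1n1.
Unshelve. all: by end_near. Qed.

Section C1_increasing_theory.
Context {R : realType} (a b : R) (psi : R -> R).
Hypothesis ab : a < b.
Hypothesis hpsi : C1_increasing a b psi.
Notation mu := (@lebesgue_measure R).

Lemma psi_lt s t : a <= s -> s < t -> t <= b -> psi s < psi t.
Proof.
case: hpsi => H _ _ _ _ as_ st tb; apply: H => //.
  by rewrite in_itv/= as_ ltW// (lt_le_trans st).
by rewrite in_itv/= tb (le_trans as_)// ltW.
Qed.

Lemma psi_le s t : a <= s -> s <= t -> t <= b -> psi s <= psi t.
Proof.
move=> as_; rewrite le_eqVlt => /predU1P[->//|st] tb; exact/ltW/psi_lt.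
Qed.

Lemma derivable_psi t : t \in `]a, b[ -> derivable psi t 1.
Proof. by case: hpsi => _ + _ _ _ => /[apply] -[]. Qed.

Lemma psi'_gt0 t : t \in `]a, b[ -> 0 < derive1 psi t.
Proof. by case: hpsi => _ + _ _ _ => /[apply] -[]. Qed.

Lemma psi'_continuous : {in `]a, b[, continuous (derive1 psi)}.
Proof. by case: hpsi. Qed.

Lemma psi_continuous : {in `]a, b[, continuous psi}.
Proof.
move=> t /derivable_psi/derivable1_diffP h; exact: differentiable_continuous.
Qed.

Lemma psi_at_right s : a <= s -> s < b -> psi t @[t --> s^'+] --> psi s.
Proof.
case: hpsi => _ _ _ psia _; rewrite le_eqVlt => /predU1P[<-//|as_] sb.
by apply: cvg_at_right_filter; apply: psi_continuous; rewrite in_itv/= as_.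
Qed.

Lemma psi_at_left t : a < t -> t <= b -> psi s @[s --> t^'-] --> psi t.
Proof.
case: hpsi => _ _ _ _ psib a_t; rewrite le_eqVlt => /predU1P[->//|tb].
by apply: cvg_at_left_filter; apply: psi_continuous; rewrite in_itv/= a_t.
Qed.

Lemma is_derive_psi t : t \in `]a, b[ -> is_derive t 1 psi (derive1 psi t).
Proof. by move=> /derivable_psi h; rewrite derive1E; exact: DeriveDef. Qed.

Lemma psi_diff_powR_derive s t p : a <= s -> s < t -> t < b ->
  is_derive t 1 (fun r => (psi r - psi s) `^ p)
    (p * (psi t - psi s) `^ (p - 1) * derive1 psi t).
Proof.
move=> as_ st tb; have pst : 0 < psi t - psi s by rewrite subr_gt0 psi_lt// ltW.
have D : is_derive t 1 (fun r => psi r - psi s) (derive1 psi t).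
  rewrite -[X in is_derive _ _ _ X]subr0; apply: is_deriveB.
  by apply: is_derive_psi; rewrite in_itv/= tb (le_lt_trans as_).
exact: (@is_derive1_comp R (fun y => y `^ p) (fun r => psi r - psi s) t _ _
    (is_derive1_powR p pst) D).
Qed.

Lemma psi_diff_powR_continuous s t p : a <= s -> s < t -> t < b ->
  {for t, continuous (fun r => (psi r - psi s) `^ p)}.
Proof.
move=> as_ st tb; apply: differentiable_continuous; apply/derivable1_diffP.
by have [] := psi_diff_powR_derive p as_ st tb.
Qed.

Lemma psi_diff_powR_cvg s p : a <= s -> s < b -> 0 < p ->
  (psi r - psi s) `^ p @[r --> s^'+] --> 0.
Proof.
move=> as_ sb p0.
apply: (@increasing_cvg_at_right_comp R (fun r => psi r - psi s)
  (fun y => y `^ p) s (BRight b)) => //.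
- move=> x y; rewrite !in_itv/= => /andP[sx xb] /andP[sy yb] xy.
  by rewrite ltrD2r psi_lt// (le_trans as_).
- by apply: cvgB; [exact: psi_at_right|exact: cvg_cst].
- by rewrite subrr; exact: powR_cvg0.
Qed.

Lemma integral_psi_powR s p : a <= s -> s < b -> 0 < p ->
  (\int[mu]_(t in `]s, b[) (p * (psi t - psi s) `^ (p - 1) * derive1 psi t)%:E =
   ((psi b - psi s) `^ p)%:E)%E.
Proof.
move=> as_ sb p0.
rewrite (@ge0_ftc_oo _ s b 0 ((psi b - psi s) `^ p) _
  (fun r => (psi r - psi s) `^ p))// ?subr0//.
- move=> t; rewrite in_itv/= => /andP[st tb].
  have tab : t \in `]a, b[ by rewrite in_itv/= tb (le_lt_trans as_).
  have [dF F't] := psi_diff_powR_derive p as_ st tb.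
  split; [|exact: dF|by rewrite derive1E F't].
  by rewrite !mulr_ge0 ?powR_ge0// ltW// psi'_gt0.
- move=> t; rewrite in_itv/= => /andP[st tb].
  have tab : t \in `]a, b[ by rewrite in_itv/= tb (le_lt_trans as_).
  apply: cvgM; last exact: psi'_continuous.
  apply: cvgM; first exact: cvg_cst.
  by have := @psi_diff_powR_continuous s t (p - 1) as_ st tb.
- exact: psi_diff_powR_cvg.
- have pb : 0 < psi b - psi s by rewrite subr_gt0 psi_lt.
  apply: (@cvg_comp _ _ _ (fun r => psi r - psi s) (fun y => y `^ p) _
    (nbhs (psi b - psi s))); last exact: powR_continuous.
  apply: cvgB; last exact: cvg_cst.
  by apply: psi_at_left => //; exact: le_lt_trans sb.
Qed.

End C1_increasing_theory.

Definition beta_const {R : realType} (g : R) : R :=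
  \int[@lebesgue_measure R]_(x in `]0, 1[) beta_integrand g x.

Lemma beta_const_gt0 {R : realType} (g : R) : 0 < g < 1 -> 0 < beta_const g.
Proof.
move=> g01.
have mu01 : (0 < @lebesgue_measure R (`]0%R, 1%R[%classic : set R))%E.
  by rewrite lebesgue_measure_itv/= lte_fin ltr01 -EFinB subr0 lte_fin ltr01.
apply: Rintegral_gt0 => //; first exact: beta_integrand_integrable.
by move=> x; exact: beta_integrand_gt0.
Qed.

Section abel_kernel.
Context {R : realType} (a b : R) (psi : R -> R).
Hypothesis ab : a < b.
Hypothesis hpsi : C1_increasing a b psi.
Notation mu := (@lebesgue_measure R).

(** Substitution $x = (\psi(r)-\psi(s))/(\psi(t)-\psi(s))$, carried out by applying [ge0_ftc_oo] to
    [Phi \o X], where [Phi] is a primitive of the Beta integrand. Only the limits of [Phi \o X] at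
    [s] and [t] matter, so singular ends are harmless. *)
Lemma beta_integral_psi (g s t : R) : 0 < g < 1 -> a <= s -> s < t -> t <= b ->
  (\int[mu]_(r in `]s, t[) ((psi t - psi r) `^ (g - 1) *
     (psi r - psi s) `^ (- g) * derive1 psi r)%:E = (beta_const g)%:E)%E.
Proof.
move=> g01 as_ st tb; have intB := beta_integrand_integrable g01.
have cB := @beta_integrand_continuous R g.
pose Phi x := 0 + \int[mu]_(y in `]0, x[) beta_integrand g y.
have dPhi (x : R) : x \in `]0, 1[ -> is_derive x 1 Phi (beta_integrand g x).
  move=> x01; have [dP <-] := continuous_integral_derive 0 cB intB x01.
  by rewrite derive1E; exact: DeriveDef.
have D0 : 0 < psi t - psi s by rewrite subr_gt0; apply: (psi_lt hpsi).
pose X r := (psi r - psi s) / (psi t - psi s).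
have X_lt x y : s <= x -> x < y -> y <= t -> X x < X y.
  move=> sx xy yt; rewrite ltr_pM2r ?invr_gt0// ltrD2r.
  by apply: (psi_lt hpsi) => //; [exact: le_trans sx|exact: le_trans tb].
have Xs : X s = 0 by rewrite /X subrr mul0r.
have Xt : X t = 1 by rewrite /X divff// gt_eqF.
have sab r : r \in `]s, t[ -> r \in `]a, b[.
  rewrite !in_itv/= => /andP[sr rt].
  by rewrite (le_lt_trans as_ sr) (lt_le_trans rt tb).
have X01 r : r \in `]s, t[ -> X r \in `]0, 1[.
  rewrite !in_itv/= => /andP[sr rt]; rewrite -Xs -Xt !X_lt//; exact: ltW.
rewrite (@ge0_ftc_oo _ s t 0 (beta_const g) _ (Phi \o X))// ?subr0//.
- move=> r rst; have rab := sab r rst; have xr := X01 r rst.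
  have DX : is_derive r 1 X (derive1 psi r / (psi t - psi s)).
    have -> : X = (psi t - psi s)^-1 \*: (psi \- cst (psi s)).
      by apply/funext => y; rewrite /X mulrC.
    rewrite mulrC -[X in _ * X]subr0; apply: is_deriveZ; apply: is_deriveB.
    exact: is_derive_psi hpsi _ rab.
  have [dF F'r] := is_derive1_comp (dPhi _ xr) DX.
  split => //.
    by rewrite !mulr_ge0 ?powR_ge0// ltW// (psi'_gt0 hpsi).
  rewrite derive1E F'r /beta_integrand.
  have -> : 1 - X r = (psi t - psi r) / (psi t - psi s).
    by rewrite /X; field; rewrite gt_eqF.
  have pr : 0 < psi r - psi s.
    rewrite subr_gt0; move: rst; rewrite in_itv/= => /andP[sr rt].
    by apply: (psi_lt hpsi) => //; rewrite ltW// (lt_le_trans rt).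
  have tr : 0 < psi t - psi r.
    rewrite subr_gt0; move: rst; rewrite in_itv/= => /andP[sr rt].
    by apply: (psi_lt hpsi) => //; rewrite ltW// (le_lt_trans as_).
  rewrite /X !powRM ?invr_ge0 ?ltW//.
  set P := (psi t - psi r) `^ _; set A := (psi t - psi s)^-1 `^ (g - 1).
  set Q := (psi r - psi s) `^ _; set B := (psi t - psi s)^-1 `^ (- g).
  (* The exponents $g-1$ and $-g$ add up to $-1$, so the scaling factor cancels against the one in
     the derivative of [X]: the result depends on neither [s] nor [t]. *)
  have AB : A * B = psi t - psi s.
    rewrite /A /B -powRD; last by apply/implyP => _; rewrite invr_eq0 gt_eqF.
    rewrite (_ : g - 1 + - g = - 1); last by ring.
    by rewrite powR_inv1 ?invrK// invr_ge0 ltW.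
  transitivity (P * Q * derive1 psi r * (A * B / (psi t - psi s))); first by ring.
  by rewrite AB divff ?mulr1// gt_eqF.
- move=> r rst; have rab := sab r rst.
  move: (rst); rewrite in_itv/= => /andP[sr rt].
  apply: cvgM; last exact: (psi'_continuous hpsi).
  apply: cvgM; last first.
    by have := @psi_diff_powR_continuous _ _ _ _ hpsi s r (- g) as_ sr (lt_le_trans rt tb).
  apply: (@cvg_comp _ _ _ (fun r => psi t - psi r) (fun y => y `^ (g - 1)) _
    (nbhs (psi t - psi r))); last first.
    apply: powR_continuous; rewrite subr_gt0.
    by apply: (psi_lt hpsi) => //; rewrite ltW// (le_lt_trans as_).
  by apply: cvgB; [exact: cvg_cst|exact: (psi_continuous hpsi)].
- apply: (@increasing_cvg_at_right_comp _ X Phi s (BRight t)) => //.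
  + by move=> x y; rewrite !in_itv/= => /andP[sx xt] /andP[sy yt] xy; exact: X_lt.
  + apply: cvgM; last exact: cvg_cst.
    apply: cvgB; last exact: cvg_cst.
    by apply: (psi_at_right hpsi) => //; exact: lt_le_trans tb.
  + by rewrite Xs; exact: integral_cvg_at_right intB.
- apply: (@increasing_cvg_at_left_comp _ X Phi (BLeft s) t) => //.
  + by move=> x y; rewrite !in_itv/= => /andP[sx xt] /andP[sy yt] xy; exact: X_lt.
  + apply: cvgM; last exact: cvg_cst.
    apply: cvgB; last exact: cvg_cst.
    by apply: (psi_at_left hpsi) => //; exact: le_lt_trans st.
  + rewrite Xt.
    have := absolutely_continuous_continuous ltr01 (absolutely_continuous_integral 0 intB).
    move=> /(continuous_within_itvP _ ltr01)[_ _].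
    by rewrite add0r.
Qed.

(* [exp (- y) <= y ^ (- p)] for [0 <= p <= 1] turns the exponential weight into
   a power, whose integral is explicit. *)
Lemma abel_kernel_le (g lam s : R) : 0 < g <= 1 -> 0 < lam -> a <= s -> s < b ->
  (\int[mu]_(t in `]s, b[) (expR (- (lam * (psi t - psi s))) *
     (psi t - psi s) `^ (g - 1) * derive1 psi t)%:E <=
   (lam `^ (- (g / 2)) * ((g / 2)^-1 * (psi b - psi a) `^ (g / 2)))%:E)%E.
Proof.
(* Half of the exponent is spent on decay in [lam]; the other half leaves the power $g - 1 - p = p -
   1$, which is still integrable. *)
move=> /andP[g0 g1] lam0 as_ sb; set p := g / 2.
have p0 : 0 < p by rewrite divr_gt0.
have p1 : p <= 1 by rewrite /p; lra.
have psib t : t \in `]s, b[ -> 0 < psi t - psi s.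
  rewrite in_itv/= => /andP[st tb]; rewrite subr_gt0.
  by apply: (psi_lt hpsi) => //; exact: ltW.
have key y : 0 < y -> expR (- (lam * y)) * y `^ (g - 1) <=
    lam `^ (- p) * p^-1 * (p * y `^ (p - 1)).
  move=> y0; have ly0 : 0 < lam * y by rewrite mulr_gt0.
  have -> : lam `^ (- p) * p^-1 * (p * y `^ (p - 1)) =
      (lam * y) `^ (- p) * y `^ (g - 1).
    rewrite powRM ?ltW// -mulrA mulKf ?gt_eqF// -mulrA; congr (_ * _).
    rewrite -powRD; first by congr (_ `^ _); rewrite /p; lra.
    by apply/implyP => _; rewrite gt_eqF.
  rewrite ler_wpM2r ?powR_ge0// powRN expRN lef_pV2 ?posrE ?expR_gt0 ?powR_gt0//.
  apply: (@le_trans _ _ (1 + lam * y)); last exact: expR_ge1Dx.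
  apply: (@le_trans _ _ ((1 + lam * y) `^ p)).
    by apply: ge0_ler_powR; rewrite ?nnegrE ?lerDr ?addr_ge0 ?(ltW ly0) ?(ltW p0).
  by rewrite ler1_powR// lerDl ltW.
have mq p' : measurable_fun `]s, b[ (fun t => (psi t - psi s) `^ p').
  apply: continuous_oo_measurable => t; rewrite in_itv/= => /andP[st tb].
  by have := @psi_diff_powR_continuous _ _ _ _ hpsi s t p' as_ st tb.
have mp' : measurable_fun `]s, b[ (derive1 psi).
  apply: continuous_oo_measurable => t; rewrite in_itv/= => /andP[st tb].
  by apply: (psi'_continuous hpsi); rewrite in_itv/= tb (le_lt_trans as_).
have mpsi : measurable_fun `]s, b[ (fun t => psi t - psi s).
  apply: continuous_oo_measurable => t; rewrite in_itv/= => /andP[st tb].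
  apply: cvgB; last exact: cvg_cst.
  by apply: (psi_continuous hpsi); rewrite in_itv/= tb (le_lt_trans as_).
have dpos t : t \in `]s, b[ -> 0 <= derive1 psi t.
  rewrite in_itv/= => /andP[st tb]; apply/ltW/(psi'_gt0 hpsi).
  by rewrite in_itv/= tb (le_lt_trans as_).
apply: (@le_trans _ _ (\int[mu]_(t in `]s, b[) ((lam `^ (- p) * p^-1)%:E *
    (p * (psi t - psi s) `^ (p - 1) * derive1 psi t)%:E))%E).
  apply: ge0_le_integral => //.
  - move=> t tsb; rewrite lee_fin !mulr_ge0 ?powR_ge0 ?expR_ge0//; exact: dpos.
  - apply/measurable_EFinP; apply: measurable_funM => //.
    apply: measurable_funM; last exact: mq.
    apply: (measurableT_comp (@measurable_expR R)).
    by apply: measurable_funN; apply: measurable_funM; [exact: measurable_cst|exact: mpsi].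
  - apply: emeasurable_funM => //; apply/measurable_EFinP.
    by apply: measurable_funM => //; apply: measurable_funM => //; exact: mq.
  - move=> t tsb; rewrite -EFinM lee_fin mulrA ler_wpM2r//; first exact: dpos.
    exact/key/psib.
rewrite ge0_integralZl//.
- rewrite (integral_psi_powR ab hpsi)// -EFinM lee_fin mulrA ler_wpM2l//.
    by rewrite mulr_ge0 ?powR_ge0 ?invr_ge0// ltW.
  have psib' : psi s <= psi b by apply: (psi_le hpsi) => //; exact: ltW.
  have psia : psi a <= psi s by apply: (psi_le hpsi) => //; exact: ltW.
  apply: ge0_ler_powR; rewrite ?nnegrE ?(ltW p0)//; lra.
- apply/measurable_EFinP.
  by apply: measurable_funM => //; apply: measurable_funM => //; exact: mq.
- move=> t tsb; rewrite lee_fin !mulr_ge0 ?powR_ge0 ?(ltW g0)//; exact: dpos.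
- by rewrite lee_fin mulr_ge0 ?powR_ge0 ?invr_ge0// ltW.
Qed.

End abel_kernel.

(** * Integral operators on L^1 with a nonnegative kernel *)

Section kernel_operator.
Context d (T : measurableType d) (R : realType).
Variable mu : {sigma_finite_measure set T -> \bar R}.
Variables (k : T * T -> R) (V : T -> R) (c : R).
Hypotheses (mk : measurable_fun setT k) (k0 : forall z, 0 <= k z).
Hypothesis kc : forall s, (\int[mu]_t (k (t, s))%:E <= c%:E)%E.
Hypothesis intV : mu.-integrable setT (EFin \o V).

Let f z := (k z * V z.2)%:E.

Let mV : measurable_fun setT V.
Proof. by apply/measurable_EFinP; exact: measurable_int intV. Qed.

Let mf : measurable_fun setT f.
Proof.
apply/measurable_EFinP; apply: measurable_funM => //.
exact: (measurableT_comp mV measurable_snd).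
Qed.

Let mk1 s : measurable_fun setT (fun t => k (t, s)).
Proof. exact: (measurableT_comp mk (measurable_pair2 s)). Qed.

Let f21 s : (\int[mu]_t `|f (t, s)| = `|V s|%:E * \int[mu]_t (k (t, s))%:E)%E.
Proof.
rewrite -ge0_integralZl//; last 2 first.
- exact/measurable_EFinP.
- by move=> t _; rewrite lee_fin.
by apply: eq_integral => t _; rewrite /f /= normrM (ger0_norm (k0 _)) mulrC EFinM.
Qed.

(** Schur's test in $L^1$: integrating first in [t] bounds the double integral by [c] times the norm
    of [V], and Tonelli and Fubini give everything else. *)
Let f21_le : (\int[mu]_s \int[mu]_t `|f (t, s)| <= c%:E * \int[mu]_s `|V s|%:E)%E.
Proof.
have c0 : 0 <= c.
  have := kc point; rewrite -lee_fin; apply: le_trans.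
  by apply: integral_ge0 => t _; rewrite lee_fin.
rewrite -ge0_integralZl//; last first.
  by apply/measurable_EFinP; exact: measurableT_comp.
apply: ge0_le_integral => //.
- by move=> s _; apply: integral_ge0.
- apply: (measurable_fun_fubini_tonelli_G (m1 := mu) (fun z => `|f z|%E)) => //.
  exact: measurableT_comp.
- by apply/measurable_EFinP; apply: measurable_funM => //; exact: measurableT_comp.
- by move=> s _; rewrite f21 muleC lee_wpmul2r ?kc// lee_fin.
Qed.

Let intf : (mu \x mu)%E.-integrable setT f.
Proof.
apply/integrable21ltyP => //; apply: le_lt_trans f21_le _.
have /integrableP[_ +] := intV; rewrite -ge0_fin_numE ?integral_ge0// => finV.
by rewrite ltey_eq fin_numM.
Qed.

Definition kernel_operator t := \int[mu]_s (k (t, s) * V s).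

Lemma kernel_operator_ae_integrable :
  {ae mu, forall t, mu.-integrable setT (fun s => (k (t, s) * V s)%:E)}.
Proof.
have := ae_integrable1 intf; exact.
Qed.

Lemma kernel_operator_integrable : mu.-integrable setT (EFin \o kernel_operator).
Proof.
have intF := integrable_fubini_F intf.
apply: (le_integrable measurableT _ _ intF) => //.
  apply/measurable_EFinP; apply: measurableT_comp => //.
  exact: measurable_int intF.
move=> t _; rewrite /kernel_operator /Rintegral /=.
rewrite -[X in (_ <= `|X|)%E]/(\int[mu]_s (k (t, s) * V s)%:E)%E.
(* At the exceptional [t] where the integral is infinite, the real integral is 0, so the bound holds
   there too. *)
by case: (\int[mu]_s _)%E => //=; rewrite normr0 leey.
Qed.

Lemma kernel_operator_norm :
  (\int[mu]_t `|kernel_operator t|%:E <= c%:E * \int[mu]_s `|V s|%:E)%E.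
Proof.
apply: le_trans f21_le.
rewrite -(fubini_tonelli (m1 := mu) (m2 := mu) (fun z => `|f z|%E)) //; last first.
  exact: measurableT_comp.
apply: ge0_le_integral => //.
- apply/measurable_EFinP; apply: measurableT_comp => //; apply/measurable_EFinP.
  exact: measurable_int kernel_operator_integrable.
- apply: (measurable_fun_fubini_tonelli_F (m2 := mu) (fun z => `|f z|%E)) => //.
  exact: measurableT_comp.
move=> t _; apply: (@le_trans _ _ `|\int[mu]_s f (t, s)|%E).
  rewrite /kernel_operator /Rintegral.
  rewrite -[X in (_ <= `|X|)%E]/(\int[mu]_s (k (t, s) * V s)%:E)%E.
  by case: (\int[mu]_s _)%E => //=; rewrite normr0 leey.
apply: le_abse_integral => //.
exact: (measurableT_comp mf (measurable_pair1 t)).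
Qed.

Lemma integral_kernel_operator :
  \int[mu]_t kernel_operator t = \int[mu]_s ((\int[mu]_t k (t, s)) * V s).
Proof.
transitivity (fine (\int[mu]_t \int[mu]_s f (t, s))%E).
  congr fine; apply: eq_integral_ae; apply: filterS kernel_operator_ae_integrable.
  move=> t it _; rewrite /kernel_operator /Rintegral fineK//.
  exact: integrable_fin_num it.
rewrite (Fubini intf); congr fine; apply: eq_integral => s _.
have ik : mu.-integrable setT (fun t => (k (t, s))%:E).
  apply/integrableP; split; first exact/measurable_EFinP.
  rewrite (eq_integral (fun t => (k (t, s))%:E)).
    by apply: le_lt_trans (kc s) _; rewrite ltry.
  by move=> t _; rewrite gee0_abs// lee_fin.
rewrite EFinM [X in _ = (X * _)%E]fineK; last exact: integrable_fin_num ik.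
rewrite muleC -integralZl//; apply: eq_integral => t _.
by rewrite /f /= mulrC EFinM.
Qed.

End kernel_operator.

(** * Fixed points in L^1 *)

Lemma integ_measurable d (T : measurableType d) (R : realType)
    (mu : {measure set T -> \bar R}) (V : T -> R) :
  mu.-integrable setT (EFin \o V) -> measurable_fun setT V.
Proof. by move=> iV; apply/measurable_EFinP; exact: measurable_int iV. Qed.

Section L1_contraction.
Context d (T : measurableType d) (R : realType).
Variable mu : {measure set T -> \bar R}.
Local Notation integ V := (mu.-integrable setT (EFin \o V)).
Local Notation dist V W := (\int[mu]_x `|V x - W x|%:E)%E.

Lemma L1_dist_fin (V W : T -> R) : integ V -> integ W -> dist V W \is a fin_num.
Proof.
move=> iV iW; have /integrable_norm := integrableB measurableT iV iW.
by move=> /(integrable_fin_num measurableT).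
Qed.

Lemma L1_dist_triangle (U V W : T -> R) : integ U -> integ V -> integ W ->
  (dist U W <= dist U V + dist V W)%E.
Proof.
move=> /integ_measurable mU /integ_measurable mV /integ_measurable mW.
have mB (A B : T -> R) : measurable_fun setT A -> measurable_fun setT B ->
    measurable_fun setT (fun x => `|A x - B x|%:E).
  move=> mA mB; apply/measurable_EFinP; apply: measurableT_comp => //.
  exact: measurable_funB.
rewrite -ge0_integralD//; [|exact: mB|exact: mB].
apply: ge0_le_integral => //; [exact: mB|by apply: emeasurable_funD; exact: mB|].
by move=> x _; rewrite -EFinD lee_fin ler_distD.
Qed.

Lemma L1_dist_eq0 (V W : T -> R) : integ V -> integ W -> dist V W = 0%E ->
  {ae mu, forall x, V x = W x}.
Proof.
move=> iV iW VW0; have iVW := integrableB measurableT iV iW.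
have mVW := measurable_int _ iVW.
have := (ae_eq_integral_abs mu measurableT mVW).1 VW0.
by apply: filterS => x /(_ I) /eqP; rewrite eqe subr_eq0 => /eqP.
Qed.

(** Banach's fixed-point theorem for functions rather than classes. Completeness is proved along the
    iteration, as in the Riesz-Fischer theorem: the norms of the increments decay geometrically, so
    the series of increments converges absolutely almost everywhere. *)
Lemma L1_contraction_fixpoint (Phi : (T -> R) -> T -> R) :
  (forall V, integ V -> integ (Phi V)) ->
  (forall V W, integ V -> integ W ->
     (dist (Phi V) (Phi W) <= 2^-1%:E * dist V W)%E) ->
  exists2 V, integ V & {ae mu, forall x, Phi V x = V x}.
Proof.
move=> iPhi cPhi; pose V n : T -> R := iter n Phi (fun=> 0).
have iV n : integ (V n).
  by elim: n => [|n IH]; [exact: integrable0|exact: iPhi].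
have mV n := integ_measurable (iV n).
pose D n x : R := `|V n.+1 x - V n x|.
have mD n : measurable_fun setT (D n).
  by apply: measurableT_comp => //; exact: measurable_funB.
pose c := fine (dist (V 1%N) (V 0%N)).
have cE : c%:E = dist (V 1%N) (V 0%N) by rewrite fineK// L1_dist_fin.
have c0 : 0 <= c by rewrite fine_ge0// integral_ge0.
have DE n : (\int[mu]_x (D n x)%:E <= (geometric c 2^-1 n)%:E)%E.
  elim: n => [|n IH]; first by rewrite /= expr0 mulr1 cE.
  apply: (le_trans (cPhi _ _ (iV n.+1) (iV n))).
  rewrite /geometric/= exprS mulrCA EFinM; apply: lee_wpmul2l => //.
(* The sum of the absolute increments is integrable. It dominates every iterate because the
   iteration starts at 0. *)
pose g x : \bar R := (\sum_(0 <= n <oo) (D n x)%:E)%E.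
have mg : measurable_fun setT g.
  apply: (@ge0_emeasurable_sum _ _ _ setT (fun n x => (D n x)%:E) xpredT).
    by move=> n x _ _; rewrite lee_fin normr_ge0.
  by move=> n _; exact/measurable_EFinP.
have g0 x : (0 <= g x)%E by apply: nneseries_ge0 => n _ _; rewrite lee_fin normr_ge0.
have ig : mu.-integrable setT g.
  apply/integrableP; split => //.
  under eq_integral do rewrite gee0_abs//.
  rewrite integral_nneseries; [|by []|by move=> n; exact/measurable_EFinP|
    by move=> n x _; rewrite lee_fin normr_ge0].
  apply: (@le_lt_trans _ _ (\sum_(0 <= n <oo) (geometric c 2^-1 n)%:E)%E).
    apply: lee_nneseries => n *; last exact: DE.
    by apply: integral_ge0 => x _; rewrite lee_fin normr_ge0.
  have cg : series (geometric c (2^-1 : R)) @ \oo --> c / (1 - 2^-1).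
    by apply: cvg_geometric_series; rewrite gtr0_norm ?invr_gt0// invf_lt1// ltr1n.
  have : (\sum_(0 <= n <oo) (geometric c 2^-1 n)%:E = (c / (1 - 2^-1))%:E)%E.
    apply/cvg_lim => //; apply: cvg_EFin.
      by apply: nearW => n; rewrite sumEFin.
    by under eq_fun do rewrite /= sumEFin.
  by move=> ->; rewrite ltry.
have Vg n x : (`|V n x|%:E <= g x)%E.
  apply: (@le_trans _ _ (\sum_(0 <= k < n) (D k x)%:E)%E); last first.
    by apply: nneseries_lim_ge => k _; rewrite lee_fin normr_ge0.
  rewrite sumEFin lee_fin.
  have -> : V n x = \sum_(0 <= k < n) (V k.+1 x - V k x).
    by rewrite telescope_sumr// subr0.
  exact: ler_norm_sum.
have cV : {ae mu, forall x, setT x -> cvg (V n x @[n --> \oo])}.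
  apply: filterS (integrable_ae measurableT ig) => x /(_ I) gx _.
  have -> : (fun n => V n x) = series (fun k => V k.+1 x - V k x).
    by apply/funext => n; rewrite /series/= telescope_sumr// subr0.
  apply: normed_cvg.
  apply: nondecreasing_is_cvgn.
    by apply: nondecreasing_series => n _; rewrite normr_ge0.
  exists (fine (g x)) => _ [n _ <-]; rewrite -lee_fin fineK//.
  rewrite /series/= -sumEFin.
  by apply: nneseries_lim_ge => k _; rewrite lee_fin normr_ge0.
(* The upper limit is measurable everywhere, and agrees with the limit where the latter exists. *)
pose W x := fine (limn_esup (fun n => (V n x)%:E)).
have mW : measurable_fun setT W.
  apply: measurableT_comp => //.
  by apply: measurable_fun_limn_esup => n; exact/measurable_EFinP.
have VW : {ae mu, forall x, setT x -> (V n x)%:E @[n --> \oo] --> (W x)%:E}.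
  apply: filterS cV => x /(_ I) cVx _; apply: cvg_EFin; first exact: nearW.
  have cE' : (V n x)%:E @[n --> \oo] --> (limn (V ^~ x))%:E.
    by apply: cvg_EFin; [exact: nearW|exact: cVx].
  rewrite /W is_cvg_limn_esupE; last by apply/cvg_ex; exists (limn (V ^~ x))%:E.
  by rewrite (cvg_lim _ cE').
have [iW dW _] := dominated_convergence measurableT
  (fun n => (measurable_EFinP _ _).2 (mV n))
  ((measurable_EFinP _ _).2 mW) VW ig (aeW _ (fun x n _ => Vg n x)).
exists W => //; apply: L1_dist_eq0 => //; first exact: iPhi.
apply/eqP; rewrite eq_le integral_ge0// andbT.
have e_cvg : dist (V n) W @[n --> \oo] --> 0%E by exact: dW.
have e_cvg2 : (dist (V n.+1) W + dist (V n) W)%E @[n --> \oo] --> 0%E.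
  rewrite -[X in _ --> X]adde0; apply: cvgeD => //.
  by rewrite (cvg_shiftS (fun n => dist (V n) W)).
rewrite -(cvg_lim _ e_cvg2)//; apply: lime_ge.
  by apply/cvg_ex; exists 0%E.
apply: nearW => n.
have sym A B : dist A B = dist B A by apply: eq_integral => x _; rewrite distrC.
(* Since [V n.+1] is [Phi (V n)], the contraction bounds the distance from [Phi W] to [V n.+1] by
   that from [V n] to [W]; both terms tend to 0. *)
apply: (le_trans (L1_dist_triangle (iPhi _ iW) (iV n.+1) iW)).
rewrite addeC leeD2l// (le_trans (cPhi _ _ iW (iV n)))// sym.
by rewrite -[leRHS]mul1e lee_wpmul2r ?lee_fin ?integral_ge0// invf_le1// ler1n.
Qed.

End L1_contraction.

(** * Abel operators on L^1 *)

Section psi_kernel.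
Context {R : realType} (a b : R) (psi : R -> R).
Notation mu := (@lebesgue_measure R).

(** Nothing is known of $\psi$ outside the interval; extension by 0 makes the kernels measurable on
    the whole plane, as Fubini requires. *)
Definition dpsi : R -> R := derive1 psi \_ `]a, b[.

Definition psi_oo : R -> R := psi \_ `]a, b[.

Definition abel_kernel (g : R) (z : R * R) : R :=
  if [&& a < z.2, z.2 < z.1 & z.1 < b]
  then (psi_oo z.1 - psi_oo z.2) `^ (g - 1) else 0.

Definition dpsi_abel_kernel (g : R) (z : R * R) : R :=
  dpsi z.1 * abel_kernel g z.

(** Kernel of the conjugated operator $V \mapsto w A(V/w)$ with $w = e^{-\lambda\psi}$ and $A$ the
    operator of kernel [dpsi_abel_kernel g]: its plain $L^1$ norm is the weighted norm of $A$. *)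
Definition weighted_abel_kernel (lam g : R) (z : R * R) : R :=
  expR (- (lam * psi_oo z.1)) * dpsi_abel_kernel g z * expR (lam * psi_oo z.2).

Hypothesis ab : a < b.
Hypothesis hpsi : C1_increasing a b psi.

Lemma psi_ooE t : t \in `]a, b[ -> psi_oo t = psi t.
Proof. by move=> tab; rewrite /psi_oo patchE mem_set. Qed.

Lemma dpsiE t : t \in `]a, b[ -> dpsi t = derive1 psi t.
Proof. by move=> tab; rewrite /dpsi patchE mem_set. Qed.

Lemma dpsi_gt0 t : t \in `]a, b[ -> 0 < dpsi t.
Proof. by move=> tab; rewrite dpsiE// (psi'_gt0 hpsi). Qed.

Lemma dpsi_out t : t \notin `]a, b[ -> dpsi t = 0.
Proof. by move=> tab; rewrite /dpsi patchE memNset//; exact/negP. Qed.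

Lemma dpsi_ge0 t : 0 <= dpsi t.
Proof.
by have [/dpsi_gt0/ltW//|/dpsi_out->] := boolP (t \in `]a, b[).
Qed.

Lemma abel_kernelE g s t : a < s -> s < t -> t < b ->
  abel_kernel g (t, s) = (psi t - psi s) `^ (g - 1).
Proof.
move=> as_ st tb; rewrite /abel_kernel/= as_ st tb /= !psi_ooE//.
  by rewrite in_itv/= as_ (lt_trans st).
by rewrite in_itv/= tb (lt_trans as_).
Qed.

Lemma abel_kernel_out g s t : ~~ (s < t) -> abel_kernel g (t, s) = 0.
Proof. by rewrite /abel_kernel/= => /negbTE->; rewrite andbF. Qed.

Lemma abel_kernel_out1 g s t : t \notin `]a, b[ -> abel_kernel g (t, s) = 0.
Proof.
rewrite /abel_kernel/= in_itv/= => /negP tab; case: ifP => // /and3P[h1 h2 h3].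
by exfalso; apply: tab; rewrite h3 (lt_trans h1).
Qed.

Lemma abel_kernel_out2 g s t : s \notin `]a, b[ -> abel_kernel g (t, s) = 0.
Proof.
rewrite /abel_kernel/= in_itv/= => /negP sab; case: ifP => // /and3P[h1 h2 h3].
by exfalso; apply: sab; rewrite h1 (lt_trans h2).
Qed.

Lemma abel_kernel_ge0 g z : 0 <= abel_kernel g z.
Proof. by rewrite /abel_kernel; case: ifP => // _; exact: powR_ge0. Qed.

Lemma dpsi_abel_kernel_ge0 g z : 0 <= dpsi_abel_kernel g z.
Proof. by rewrite mulr_ge0 ?dpsi_ge0 ?abel_kernel_ge0. Qed.

Lemma weighted_abel_kernel_ge0 lam g z : 0 <= weighted_abel_kernel lam g z.
Proof. by do 2?apply: mulr_ge0; rewrite ?expR_ge0 ?dpsi_abel_kernel_ge0. Qed.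

Lemma measurable_psi_oo : measurable_fun setT psi_oo.
Proof.
apply/(measurable_restrictT _ (measurable_itv _)); apply: continuous_oo_measurable.
exact: psi_continuous hpsi.
Qed.

Lemma measurable_dpsi : measurable_fun setT dpsi.
Proof.
apply/(measurable_restrictT _ (measurable_itv _)); apply: continuous_oo_measurable.
exact: psi'_continuous hpsi.
Qed.

Lemma measurable_abel_kernel g : measurable_fun setT (abel_kernel g).
Proof.
apply: measurable_fun_ifT => //.
- apply: measurable_and.
    by apply: measurable_fun_ltr; [exact: measurable_cst|exact: measurable_snd].
  apply: measurable_and.
    by apply: measurable_fun_ltr; [exact: measurable_snd|exact: measurable_fst].
  by apply: measurable_fun_ltr; [exact: measurable_fst|exact: measurable_cst].
- apply: (measurableT_comp (measurable_powR (g - 1))).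
  apply: measurable_funB.
    exact: (measurableT_comp measurable_psi_oo measurable_fst).
  exact: (measurableT_comp measurable_psi_oo measurable_snd).
Qed.

Lemma measurable_dpsi_abel_kernel g : measurable_fun setT (dpsi_abel_kernel g).
Proof.
apply: measurable_funM; last exact: measurable_abel_kernel.
exact: (measurableT_comp measurable_dpsi measurable_fst).
Qed.

Lemma measurable_weight (lam : R) :
  measurable_fun setT (fun t => expR (lam * psi_oo t)).
Proof.
apply: (measurableT_comp (@measurable_expR R)).
by apply: measurable_funM => //; exact: measurable_psi_oo.
Qed.

Lemma measurable_weighted_abel_kernel lam g :
  measurable_fun setT (weighted_abel_kernel lam g).
Proof.
apply: measurable_funM; last first.
  exact: (measurableT_comp (measurable_weight lam) measurable_snd).
apply: measurable_funM; last exact: measurable_dpsi_abel_kernel.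
under eq_fun do rewrite -mulNr.
exact: (measurableT_comp (measurable_weight (- lam)) measurable_fst).
Qed.

Definition abel_bound (lam g : R) : R :=
  lam `^ (- (g / 2)) * ((g / 2)^-1 * (psi b - psi a) `^ (g / 2)).

Lemma weighted_abel_kernel_le (lam g s : R) : 0 < g <= 1 -> 0 < lam ->
  (\int[mu]_t (weighted_abel_kernel lam g (t, s))%:E <= (abel_bound lam g)%:E)%E.
Proof.
move=> g01 lam0; have [sab|sab] := boolP (s \in `]a, b[); last first.
  rewrite integral0_eq; last first.
    by move=> t _; rewrite /weighted_abel_kernel /dpsi_abel_kernel abel_kernel_out2// mulr0
      mulr0 mul0r.
  have /andP[g0 _] := g01.
  by rewrite lee_fin !mulr_ge0 ?powR_ge0// invr_ge0 divr_ge0 ?ltW.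
have := sab; rewrite in_itv/= => /andP[as_ sb].
apply: le_trans (abel_kernel_le ab hpsi g01 lam0 (ltW as_) sb).
rewrite [leRHS]integral_mkcond le_eqVlt; apply/orP; left; apply/eqP.
apply: eq_integral => t _; rewrite patchE; case: ifPn => [|tsb].
  rewrite inE/= in_itv/= => /andP[st tb].
  have tab : t \in `]a, b[ by rewrite in_itv/= tb (lt_trans as_).
  rewrite /weighted_abel_kernel /dpsi_abel_kernel/= abel_kernelE// dpsiE//.
  have -> : expR (- (lam * (psi t - psi s))) =
      expR (- (lam * psi t)) * expR (lam * psi s).
    by rewrite -expRD; congr expR; ring.
  by rewrite !psi_ooE//; congr EFin; ring.
rewrite /weighted_abel_kernel /dpsi_abel_kernel/= /abel_kernel/= as_ /=.
case: ifP => [/andP[st tb]|]; last by rewrite !(mulr0, mul0r).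
by exfalso; move/negP: tsb; apply; rewrite inE/= in_itv/= st.
Qed.

Lemma abel_bound_small (g e : R) : 0 < g -> 0 < e ->
  exists2 lam0, 0 < lam0 & forall lam, lam0 <= lam -> abel_bound lam g <= e.
Proof.
move=> g0 e0; rewrite /abel_bound; set p := g / 2.
have p0 : 0 < p by rewrite divr_gt0.
set K := p^-1 * _.
have K0 : 0 <= K by rewrite mulr_ge0 ?powR_ge0 ?invr_ge0 ?(ltW p0).
(* The threshold below solves $\lambda^{-p} = x$; adding 1 keeps the quotient meaningful if [K] is
   0. *)
pose x := e / (K + 1).
have x0 : 0 < x by rewrite divr_gt0// ltr_wpDl.
exists (x `^ (- p^-1)); first exact: powR_gt0.
move=> lam lamx; have lam_gt0 := lt_le_trans (powR_gt0 (- p^-1) x0) lamx.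
have : lam `^ (- p) <= x.
  rewrite powRN -[leRHS]invrK lef_pV2 ?posrE ?invr_gt0 ?powR_gt0//.
  have -> : x^-1 = (x `^ (- p^-1)) `^ p.
    by rewrite -powRrM mulNr mulVf ?gt_eqF// powR_inv1// ltW.
  by apply: ge0_ler_powR; rewrite ?nnegrE ?powR_ge0// ltW.
move=> /(ler_wpM2r K0)/le_trans; apply.
by rewrite /x mulrAC ler_pdivrMr ?ltr_wpDl// ler_pM2l// lerDl.
Qed.

End psi_kernel.

Section abel_operator.
Context {R : realType} (a b : R) (psi : R -> R).
Notation mu := (@lebesgue_measure R).
Local Notation integ V := (mu.-integrable setT (EFin \o V)).
Local Notation dist V W := (\int[mu]_x `|V x - W x|%:E)%E.

Definition abel_operator (g : R) (V : R -> R) : R -> R :=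
  kernel_operator mu (dpsi_abel_kernel a b psi g) V.

Definition exp_weight (lam : R) (t : R) : R := expR (- (lam * psi_oo a b psi t)).

Hypothesis ab : a < b.
Hypothesis hpsi : C1_increasing a b psi.

Lemma integ_ae_eq (V W : R -> R) : measurable_fun setT V -> integ W ->
  {ae mu, forall t, V t = W t} -> integ V.
Proof.
move=> mV /integrableP[_ iW] VW; apply/integrableP; split; first exact/measurable_EFinP.
apply: le_lt_trans iW; rewrite le_eqVlt; apply/orP; left; apply/eqP.
by apply: eq_integral_ae; apply: filterS VW => t /= -> _.
Qed.

(** Taken from the weighted bound with [lam] equal to 1: on the interval the ratio of two weights is
    at least $e^{-(\psi(b)-\psi(a))}$. *)
Lemma dpsi_abel_kernel_le (g s : R) : 0 < g <= 1 ->
  (\int[mu]_t (dpsi_abel_kernel a b psi g (t, s))%:E <=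
   (expR (psi b - psi a) * abel_bound a b psi 1 g)%:E)%E.
Proof.
move=> g01.
have mw := measurable_weighted_abel_kernel hpsi 1 g.
rewrite EFinM; apply: (@le_trans _ _ ((expR (psi b - psi a))%:E *
  \int[mu]_t (weighted_abel_kernel a b psi 1 g (t, s))%:E)%E); last first.
  by rewrite lee_wpmul2l ?lee_fin ?expR_ge0// weighted_abel_kernel_le.
have mws : measurable_fun setT (fun t => weighted_abel_kernel a b psi 1 g (t, s)).
  exact: (measurableT_comp mw (measurable_pair2 s)).
rewrite -ge0_integralZl; [|exact: measurableT|exact/measurable_EFinP|
  by move=> t _; rewrite lee_fin weighted_abel_kernel_ge0|by rewrite lee_fin expR_ge0].
apply: ge0_le_integral => //.
- by move=> t _; rewrite lee_fin dpsi_abel_kernel_ge0.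
- apply/measurable_EFinP.
  exact: (measurableT_comp (measurable_dpsi_abel_kernel hpsi g) (measurable_pair2 s)).
- by apply: emeasurable_funM => //; exact/measurable_EFinP.
move=> t _; rewrite -EFinM lee_fin /weighted_abel_kernel /=.
have [tab|tab] := boolP (t \in `]a, b[); last first.
  by rewrite /dpsi_abel_kernel abel_kernel_out1// !(mulr0, mul0r).
have [sab|sab] := boolP (s \in `]a, b[); last first.
  by rewrite /dpsi_abel_kernel abel_kernel_out2// !(mulr0, mul0r).
rewrite !mul1r !psi_ooE//.
rewrite [leRHS](_ : _ = expR ((psi b - psi a) + (- psi t + psi s)) *
    dpsi_abel_kernel a b psi g (t, s)); last by rewrite !expRD; ring.
rewrite ler_peMl ?dpsi_abel_kernel_ge0// -[leLHS]expR0 ler_expR.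
move: tab sab; rewrite !in_itv/= => /andP[a_t tb] /andP[as_ sb].
have h1 : psi t <= psi b by apply: (psi_le hpsi) => //; exact: ltW.
have h2 : psi a <= psi s by apply: (psi_le hpsi) => //; exact: ltW.
lra.
Qed.

Section fixed_exponent.
Variables (g : R).
Hypothesis g01 : 0 < g <= 1.

Let k := dpsi_abel_kernel a b psi g.
Let mk : measurable_fun setT k.
Proof. exact: measurable_dpsi_abel_kernel. Qed.
Let k0 z : 0 <= k z. Proof. exact: dpsi_abel_kernel_ge0. Qed.
Let kc s := dpsi_abel_kernel_le s g01.

Lemma abel_operator_integrable V : integ V -> integ (abel_operator g V).
Proof.
move=> iV.
exact: (@kernel_operator_integrable _ (measurableTypeR R) R mu _ _ _ mk k0 kc iV).
Qed.

Lemma abel_operator_ae V : integ V ->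
  {ae mu, forall t, integ (fun s => k (t, s) * V s)}.
Proof.
move=> iV.
exact: (@kernel_operator_ae_integrable _ (measurableTypeR R) R mu _ _ _ mk k0 kc iV).
Qed.

Lemma measurable_exp_weight lam : measurable_fun setT (exp_weight lam).
Proof.
have := measurable_weight hpsi (- lam).
by apply: eq_measurable_fun => t _; rewrite /exp_weight mulNr.
Qed.

Lemma exp_weight_gt0 lam t : 0 < exp_weight lam t.
Proof. exact: expR_gt0. Qed.

Lemma exp_weight_bounded lam : exists M, forall t, `|exp_weight lam t| <= M.
Proof.
pose m := Num.max 0 (Num.max `|psi a| `|psi b|).
exists (expR (`|lam| * m)) => t.
rewrite ger0_norm ?(ltW (exp_weight_gt0 _ _))// /exp_weight ler_expR.
rewrite (le_trans (ler_norm _))// normrN normrM ler_wpM2l// /m le_max.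
rewrite /psi_oo patchE; case: ifPn; last by rewrite normr0 lexx.
rewrite inE/= in_itv/= => /andP[a_t tb].
have h1 : psi t <= psi b by apply: (psi_le hpsi) => //; exact: ltW.
have h2 : psi a <= psi t by apply: (psi_le hpsi) => //; exact: ltW.
apply/orP; right; rewrite le_max; have [pt|pt] := leP 0 (psi t).
  by apply/orP; right; rewrite (ger0_norm pt) (le_trans h1)// ler_norm.
apply/orP; left; rewrite (ltr0_norm pt) ltr0_norm; first by rewrite lerN2.
exact: le_lt_trans pt.
Qed.

Lemma integ_exp_weight lam V : integ V <-> integ (fun t => exp_weight lam t * V t).
Proof.
have H l W : integ W -> integ (fun t => exp_weight l t * W t).
  move=> iW; have [M hM] := exp_weight_bounded l.
  have mW := integ_measurable iW.
  have iMW := integrableZl measurableT M iW.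
  apply: (le_integrable measurableT _ _ iMW).
    by apply/measurable_EFinP; apply: measurable_funM => //; exact: measurable_exp_weight.
  by move=> t _; rewrite /= lee_fin !normrM ler_wpM2r// (le_trans (hM t))// ler_norm.
split; first exact: H.
move=> /(H (- lam)); apply: eq_integrable => // t _ /=.
by rewrite mulrA -expRD mulNr opprK subrr expR0 mul1r.
Qed.

Lemma abel_operator_contraction lam V W : 0 < lam -> integ V -> integ W ->
  (dist (fun t => exp_weight lam t * abel_operator g V t)
        (fun t => exp_weight lam t * abel_operator g W t) <=
   (abel_bound a b psi lam g)%:E * dist (fun t => exp_weight lam t * V t)
        (fun t => exp_weight lam t * W t))%E.
Proof.
move=> lam0 iV iW.
pose D t := exp_weight lam t * V t - exp_weight lam t * W t.
have iD : integ D.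
  exact: (integrableB measurableT ((integ_exp_weight lam V).1 iV)
           ((integ_exp_weight lam W).1 iW)).
have mw := measurable_weighted_abel_kernel hpsi lam g.
have w0 := weighted_abel_kernel_ge0 hpsi lam g.
have wc s := weighted_abel_kernel_le ab hpsi s g01 lam0.
have := @kernel_operator_norm _ (measurableTypeR R) R mu _ _ _ mw w0 wc iD; apply: le_trans.
rewrite le_eqVlt; apply/orP; left; apply/eqP; apply: eq_integral_ae.
have aeV := abel_operator_ae iV; have aeW := abel_operator_ae iW.
apply: filterS2 aeV aeW => t it it' _; congr (`|_|%:E).
rewrite -mulrBr /abel_operator /kernel_operator -RintegralB//.
rewrite -RintegralZl//; last exact: (integrableB measurableT it it').
apply: eq_Rintegral => s _.
rewrite /D /weighted_abel_kernel /exp_weight /k /=; set y := lam * psi_oo a b psi s.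
have E : expR y * expR (- y) = 1 by rewrite -expRD subrr expR0.
transitivity (expR (- (lam * psi_oo a b psi t)) * dpsi_abel_kernel a b psi g (t, s) *
  (expR y * expR (- y)) * (V s - W s)); last by ring.
by rewrite E; ring.
Qed.

End fixed_exponent.
End abel_operator.

(** * Composition and injectivity of Abel operators *)

Section abel_inversion.
Context {R : realType} (a b : R) (psi : R -> R).
Notation mu := (@lebesgue_measure R).
Local Notation integ V := (mu.-integrable setT (EFin \o V)).
Hypothesis ab : a < b.
Hypothesis hpsi : C1_increasing a b psi.

Local Notation kap := (abel_kernel a b psi).
Local Notation abelop := (abel_operator a b psi).

(** At order one the kernel is constant, so each stage of an iterated primitive is also an Abel
    operator, and the norm estimates cover it. *)
Lemma abel_operator1 V : integ V -> forall t,
  abelop 1 V t = dpsi a b psi t * \int[mu]_(s in `]a, t[) V s.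
Proof.
move=> iV t; rewrite /abel_operator /kernel_operator.
have [tab|tab] := boolP (t \in `]a, b[); last first.
  rewrite dpsi_out// mul0r /Rintegral integral0_eq// => s _.
  by rewrite /dpsi_abel_kernel abel_kernel_out1// mulr0 mul0r.
rewrite [X in _ = _ * X]Rintegral_mkcond -RintegralZl//; last first.
  by rewrite -restrict_EFin; apply/integrable_restrict => //=; rewrite setTI;
     exact: integrableS iV.
apply: eq_Rintegral => s _; rewrite /dpsi_abel_kernel/= -mulrA; congr (_ * _).
move: tab; rewrite in_itv/= => /andP[a_t tb].
rewrite patchE /abel_kernel/= tb andbT; case: ifPn => [/andP[as_ st]|nst].
  by rewrite subrr powRr0 mul1r mem_set//= in_itv/= as_.
rewrite mul0r memNset//= in_itv/=; exact/negP.
Qed.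

(** With [t] fixed this is a kernel in the pair [(r, s)]. Integrating out [s] gives the inner Abel
    operator; integrating out [r], when the orders add up to 1, gives the Beta integral, a constant
    for $a < s < t$. *)
Let compose_kernel (g h t : R) (z : R * R) := kap g (t, z.1) * dpsi_abel_kernel a b psi h z.

Let mcomp g h t : measurable_fun setT (compose_kernel g h t).
Proof.
apply: measurable_funM; last exact: measurable_dpsi_abel_kernel.
exact: (measurableT_comp (measurableT_comp (measurable_abel_kernel hpsi g)
  (measurable_pair1 t)) measurable_fst).
Qed.

Let comp0 g h t z : 0 <= compose_kernel g h t z.
Proof. by rewrite mulr_ge0 ?abel_kernel_ge0 ?dpsi_abel_kernel_ge0. Qed.

Let compE (g s t : R) : 0 < g < 1 -> t \in `]a, b[ ->
  (\int[mu]_r (compose_kernel g (1 - g) t (r, s))%:E =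
   (if (a < s) && (s < t) then beta_const g else 0)%:E)%E.
Proof.
move=> g01; rewrite in_itv/= => /andP[a_t tb]; case: ifPn => [/andP[as_ st]|nst].
  rewrite -(beta_integral_psi hpsi g01 (ltW as_) st (ltW tb)).
  rewrite [RHS]integral_mkcond; apply: eq_integral => r _.
  rewrite patchE /compose_kernel; case: ifPn => [|rst].
    rewrite inE/= in_itv/= => /andP[sr rt].
    have as' := lt_trans as_ sr; have rb := lt_trans rt tb.
    rewrite /dpsi_abel_kernel/= !abel_kernelE// dpsiE; last by rewrite in_itv/= as'.
    by rewrite (_ : 1 - g - 1 = - g); [congr EFin; ring|ring].
  congr EFin; have [rt|] := ltP r t; last first.
    by move=> tr; rewrite /= abel_kernel_out ?mul0r// -leNgt.
  rewrite /dpsi_abel_kernel /= (@abel_kernel_out _ _ _ _ (1 - g)) ?mulr0//.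
  by apply: contra rst => sr; rewrite inE/= in_itv/= sr.
rewrite integral0_eq// => r _; congr EFin; rewrite /compose_kernel /dpsi_abel_kernel /=.
rewrite /abel_kernel /=; case: ifP => [/and3P[ar rt _]|]; last by rewrite mul0r.
case: ifP => [/and3P[as_ sr rb]|]; last by rewrite !mulr0.
by move: nst; rewrite as_ (lt_trans sr rt).
Qed.

Section composition.
Variables (g t : R) (V : R -> R).
Hypotheses (g01 : 0 < g < 1) (tab : t \in `]a, b[) (iV : integ V).

Let k := compose_kernel g (1 - g) t.
Let mk : measurable_fun setT k. Proof. exact: mcomp. Qed.
Let k0 z : 0 <= k z. Proof. exact: comp0. Qed.
Let kc s : (\int[mu]_r (k (r, s))%:E <= (beta_const g)%:E)%E.
Proof.
rewrite compE// lee_fin; case: ifP => // _; exact/ltW/beta_const_gt0.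
Qed.

Let kE : {ae mu, forall r, kernel_operator mu k V r = kap g (t, r) * abelop (1 - g) V r}.
Proof.
have g01' : 0 < 1 - g <= 1 by case/andP: g01 => *; apply/andP; split; lra.
have := abel_operator_ae ab hpsi g01' iV; apply: filterS => r ir.
rewrite /kernel_operator /abel_operator /kernel_operator -RintegralZl//.
by apply: eq_Rintegral => s _; rewrite /k /compose_kernel/= mulrA.
Qed.

Lemma abel_compose_integrable : integ (fun r => kap g (t, r) * abelop (1 - g) V r).
Proof.
have ik := @kernel_operator_integrable _ (measurableTypeR R) R mu _ _ _ mk k0 kc iV.
apply: (integ_ae_eq _ ik).
  apply: measurable_funM.
    exact: (measurableT_comp (measurable_abel_kernel hpsi g) (measurable_pair1 t)).
  have g01' : 0 < 1 - g <= 1 by case/andP: g01 => *; apply/andP; split; lra.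
  exact: integ_measurable (abel_operator_integrable ab hpsi g01' iV).
by apply: filterS kE => r ->.
Qed.

Lemma abel_compose : \int[mu]_r (kap g (t, r) * abelop (1 - g) V r) =
  beta_const g * \int[mu]_(s in `]a, t[) V s.
Proof.
transitivity (\int[mu]_r kernel_operator mu k V r).
  by apply: eq_Rintegral_ae; apply: filterS kE => r ->.
rewrite (@integral_kernel_operator _ (measurableTypeR R) R mu _ _ _ mk k0 kc iV).
rewrite [X in _ = _ * X]Rintegral_mkcond -RintegralZl//; last first.
  by rewrite -restrict_EFin; apply/integrable_restrict => //=; rewrite setTI;
     exact: integrableS iV.
apply: eq_Rintegral => s _; rewrite {1}/Rintegral compE//= patchE.
case: ifPn => st; first by rewrite mem_set//= in_itv.
by rewrite mul0r memNset ?mulr0//= in_itv/=; exact/negP.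
Qed.

End composition.

(** The case of [abel_compose] in which [V] is a unit point mass at [a]. It produces the constant
    term $c_n$ in the Abel equation. *)
Lemma abel_beta (g t : R) : 0 < g < 1 -> t \in `]a, b[ ->
  integ (fun r => kap g (t, r) * (dpsi a b psi r * (psi_oo a b psi r - psi a) `^ (- g))) /\
  \int[mu]_r (kap g (t, r) * (dpsi a b psi r * (psi_oo a b psi r - psi a) `^ (- g)))
    = beta_const g.
Proof.
move=> g01 tab; have := tab; rewrite in_itv/= => /andP[a_t tb].
set f := fun r => _.
have f0 r : 0 <= f r.
  by rewrite !mulr_ge0 ?abel_kernel_ge0 ?powR_ge0 ?dpsi_ge0.
have mf : measurable_fun setT f.
  apply: measurable_funM.
    exact: (measurableT_comp (measurable_abel_kernel hpsi g) (measurable_pair1 t)).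
  apply: measurable_funM; first exact: measurable_dpsi.
  apply: (measurableT_comp (measurable_powR (- g))).
  by apply: measurable_funB => //; exact: measurable_psi_oo.
have fE : (\int[mu]_r (f r)%:E = (beta_const g)%:E)%E.
  rewrite -(beta_integral_psi hpsi g01 (lexx a) a_t (ltW tb)).
  rewrite [RHS]integral_mkcond; apply: eq_integral => r _.
  rewrite patchE /f; case: ifPn => [|rst].
    rewrite inE/= in_itv/= => /andP[ar rt]; have rb := lt_trans rt tb.
    have rab : r \in `]a, b[ by rewrite in_itv/= ar.
    by rewrite abel_kernelE// dpsiE// psi_ooE//; congr EFin; ring.
  congr EFin; rewrite /abel_kernel /=; case: ifP => [/and3P[ar rt _]|]; last by rewrite mul0r.
  by exfalso; move/negP: rst; apply; rewrite inE/= in_itv/= ar.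
split; last by rewrite /Rintegral fE.
apply/integrableP; split; first exact/measurable_EFinP.
apply: le_lt_trans (ltry (beta_const g)); rewrite -fE le_eqVlt.
by apply/orP; left; apply/eqP; apply: eq_integral => r _; rewrite /= ger0_norm.
Qed.

(** Applying the operator of complementary order $1-g$ turns the hypothesis into the vanishing of
    all integrals of [V] from [a], and these are differentiated almost everywhere. *)
Lemma abel_injective (g : R) V : 0 < g < 1 -> integ V ->
  {ae mu, forall t, t \in `]a, b[ -> \int[mu]_s (kap g (t, s) * V s) = 0} ->
  {ae mu, forall t, t \in `]a, b[ -> V t = 0}.
Proof.
move=> g01 iV V0.
have g01' : 0 < 1 - g < 1 by case/andP: g01 => *; apply/andP; split; lra.
have g01'' : 0 < g <= 1 by case/andP: g01 => *; apply/andP; split; lra.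
have aV0 : {ae mu, forall t, abelop g V t = 0}.
  have := abel_operator_ae ab hpsi g01'' iV; apply: filterS2 V0 => t V0t it.
  have [tab|tab] := boolP (t \in `]a, b[); last first.
    rewrite /abel_operator /kernel_operator /Rintegral integral0_eq// => s _.
    by rewrite /dpsi_abel_kernel abel_kernel_out1// mulr0 mul0r.
  have pt := dpsi_gt0 hpsi tab.
  transitivity (dpsi a b psi t * \int[mu]_s (kap g (t, s) * V s)); last by rewrite V0t// mulr0.
  rewrite -RintegralZl//.
    by apply: eq_Rintegral => s _; rewrite /dpsi_abel_kernel/= mulrA.
  have := integrableZl measurableT (dpsi a b psi t)^-1 it; apply: eq_integrable => // s _.
  by rewrite /= -EFinM /dpsi_abel_kernel/= !mulrA mulVf ?mul1r// gt_eqF.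
have I0 t : t \in `]a, b[ -> \int[mu]_(s in `]a, t[) V s = 0.
  move=> tab; have := abel_compose g01' tab iV.
  rewrite subKr (_ : \int[mu]_r _ = 0); last first.
    rewrite (@eq_Rintegral_ae _ _ _ _ _ _ (cst 0)).
      by rewrite /Rintegral integral0.
    by apply: filterS aV0 => r -> _; rewrite mulr0.
  move=> /esym/eqP; rewrite mulf_eq0 gt_eqF ?beta_const_gt0//=.
  by move=> /eqP.
have iVab : mu.-integrable `]a, b[ (EFin \o V) by exact: integrableS iV.
have := integral_derive_ae iVab; apply: filterS => t dV tab.
have [_ <-] := dV tab.
have H : {in `]a, b[, (fun t => \int[mu]_(s in `]a, t[) V s) =1 cst 0}.
  by move=> s sab; rewrite I0.
by have [-> _] := eq_in_oo_derive H tab; rewrite derive1_cst.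
Qed.

Lemma RLint_abel (g : R) (u V : R -> R) t : g != 0 -> t \in `]a, b[ ->
  {ae mu, forall s, s \in `]a, b[ -> V s = derive1 psi s * u s} ->
  RLint a psi g u t = (Gamma g)^-1 * \int[mu]_s (kap g (t, s) * V s).
Proof.
move=> g0; rewrite in_itv/= => /andP[a_t tb] Vu; rewrite /RLint (negbTE g0); congr (_ * _).
rewrite Rintegral_mkcond; apply: eq_Rintegral_ae; apply: filterS Vu => s Vu _.
rewrite patchE; case: ifPn => [|sat].
  rewrite inE/= in_itv/= => /andP[as_ st].
  rewrite abel_kernelE// Vu; last by rewrite in_itv/= as_ (lt_trans st).
  have -> : g - 1 = - (1 - g) by rewrite opprB.
  by rewrite powRN mulrC.
rewrite /abel_kernel/=; case: ifP => [/and3P[as_ st _]|]; last by rewrite mul0r.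
by exfalso; move/negP: sat; apply; rewrite inE/= in_itv/= as_.
Qed.

End abel_inversion.

(** * Iterated primitives *)

Lemma eq_continuous_ae {R : realType} (a b : R) (f g : R -> R) :
  {in `]a, b[, continuous f} -> {in `]a, b[, continuous g} ->
  (\forall t \ae @lebesgue_measure R, t \in `]a, b[ -> f t = g t) ->
  {in `]a, b[, f =1 g}.
Proof.
move=> cf cg [N [mN N0 fgN]] t tab; apply/eqP/negP => /negP fgt.
have h0 : f t - g t != 0 by rewrite subr_eq0.
have ch : {for t, continuous (fun s => f s - g s)}.
  by apply: continuousB; [exact: cf|exact: cg].
have : \forall s \near t, (s \in `]a, b[) && (f s - g s != 0).
  near=> s; apply/andP; split; first by near: s; exact: near_in_itvoo.
  by near: s; exact: (cvgr_neq0 _ ch h0).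
move=> /nbhs_ballP[e /= e0 eN].
have : (@lebesgue_measure R (ball t e) <= @lebesgue_measure R N)%E.
  rewrite le_measure ?inE//; first exact: measurable_ball.
  move=> s /eN/andP[sab fgs]; apply: fgN => /= /(_ sab)/eqP.
  by rewrite -subr_eq0 (negbTE fgs).
rewrite N0 lebesgue_measure_ball ?(ltW e0)// lee_fin leNgt.
by rewrite mulrn_wgt0.
Unshelve. all: by end_near. Qed.

Section primitives.
Context {R : realType} (a b : R) (psi : R -> R).
Notation mu := (@lebesgue_measure R).
Local Notation integ V := (mu.-integrable setT (EFin \o V)).
Hypothesis ab : a < b.
Hypothesis hpsi : C1_increasing a b psi.

Local Notation dpsi := (dpsi a b psi).
Local Notation rho := (rho psi).

(* The constants are numbered so that [iter_primitive c H j] tends to [c j.+1] at a. *)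
Fixpoint iter_density (c : nat -> R) (H : R -> R) (j : nat) : R -> R :=
  if j is i.+1 then fun t => dpsi t * (c j + \int[mu]_(s in `]a, t[) iter_density c H i s)
  else H.

Definition iter_primitive (c : nat -> R) (H : R -> R) (j : nat) (t : R) : R :=
  c j.+1 + \int[mu]_(s in `]a, t[) iter_density c H j s.

Implicit Types (c : nat -> R) (H : R -> R).

Lemma iter_densityS c H j t :
  iter_density c H j.+1 t = dpsi t * iter_primitive c H j t.
Proof. by []. Qed.

Lemma dpsi_integrable : integ dpsi.
Proof.
have mp := measurable_dpsi hpsi.
apply/integrableP; split; first exact/measurable_EFinP.
have E := integral_psi_powR ab hpsi (lexx a) ab ltr01.
apply: (@le_lt_trans _ _ ((psi b - psi a) `^ 1)%:E); last exact: ltry.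
rewrite -E [leRHS]integral_mkcond le_eqVlt; apply/orP; left; apply/eqP.
apply: eq_integral => t _; rewrite /= ger0_norm ?dpsi_ge0// patchE.
case: ifPn => [|tab].
  by rewrite inE/= => tab; rewrite dpsiE// subrr powRr0 !mul1r.
by rewrite dpsi_out//; apply: contra tab => tab; rewrite inE.
Qed.

Lemma iter_density_integrable c H j : integ H -> integ (iter_density c H j).
Proof.
move=> iH; elim: j => //= j IH.
have i1 := integrableZl measurableT (c j.+1) dpsi_integrable.
have i2 := abel_operator_integrable ab hpsi (_ : 0 < 1 <= 1) IH.
have {}i2 := i2 (introT andP (conj ltr01 (lexx 1))).
have := integrableD measurableT i1 i2; apply: eq_integrable => // t _ /=.
by rewrite (abel_operator1 a b psi IH) -EFinM -EFinD mulrDr mulrC.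
Qed.

Let integ_oo V : integ V -> mu.-integrable `]a, b[ (EFin \o V).
Proof. by move=> iV; exact: integrableS iV. Qed.

Lemma iter_primitive_AC c H j : integ H ->
  absolutely_continuous a b (iter_primitive c H j).
Proof.
move=> iH; apply: absolutely_continuous_integral; apply: integ_oo.
exact: iter_density_integrable.
Qed.

Lemma iter_primitive_continuous c H j : integ H ->
  {in `]a, b[, continuous (iter_primitive c H j)}.
Proof.
move=> iH; have := absolutely_continuous_continuous ab (iter_primitive_AC c j iH).
by move=> /(continuous_within_itvP _ ab)[].
Qed.

Lemma iter_primitive_cvg c H j : integ H ->
  iter_primitive c H j t @[t --> a^'+] --> c j.+1.
Proof.
move=> iH; apply: (@integral_cvg_at_right _ a b (c j.+1) _ ab); apply: integ_oo.
exact: iter_density_integrable.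
Qed.

Lemma iter_density_continuous c H j : integ H ->
  {in `]a, b[, continuous (iter_density c H j.+1)}.
Proof.
move=> iH t tab.
have cE : {in `]a, b[, iter_density c H j.+1 =1
    (fun t => derive1 psi t * iter_primitive c H j t)}.
  by move=> s sab; rewrite iter_densityS dpsiE.
apply: (@cvg_trans _ ((fun t => derive1 psi t * iter_primitive c H j t) @ t)).
  apply: near_eq_cvg; near=> s; apply/esym/cE; near: s; exact: near_in_itvoo.
have : derive1 psi s * iter_primitive c H j s @[s --> t] -->
    derive1 psi t * iter_primitive c H j t.
  apply: cvgM; first exact: (psi'_continuous hpsi).
  exact: iter_primitive_continuous.
by rewrite cE.
Unshelve. all: by end_near. Qed.

Lemma iter_primitive_derive c H j t : integ H -> t \in `]a, b[ ->
  derivable (iter_primitive c H j.+1) t 1 /\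
  rho (iter_primitive c H j.+1) t = iter_primitive c H j t.
Proof.
move=> iH tab.
have iY := integ_oo (iter_density_integrable c j.+1 iH).
have [dP P't] := continuous_integral_derive (c j.+2)
  (@iter_density_continuous c H j iH) iY tab.
split => //; rewrite /rho.
rewrite [derive1 _ t]P't iter_densityS dpsiE// mulrC mulKf// gt_eqF//.
exact: (psi'_gt0 hpsi).
Qed.

Lemma eq_rho f g : {in `]a, b[, f =1 g} -> {in `]a, b[, rho f =1 rho g}.
Proof. by move=> fg t tab; rewrite /rho; have [-> _] := eq_in_oo_derive fg tab. Qed.

Lemma eq_iter_rho k f g : {in `]a, b[, f =1 g} ->
  {in `]a, b[, iter k rho f =1 iter k rho g}.
Proof. by move=> fg; elim: k => //= k; exact: eq_rho. Qed.

Lemma iter_rho_primitive c H j k : integ H -> (k <= j)%N ->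
  {in `]a, b[, iter k rho (iter_primitive c H j) =1 iter_primitive c H (j - k)}.
Proof.
move=> iH; elim: k => [|k IH] kj; first by rewrite subn0.
move=> t tab; rewrite /= (eq_rho (IH (ltnW kj)) tab) subnS.
have := kj; rewrite -subn_gt0 => /prednK <-.
by have [_ ->] := iter_primitive_derive c (j - k).-1 iH tab.
Qed.

Lemma ACpsi_primitive c H j m : integ H -> (0 < m <= j.+1)%N ->
  ACpsi a b psi m (iter_primitive c H j).
Proof.
move=> iH /andP[m0 mj]; have mj' : (m.-1 <= j)%N by rewrite -ltnS prednK.
split.
  move=> k km t tab; have kj := leq_trans km mj'.
  have [_ h] := eq_in_oo_derive (iter_rho_primitive c iH (ltnW kj)) tab.
  apply/h; have := kj; rewrite -subn_gt0 => /prednK <-.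
  by have [] := iter_primitive_derive c (j - k).-1 iH tab.
exists (iter_primitive c H (j - m.-1)); first exact: iter_primitive_AC.
exact: iter_rho_primitive.
Qed.

(** All differentiations but the last are classical; the last meets a merely integrable [H], hence
    holds only almost everywhere. *)
Lemma rho_primitive_ae c H j : integ H ->
  {ae mu, forall t, t \in `]a, b[ ->
    iter j.+1 rho (iter_primitive c H j) t = H t / derive1 psi t}.
Proof.
move=> iH; have := integral_derive_ae (integ_oo iH).
apply: filterS => t dI tab; have [dI1 dI2] := dI tab.
rewrite iterS (eq_rho (iter_rho_primitive c iH (leqnn j)) tab) subnn /rho.
suff -> : derive1 (iter_primitive c H 0) t = H t by [].
rewrite /iter_primitive derive1E deriveD; [|exact: derivable_cst|exact: dI1].
by rewrite derive_cst add0r -derive1E.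
Qed.

(** The top derivative is the integral of an $L^1$ function; one then integrates downwards with
    [derivable_ftc], whose integrand is continuous from the second stage on. *)
Lemma primitive_ACpsi j w : ACpsi a b psi j.+1 w ->
  exists c, exists2 H, integ H & forall k, (k <= j)%N ->
    {in `]a, b[, iter (j - k) rho w =1 iter_primitive c H k}.
Proof.
move=> [dw [F acF wF]]; have [H iH FH] := absolutely_continuous_density ab acF.
(* One sequence of constants has to serve all stages, so it is fixed in advance by limits at [a].
   That these exist is seen at each stage from the integral form just obtained. *)
pose c k := lim (iter (j.+1 - k) rho w t @[t --> a^'+]).
exists c; exists H => // k kj.
have limE d k' G : integ G -> (k' <= j)%N ->
    {in `]a, b[, iter (j - k') rho w =1 (fun t => d + \int[mu]_(s in `]a, t[) G s)} ->
    d = c k'.+1.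
  move=> iG k'j wG; rewrite /c subSS.
  suff : iter (j - k') rho w t @[t --> a^'+] --> d by move=> /cvg_lim ->.
  have := @integral_cvg_at_right _ a b d _ ab (integ_oo iG); apply: cvg_trans.
  apply: near_eq_cvg; near=> t; apply/esym/wG; rewrite in_itv/=; apply/andP; split.
    by near: t; exact: nbhs_right_gt.
  by near: t; exact: nbhs_right_lt.
elim: k kj => [|k IH] kj.
  rewrite subn0.
  have E : {in `]a, b[, iter j rho w =1 (fun t => F a + \int[mu]_(s in `]a, t[) H s)}.
    move=> t tab; rewrite wF// FH; last by move: tab; rewrite in_itv/= => /andP[/ltW-> /ltW->].
    rewrite Rintegral_itv_bndo_bndc//; exact: integrableS iH.
  move=> t tab; rewrite E// /iter_primitive; congr (_ + _).
  by apply: (limE _ _ _ iH) => //; rewrite subn0.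
have dw' : {in `]a, b[, forall t, derivable (iter (j - k.+1) rho w) t 1 /\
    derive1 (iter (j - k.+1) rho w) t = iter_density c H k.+1 t}.
  move=> t tab; split; first by apply: dw => //; rewrite /= -subn_gt0 subKn.
  rewrite iter_densityS dpsiE// -(IH (ltnW kj) t tab).
  have -> : (j - k = (j - k.+1).+1)%N by rewrite subnS prednK// subn_gt0.
  by rewrite /= /Defs.rho mulrC divfK// gt_eqF// (psi'_gt0 hpsi).
have iY := iter_density_integrable c k.+1 iH.
have [d wd] := derivable_ftc ab dw' (@iter_density_continuous c H k iH) (integ_oo iY).
move=> t tab; rewrite wd// /iter_primitive; congr (_ + _).
exact: (limE _ _ _ iY).
Unshelve. all: by end_near. Qed.

Lemma eq_iter_primitive c c' H H' j :
  (forall k, (0 < k <= j.+1)%N -> c k = c' k) ->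
  {ae mu, forall t, t \in `]a, b[ -> H t = H' t} ->
  {in `]a, b[, iter_primitive c H j =1 iter_primitive c' H' j}.
Proof.
move=> cc' HH'; elim: j cc' => [|j IH] cc' t tab.
  have I : \int[mu]_(s in `]a, t[) H s = \int[mu]_(s in `]a, t[) H' s.
    apply: eq_Rintegral_ae; apply: filterS HH' => s + sat; apply.
    move: tab sat; rewrite /= !in_itv/= => /andP[_ tb] /andP[-> st]/=.
    exact: lt_trans tb.
  by rewrite /iter_primitive /iter_density I cc'.
have I : \int[mu]_(s in `]a, t[) iter_density c H j.+1 s =
         \int[mu]_(s in `]a, t[) iter_density c' H' j.+1 s.
  apply: eq_Rintegral => s /set_mem sat.
  rewrite !iter_densityS IH//.
    by move=> k /andP[k0 kj]; rewrite cc'// k0 ltnW.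
  move: tab sat; rewrite /= !in_itv/= => /andP[_ tb] /andP[-> st]/=.
  exact: lt_trans tb.
by rewrite /iter_primitive I cc'// ltnSn.
Qed.

End primitives.

(** * Superposition *)

Section Gamma.
Context {R : realType}.
Notation mu := (@lebesgue_measure R).

(** Integrability is the point, since a divergent real integral would be 0. The integrand is
    dominated by $t^{x-1}$ on []0, 1[] plus the exponential density. *)
Lemma Gamma_gt0 (x : R) : 0 < x < 1 -> 0 < Gamma x.
Proof.
move=> /andP[x0 x1]; pose f t : R := t `^ (x - 1) * expR (- t).
have mf : measurable_fun setT f.
  apply: measurable_funM; first exact: measurable_powR.
  exact: (measurableT_comp (@measurable_expR R) (@oppr_measurable R setT)).
have f0 t : 0 < t -> 0 < f t by move=> t0; rewrite mulr_gt0 ?powR_gt0 ?expR_gt0.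
pose g t : R := ((fun t => t `^ (x - 1)) \_ `]0, 1[) t.
have ig : mu.-integrable setT (EFin \o g).
  rewrite /g -restrict_EFin; apply/integrable_restrict => //=; rewrite setTI.
  apply/integrableP; split.
    by apply/measurable_EFinP; apply: measurable_funTS; exact: measurable_powR.
  apply: (@le_lt_trans _ _ (x^-1)%:E); last exact: ltry.
  rewrite -(integral_powR x0) le_eqVlt; apply/orP; left; apply/eqP.
  by apply: eq_integral => t _; rewrite /= ger0_norm ?powR_ge0.
have ih := integrable_exponential_pdf (@ltr01 R).
have iff : mu.-integrable `]0, +oo[ (EFin \o f).
  have igh : mu.-integrable `]0, +oo[ (fun t => (EFin \o g) t + (EFin \o exponential_pdf 1) t)%E.
    by apply: integrableS (integrableD measurableT ig ih).
  apply: le_integrable igh => //.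
    by apply/measurable_EFinP; exact: measurable_funTS.
  move=> t /=; rewrite in_itv/= andbT => t0.
  rewrite lee_fin (gtr0_norm (f0 _ t0)) (le_trans _ (ler_norm _))//.
  have -> : exponential_pdf 1 t = expR (- t).
    by rewrite exponential_pdfE ?ltW//= mul1r mulN1r.
  rewrite /g patchE.
  have e1 : expR (- t) <= 1 by rewrite -expR0 ler_expR oppr_le0 ltW.
  case: ifPn => [|tn].
    rewrite inE/= in_itv/= => _.
    by rewrite -[leLHS]addr0 lerD ?expR_ge0// ler_piMr ?powR_ge0.
  have t1 : 1 <= t.
    by rewrite leNgt; apply: contra tn => t1; rewrite inE/= in_itv/= t0.
  rewrite add0r ler_piMl ?expR_ge0// -[leRHS](powRr0 t) ler_powR//; lra.
have mu0y : (0 < mu (`]0%R, +oo[%classic : set R))%E.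
  by rewrite lebesgue_measure_itv/= ltry ?ltey.
rewrite /Gamma; apply: Rintegral_gt0 => //.
by move=> t /=; rewrite in_itv/= andbT; exact: f0.
Qed.

End Gamma.

Lemma measurable_inv_ge0 {R : realType} (f : R -> R) :
  measurable_fun setT f -> (forall t, 0 <= f t) -> measurable_fun setT (fun t => (f t)^-1).
Proof.
move=> mf f0; have := measurableT_comp (measurable_powR (- 1)) mf.
by apply: eq_measurable_fun => t _ /=; rewrite powR_inv1.
Qed.

(** * The space [L1psi] in terms of densities *)

Section L1psi_density.
Context {R : realType} (a b : R) (psi : R -> R).
Notation mu := (@lebesgue_measure R).
Local Notation integ V := (mu.-integrable setT (EFin \o V)).
Hypothesis ab : a < b.
Hypothesis hpsi : C1_increasing a b psi.
Local Notation dpsi := (dpsi a b psi).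

Lemma ae_neq (c : R) : {ae mu, forall t, t != c}.
Proof.
exists [set c]; split => //; first exact: lebesgue_measure_set1.
by move=> t /= /negP; rewrite negbK => /eqP.
Qed.

Lemma L1psi_density u : L1psi a b psi u ->
  exists2 V, integ V & {ae mu, forall t, t \in `]a, b[ -> V t = derive1 psi t * u t}.
Proof.
move=> [v [mv uv iv]]; exists (fun t => dpsi t * v t); last first.
  apply: filterS uv => t uv tab; rewrite dpsiE// uv//.
  by move: tab; rewrite !in_itv/= => /andP[/ltW-> /ltW->].
have E : (fun t => dpsi t * v t) = (fun t => derive1 psi t * v t) \_ `]a, b[.
  by apply/funext => t; rewrite -[dpsi t]/(((derive1 psi) \_ `]a, b[) t) !patchE; case: ifP; rewrite ?mul0r.
rewrite E -restrict_EFin; apply/integrable_restrict => //=; rewrite setTI.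
have mv' : measurable_fun `]a, b[ v.
  by apply: measurable_funS mv => //; exact: subset_itv_oo_cc.
apply/integrableP; split.
  apply/measurable_EFinP; apply: measurable_funM => //.
  by apply: continuous_oo_measurable; exact: psi'_continuous hpsi.
apply: le_lt_trans iv; rewrite le_eqVlt; apply/orP; left; apply/eqP.
apply: eq_integral => t; rewrite inE/= => tab.
by rewrite normrM mulrC (gtr0_norm (psi'_gt0 hpsi tab)).
Qed.

Lemma density_L1psi u V : integ V ->
  {ae mu, forall t, t \in `]a, b[ -> V t = derive1 psi t * u t} -> L1psi a b psi u.
Proof.
move=> iV Vu; have mV := integ_measurable iV.
have mv : measurable_fun setT (fun t => V t / dpsi t).
  apply: measurable_funM => //; apply: measurable_inv_ge0; last exact: dpsi_ge0.
  exact: measurable_dpsi.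
exists (fun t => V t / dpsi t); split; first exact: measurable_funTS.
- apply: filterS3 Vu (ae_neq a) (ae_neq b) => t {}Vu ta tb tab.
  have tab' : t \in `]a, b[.
    move: tab; rewrite !in_itv/= => /andP[a_t t_b].
    by rewrite !lt_neqAle eq_sym ta tb a_t.
  by rewrite Vu// dpsiE// mulrC mulKf// gt_eqF// (psi'_gt0 hpsi).
- have : mu.-integrable `]a, b[ (EFin \o V) by exact: integrableS iV.
  move=> /integrableP[_]; apply: le_lt_trans; rewrite le_eqVlt; apply/orP; left; apply/eqP.
  apply: eq_integral => t; rewrite inE/= => tab.
  rewrite dpsiE// normrM normfV (gtr0_norm (psi'_gt0 hpsi tab)).
  by rewrite divfK// gt_eqF// (psi'_gt0 hpsi).
Qed.

(** A single null set serves a whole sequence. For a function that is Lipschitz in its second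
    variable, a dense sequence of values controls all the others off that set. *)
Lemma L1psi_seq_density (f : nat -> R -> R) : (forall n, L1psi a b psi (f n)) ->
  exists N, [/\ measurable N, mu N = 0%E &
    forall n (g := f n \_ (`]a, b[ `\` N)),
      measurable_fun setT g /\ integ (fun t => dpsi t * g t)].
Proof.
move=> fL; have /choice[v hv] n := fL n.
have [N [mN N0 fN]] : {ae mu, forall t, forall n, t \in `[a, b] -> f n t = v n t}.
  by apply/ae_foralln => n; have [] := hv n.
exists N; split => // n g.
have mD : measurable (`]a, b[ `\` N) by exact: measurableD.
have gE : g = v n \_ (`]a, b[ `\` N).
  apply/funext => t; rewrite /g !patchE; case: ifPn => //; rewrite inE/= => -[tab tN].
  apply: contrapT => fv; apply: tN; apply: fN => /= /(_ n) fv'; apply: fv; apply: fv'.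
  by move: tab; rewrite !in_itv/= => /andP[/ltW-> /ltW->].
have mg : measurable_fun setT g.
  rewrite gE; apply/(measurable_restrictT _ mD); have [mv _ _] := hv n.
  by apply: measurable_funS mv => //; apply: subset_trans (@subDsetl _ _ _) _;
    exact: subset_itv_oo_cc.
split => //; have [V iV VE] := L1psi_density (fL n).
have iV' : integ (V \_ `]a, b[).
  by rewrite -restrict_EFin; apply/integrable_restrict => //=; rewrite setTI;
     exact: integrableS iV.
apply: (integ_ae_eq _ iV').
  by apply: measurable_funM => //; exact: measurable_dpsi.
have aeN : {ae mu, forall t, ~ N t} by exists N; split => // t /= /contrapT.
apply: filterS2 VE aeN => t VE tN; have [tab|tab] := boolP (t \in `]a, b[).
  by rewrite /g !patchE !mem_set// dpsiE// VE.
by rewrite dpsi_out// mul0r patchE memNset//; exact/negP.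
Qed.

End L1psi_density.

Section superposition.
Context {R : realType}.

Definition rat_seq (n : nat) : R := ratr (odflt 0 (unpickle n)).

Lemma rat_seq_dense (x e : R) : 0 < e -> exists n, `|x - rat_seq n| < e.
Proof.
move=> e0; have [q] := @rat_in_itvoo R (x - e) (x + e) (ltac:(lra)).
rewrite in_itv/= => /andP[q1 q2]; exists (pickle q).
by rewrite /rat_seq pickleK/= ltr_distlC q1.
Qed.

(** McShane's formula over a dense sequence: a countable infimum recovers the function, which turns
    the Lipschitz condition into measurability. *)
Lemma lipschitz_inf (G : R -> R) (L : R) (r : nat -> R) (x : R) : 0 < L ->
  (forall n, `|G x - G (r n)| <= L * `|x - r n|) ->
  (forall e, 0 < e -> exists n, `|x - r n| < e) ->
  infs (fun n => G (r n) + L * `|x - r n|) 0 = G x.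
Proof.
move=> L0 Glip rx; rewrite /infs.
have lb : lbound (sdrop (fun n => G (r n) + L * `|x - r n|) 0) (G x).
  by move=> _ [n _ <-]; have := Glip n; rewrite ler_distl => /andP[_ +]; lra.
apply/eqP; rewrite eq_le; apply/andP; split; last first.
  by apply: lb_le_inf => //; exists (G (r 0%N) + L * `|x - r 0%N|), 0%N.
apply/ler_addgt0Pr => e e0.
(* By the Lipschitz condition, each term exceeds [G x] by at most $2L$ times the distance. *)
have e' : 0 < e / (2 * L) by rewrite divr_gt0// mulr_gt0.
have [n xn] := rx _ e'.
apply: (@le_trans _ _ (G (r n) + L * `|x - r n|)).
  by apply: ge_inf; [exists (G x)|exists n].
have := Glip n; rewrite ler_distl => /andP[+ _].
move: xn; rewrite ltr_pdivlMr ?mulr_gt0//; set y := `|x - r n|; nra.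
Qed.

Lemma superposition_measurable d (T : measurableType d) (F : T -> R -> R) (L : R) (u : T -> R) :
  0 < L -> (forall t x y, `|F t x - F t y| <= L * `|x - y|) ->
  (forall n, measurable_fun setT (F ^~ (rat_seq n))) ->
  measurable_fun setT u -> measurable_fun setT (fun t => F t (u t)).
Proof.
move=> L0 FL mF mu'.
have FE t : F t (u t) = infs (fun n => F t (rat_seq n) + L * `|u t - rat_seq n|) 0.
  by rewrite lipschitz_inf//; exact: rat_seq_dense.
have -> : (fun t => F t (u t)) =
    (fun t => infs ((fun n t => F t (rat_seq n) + L * `|u t - rat_seq n|) ^~ t) 0).
  by apply/funext => t; rewrite FE.
apply: measurable_fun_infs.
- move=> t _; exists (F t (u t)) => _ [n _ <-].
  by have := FL t (u t) (rat_seq n); rewrite ler_distl => /andP[_ +]; lra.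
- move=> n; apply: measurable_funD => //; apply: measurable_funM => //.
  by apply: measurableT_comp => //; exact: measurable_funB.
Qed.

End superposition.

(** * The Abel equation *)

Lemma nceil_itv {R : realType} (x : R) : 0 < x ->
  (0 < nceil x)%N /\ (nceil x)%:R - 1 < x <= (nceil x)%:R.
Proof.
move=> x0; have c0 : 0 < Num.ceil x by rewrite ceil_gt0.
have cE : (nceil x)%:Z = Num.ceil x by rewrite /nceil gez0_abs// ltW.
split; first by rewrite -ltz_nat cE.
have := ceil_itv x; rewrite -cE intrB /=.
by rewrite -[(nceil x)%:~R]/((nceil x)%:R).
Qed.

Lemma nceil_def {R : realType} (x : R) (m : nat) : m%:R - 1 < x <= m%:R -> nceil x = m.
Proof.
move=> h; rewrite /nceil (@ceil_def _ x m%:Z)//.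
by rewrite intrB.
Qed.

Section solution_operator.
Context {R : realType} (a b : R) (psi : R -> R) (beta : R).
Notation mu := (@lebesgue_measure R).
Local Notation integ V := (mu.-integrable setT (EFin \o V)).
Local Notation dist V W := (\int[mu]_x `|V x - W x|%:E)%E.
Hypothesis ab : a < b.
Hypothesis hpsi : C1_increasing a b psi.
Hypothesis hbeta : 0 <= beta < 1.
Local Notation dpsi := (dpsi a b psi).
Local Notation kap := (abel_kernel a b psi).
Local Notation abelop := (abel_operator a b psi).
Local Notation Y := (iter_density a b psi).
Local Notation prim := (iter_primitive a b psi).

Let g01 : 0 < 1 - beta <= 1. Proof. by case/andP: hbeta => *; apply/andP; split; lra. Qed.

(** The response to a unit initial value of $I^\beta u$, up to the factor [abel_const]. *)
Definition singular_density (t : R) : R := dpsi t * (psi_oo a b psi t - psi a) `^ (- beta).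

(** By the relation between the Beta and Gamma functions this is $1/\Gamma(1-\beta)$, in the form
    that the Beta integral delivers it. *)
Definition abel_const : R := if beta == 0 then 1 else Gamma beta / beta_const beta.

(* The density of the solution of [I^beta u = W], where [W] is the [(j+1)]-fold
   iterated primitive of [H] with initial values [c (j+1), ..., c 1]. *)
Definition solution_density (c : nat -> R) (j : nat) (H : R -> R) (t : R) : R :=
  abel_const * (c j.+1 * singular_density t + abelop (1 - beta) (Y c H j) t).

Lemma singular_density_integrable : integ singular_density.
Proof.
have /andP[g0 _] := g01.
have mp : measurable_fun setT singular_density.
  apply: measurable_funM; first exact: measurable_dpsi.
  apply: (measurableT_comp (measurable_powR (- beta))).
  by apply: measurable_funB => //; exact: measurable_psi_oo.
apply/integrableP; split; first exact/measurable_EFinP.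
have E := integral_psi_powR ab hpsi (lexx a) ab g0.
apply: (@le_lt_trans _ _ ((1 - beta)^-1%:E * ((psi b - psi a) `^ (1 - beta))%:E)%E);
  last by rewrite -EFinM ltry.
rewrite -E -ge0_integralZl; last first.
- by rewrite lee_fin invr_ge0 ltW.
- move=> t /=; rewrite in_itv/= => tab.
  rewrite lee_fin !mulr_ge0 ?powR_ge0 ?ltW//; exact: (psi'_gt0 hpsi).
- apply/measurable_EFinP; apply: measurable_funM; last first.
    by apply: continuous_oo_measurable; exact: psi'_continuous hpsi.
  apply: measurable_funM => //; apply: continuous_oo_measurable => t.
  rewrite in_itv/= => /andP[a_t tb].
  by have := @psi_diff_powR_continuous _ _ _ _ hpsi a t (1 - beta - 1) (lexx a) a_t tb.
- exact: measurable_itv.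
rewrite [leRHS]integral_mkcond le_eqVlt; apply/orP; left; apply/eqP.
apply: eq_integral => t _; rewrite /= patchE /singular_density.
case: ifPn => [|tab].
  rewrite inE/= => tab.
  rewrite ger0_norm ?mulr_ge0 ?powR_ge0 ?dpsi_ge0// dpsiE// psi_ooE//.
  rewrite -EFinM; congr EFin; rewrite !mulrA mulVf ?mul1r ?gt_eqF//.
  by rewrite mulrC (_ : 1 - beta - 1 = - beta)//; ring.
rewrite dpsi_out ?mul0r ?normr0//.
by apply: contra tab => tab; rewrite inE.
Qed.

Lemma solution_density_integrable c j H : integ H -> integ (solution_density c j H).
Proof.
move=> iH; have iY := iter_density_integrable ab hpsi c j iH.
have i1 := integrableZl measurableT (c j.+1) singular_density_integrable.
have i2 := abel_operator_integrable ab hpsi g01 iY.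
have := integrableZl measurableT abel_const (integrableD measurableT i1 i2).
by apply: eq_integrable.
Qed.

Lemma solution_density_out c j H t : t \notin `]a, b[ -> solution_density c j H t = 0.
Proof.
move=> tab; rewrite /solution_density /singular_density dpsi_out// mul0r mulr0 add0r.
rewrite /abel_operator /kernel_operator /Rintegral integral0_eq ?mulr0// => s _.
by rewrite /dpsi_abel_kernel abel_kernel_out1// mulr0 mul0r.
Qed.

Lemma abel_kernel_ae_integrable (g : R) V : 0 < g <= 1 -> integ V ->
  {ae mu, forall t, t \in `]a, b[ -> integ (fun s => kap g (t, s) * V s)}.
Proof.
move=> g01' iV; have := abel_operator_ae ab hpsi g01' iV.
apply: filterS => t it tab; have pt := dpsi_gt0 hpsi tab.
have := integrableZl measurableT (dpsi t)^-1 it; apply: eq_integrable => // s _.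
by rewrite /= -EFinM /dpsi_abel_kernel/= !mulrA mulVf ?mul1r// gt_eqF.
Qed.

Lemma abel_const_neq0 : abel_const != 0.
Proof.
rewrite /abel_const; have [_|b0] := eqVneq beta 0; first exact: oner_neq0.
have b01 : 0 < beta < 1.
  by case/andP: hbeta => h1 h2; rewrite h2 andbT lt_neqAle eq_sym b0.
by rewrite mulf_neq0 ?invr_eq0// gt_eqF ?Gamma_gt0// beta_const_gt0.
Qed.

Section beta_pos.
Hypothesis b01 : 0 < beta < 1.

Lemma abel_solution_density c j H t : integ H -> t \in `]a, b[ ->
  integ (fun s => kap beta (t, s) * solution_density c j H s) /\
  \int[mu]_s (kap beta (t, s) * solution_density c j H s) =
    Gamma beta * prim c H j t.
Proof.
move=> iH tab; have iY := iter_density_integrable ab hpsi c j iH.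
have [i1 E1] := abel_beta hpsi b01 tab.
have i2 := abel_compose_integrable ab hpsi b01 tab iY.
have E2 := abel_compose ab hpsi b01 tab iY.
have i1' := integrableZl measurableT (abel_const * c j.+1) i1.
have i2' := integrableZl measurableT abel_const i2.
have E s : kap beta (t, s) * solution_density c j H s =
  abel_const * c j.+1 * (kap beta (t, s) * (dpsi s * (psi_oo a b psi s - psi a) `^ (- beta)))
  + abel_const * (kap beta (t, s) * abelop (1 - beta) (Y c H j) s).
  by rewrite /solution_density /singular_density; ring.
split.
  have := integrableD measurableT i1' i2'; apply: eq_integrable => // s _.
  by rewrite /= E.
under eq_Rintegral do rewrite E.
rewrite RintegralD//.
rewrite !RintegralZl// E1 E2 /iter_primitive /abel_const.
case/andP: (b01) => b0 _; rewrite (gt_eqF b0).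
field; rewrite gt_eqF//; exact: beta_const_gt0.
Qed.

End beta_pos.

Lemma RLint_solution_density c j H u : integ H ->
  {ae mu, forall t, t \in `]a, b[ -> solution_density c j H t = derive1 psi t * u t} ->
  {ae mu, forall t, t \in `]a, b[ -> RLint a psi beta u t = prim c H j t}.
Proof.
(* If $\beta = 0$, that is for integer order, the Abel equation reads $u = W$ and the operator of
   order $1-\beta$ is plain integration. *)
move=> iH uE; have [b0|b0] := eqVneq beta 0.
  apply: filterS uE => t uE tab; rewrite b0 /RLint eqxx.
  apply: (mulfI (_ : derive1 psi t != 0)); first by rewrite gt_eqF// (psi'_gt0 hpsi).
  rewrite -uE// /solution_density /abel_const b0 eqxx mul1r subr0.
  rewrite (abel_operator1 a b psi (iter_density_integrable ab hpsi c j iH)).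
  by rewrite /singular_density b0 oppr0 powRr0 mulr1 dpsiE// /iter_primitive mulrDr mulrC.
have b01 : 0 < beta < 1.
  by case/andP: hbeta => h1 h2; rewrite h2 andbT lt_neqAle eq_sym b0.
apply: aeW => t tab.
rewrite (RLint_abel b0 tab uE); have [_ ->] := abel_solution_density b01 c j iH tab.
by rewrite mulKf// gt_eqF// Gamma_gt0.
Qed.

(** The Abel operator of order $\beta$ annihilates the difference of the two densities, and it is
    injective. *)
Lemma solution_density_unique c j H u V : integ H -> integ V ->
  {ae mu, forall t, t \in `]a, b[ -> V t = derive1 psi t * u t} ->
  {ae mu, forall t, t \in `]a, b[ -> RLint a psi beta u t = prim c H j t} ->
  {ae mu, forall t, t \in `]a, b[ -> V t = solution_density c j H t}.
Proof.
move=> iH iV uE IuE; have [b0|b0] := eqVneq beta 0.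
  apply: filterS2 uE IuE => t uE IuE tab.
  rewrite uE//; move: (IuE tab); rewrite b0 /RLint eqxx => ->.
  rewrite /solution_density /abel_const b0 eqxx mul1r subr0.
  rewrite (abel_operator1 a b psi (iter_density_integrable ab hpsi c j iH)).
  by rewrite /singular_density b0 oppr0 powRr0 mulr1 dpsiE// /iter_primitive mulrDr
    [X in _ = X + _]mulrC.
have b01 : 0 < beta < 1.
  by case/andP: hbeta => h1 h2; rewrite h2 andbT lt_neqAle eq_sym b0.
have b01' : 0 < beta <= 1 by case/andP: b01 => -> /ltW ->.
have iS := solution_density_integrable c j iH.
have E0 : {ae mu, forall t, t \in `]a, b[ ->
    \int[mu]_s (kap beta (t, s) * (V s - solution_density c j H s)) = 0}.
  have := abel_kernel_ae_integrable b01' iV; apply: filterS2 IuE => t IuE iVt tab.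
  have [iSt St] := abel_solution_density b01 c j iH tab.
  transitivity (\int[mu]_s (kap beta (t, s) * V s) -
      \int[mu]_s (kap beta (t, s) * solution_density c j H s)).
    rewrite -RintegralB//; last exact: iVt.
    by apply: eq_Rintegral => s _; rewrite mulrBr.
  rewrite St -IuE// (RLint_abel b0 tab uE) mulrA divff ?mul1r ?subrr//.
  by rewrite gt_eqF// Gamma_gt0.
have := abel_injective ab hpsi b01 (integrableB measurableT iV iS) E0.
by apply: filterS => t h tab; apply/eqP; rewrite -subr_eq0; apply/eqP/h.
Qed.

(** The constants [c] cancel in differences, and each further stage is an Abel operator of order
    one, of weighted norm at most 1. *)
Lemma iter_density_contraction lam c j H H' : 0 < lam -> integ H -> integ H' ->
  abel_bound a b psi lam 1 <= 1 ->
  (dist (fun t => exp_weight a b psi lam t * Y c H j t)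
        (fun t => exp_weight a b psi lam t * Y c H' j t) <=
   dist (fun t => exp_weight a b psi lam t * H t)
        (fun t => exp_weight a b psi lam t * H' t))%E.
Proof.
move=> lam0 iH iH' lam1; elim: j => [//|j IH].
have iY := iter_density_integrable ab hpsi c j iH.
have iY' := iter_density_integrable ab hpsi c j iH'.
have g1 : 0 < (1 : R) <= 1 by rewrite ltr01 lexx.
apply: le_trans IH; have := abel_operator_contraction ab hpsi g1 lam0 iY iY'.
have -> : (\int[mu]_x `|(exp_weight a b psi lam x * Y c H j.+1 x -
    exp_weight a b psi lam x * Y c H' j.+1 x)|%:E =
  \int[mu]_x `|(exp_weight a b psi lam x * abelop 1 (Y c H j) x -
    exp_weight a b psi lam x * abelop 1 (Y c H' j) x)|%:E)%E.
  apply: eq_integral => t _; congr (`|_|%:E).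
  rewrite (abel_operator1 a b psi iY) (abel_operator1 a b psi iY') /=.
  by rewrite !mulrDr opprD addrACA subrr add0r.
move=> /le_trans; apply.
rewrite -[leRHS]mul1e lee_wpmul2r ?lee_fin//.
by apply: integral_ge0 => t _; rewrite lee_fin.
Qed.

(** [lam] is taken large enough for the inner stages not to expand and for the outer operator of
    order $1-\beta$ to have norm at most [e] divided by the size of [abel_const]. *)
Lemma solution_density_contraction (e : R) : 0 < e ->
  exists2 lam, 0 < lam & forall c j H H', integ H -> integ H' ->
  (dist (fun t => exp_weight a b psi lam t * solution_density c j H t)
        (fun t => exp_weight a b psi lam t * solution_density c j H' t) <=
   e%:E * dist (fun t => exp_weight a b psi lam t * H t)
        (fun t => exp_weight a b psi lam t * H' t))%E.
Proof.
move=> e0; have k0 : 0 < `|abel_const| by rewrite normr_gt0 abel_const_neq0.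
have /andP[g0 _] := g01.
have [l1 l10 h1] := @abel_bound_small _ a b psi 1 1 ltr01 ltr01.
have [l2 l20 h2] := @abel_bound_small _ a b psi (1 - beta) (e / `|abel_const|) g0
  (divr_gt0 e0 k0).
exists (Num.max l1 l2); first by rewrite lt_max l10.
move=> c j H H' iH iH'; set lam := Num.max l1 l2.
have lam0 : 0 < lam by rewrite lt_max l10.
have iY := iter_density_integrable ab hpsi c j iH.
have iY' := iter_density_integrable ab hpsi c j iH'.
pose D t := (exp_weight a b psi lam t * abelop (1 - beta) (Y c H j) t -
   exp_weight a b psi lam t * abelop (1 - beta) (Y c H' j) t).
have mw := measurable_exp_weight hpsi lam.
have iD : integ D.
  have i1 := (integ_exp_weight hpsi lam _).1 (abel_operator_integrable ab hpsi g01 iY).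
  have i2 := (integ_exp_weight hpsi lam _).1 (abel_operator_integrable ab hpsi g01 iY').
  exact: (integrableB measurableT i1 i2).
apply: (@le_trans _ _ (`|abel_const|%:E * \int[mu]_t `|D t|%:E)%E).
  rewrite -ge0_integralZl//; last first.
    apply/measurable_EFinP; apply: measurableT_comp => //; apply/measurable_EFinP.
    exact: measurable_int iD.
  rewrite le_eqVlt; apply/orP; left; apply/eqP; apply: eq_integral => t _.
  rewrite -EFinM -normrM /D /solution_density; congr (`|_|%:E); ring.
apply: (@le_trans _ _ (`|abel_const|%:E * ((e / `|abel_const|)%:E *
   dist (fun t => exp_weight a b psi lam t * H t)
        (fun t => exp_weight a b psi lam t * H' t)))%E).
  rewrite lee_wpmul2l ?lee_fin//.
  apply: (le_trans (abel_operator_contraction ab hpsi g01 lam0 iY iY')).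
  apply: lee_pmul.
  - by rewrite lee_fin !mulr_ge0 ?powR_ge0 ?invr_ge0 ?divr_ge0// ltW.
  - by apply: integral_ge0 => t _; rewrite lee_fin.
  - by rewrite lee_fin h2// le_max lexx orbT.
  - apply: iter_density_contraction => //; apply: h1.
    by rewrite le_max lexx.
by rewrite muleA -EFinM mulrCA divff ?mulr1// gt_eqF.
Qed.

End solution_operator.

(** * The Cauchy problem *)

Section fixpoint.
Context {R : realType} (a b : R) (psi : R -> R) (beta : R).
Notation mu := (@lebesgue_measure R).
Local Notation integ V := (mu.-integrable setT (EFin \o V)).
Local Notation dist V W := (\int[mu]_x `|V x - W x|%:E)%E.
Hypothesis ab : a < b.
Hypothesis hpsi : C1_increasing a b psi.
Hypothesis hbeta : 0 <= beta < 1.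
Local Notation dpsi := (dpsi a b psi).
Local Notation sol := (solution_density a b psi beta).

Lemma solution_density_fixpoint c j (Nem : (R -> R) -> R -> R) (L : R) : 0 < L ->
  (forall V, integ V -> integ (Nem V)) ->
  (forall V W t, `|Nem V t - Nem W t| <= L * `|V t - W t|) ->
  exists V, [/\ integ V, {ae mu, forall t, V t = sol c j (Nem V) t} &
    forall W, integ W -> {ae mu, forall t, W t = sol c j (Nem W) t} ->
      {ae mu, forall t, W t = V t}].
Proof.
move=> L0 iNem lipN.
(* Together with the Lipschitz constant [L] of [Nem], this yields the contraction factor 1/2. *)
have e0 : 0 < (2 * L)^-1 by rewrite invr_gt0 mulr_gt0.
have [lam lam0 hlam] := solution_density_contraction ab hpsi hbeta e0.
pose w := exp_weight a b psi lam.
have w0 t : 0 < w t := exp_weight_gt0 a b psi lam t.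
(* The unknown becomes $U = wV$, so that the weighted distance is the plain $L^1$ distance of the
   fixed-point theorem. *)
pose Phi U t := w t * sol c j (Nem (fun s => U s / w s)) t.
have wK (U : R -> R) : (fun t => w t * (U t / w t)) = U.
  by apply/funext => t; rewrite mulrCA divff ?mulr1// gt_eqF.
have iw (U : R -> R) : integ U -> integ (fun t => U t / w t).
  by move=> iU; apply/(integ_exp_weight hpsi lam); rewrite [X in EFin \o X]wK.
have iPhi U : integ U -> integ (Phi U).
  move=> iU; apply: (integ_exp_weight hpsi lam _).1.
  by apply: solution_density_integrable => //; exact/iNem/iw.
have cPhi U W : integ U -> integ W -> (dist (Phi U) (Phi W) <= 2^-1%:E * dist U W)%E.
  move=> iU iW; have iNU := iNem _ (iw _ iU); have iNW := iNem _ (iw _ iW).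
  apply: (le_trans (hlam c j _ _ iNU iNW)).
  have -> : 2^-1%:E = ((2 * L)^-1 * L)%:E :> \bar R.
    by rewrite invfM -mulrA mulVf ?mulr1// gt_eqF.
  rewrite EFinM -muleA lee_wpmul2l ?lee_fin ?(ltW e0)//.
  have mUW : measurable_fun setT (fun x => `|U x - W x|%:E).
    apply/measurable_EFinP; apply: measurableT_comp => //; apply/measurable_EFinP.
    exact: measurable_int (integrableB measurableT iU iW).
  rewrite -ge0_integralZl//; last by rewrite lee_fin ltW.
  apply: ge0_le_integral => //.
  - apply/measurable_EFinP; apply: measurableT_comp => //; apply/measurable_EFinP.
    have i1 := (integ_exp_weight hpsi lam _).1 iNU.
    have i2 := (integ_exp_weight hpsi lam _).1 iNW.
    exact: measurable_int (integrableB measurableT i1 i2).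
  - by apply: emeasurable_funM.
  move=> t _; rewrite -EFinM lee_fin -mulrBr normrM (gtr0_norm (w0 t)).
  rewrite (le_trans (ler_wpM2l (ltW (w0 t)) (lipN _ _ t)))//.
  by rewrite -mulrBl normrM normfV (gtr0_norm (w0 t)) mulrCA [w t * _]mulrC divfK// gt_eqF.
have [U iU UE] := L1_contraction_fixpoint iPhi cPhi.
exists (fun t => U t / w t); split; first exact: iw.
  by apply: filterS UE => t <-; rewrite /Phi mulrC mulKf// gt_eqF.
move=> W iW WE; pose X t := w t * W t.
have iX : integ X by exact: (integ_exp_weight hpsi lam _).1.
have XW : (fun t => X t / w t) = W.
  by apply/funext => t; rewrite /X mulrC mulKf// gt_eqF.
have XE : {ae mu, forall t, Phi X t = X t}.
  by apply: filterS WE => t WE; rewrite /Phi XW -WE.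
have dE : dist (Phi X) (Phi U) = dist X U.
  by apply: eq_integral_ae; apply: filterS2 XE UE => t -> -> _.
have := cPhi _ _ iX iU; rewrite dE.
have q0 : (0 <= dist X U)%E by apply: integral_ge0 => t _; rewrite lee_fin.
have := L1_dist_fin iX iU; have := L1_dist_eq0 iX iU.
case: (dist X U) q0 => // r; rewrite lee_fin => r0 h _; rewrite -EFinM lee_fin => r1.
have {r0 r1}r0 : r = 0 by lra.
have := h (congr1 EFin r0).
by apply: filterS => t <-; rewrite /X mulrC mulKf// gt_eqF.
Qed.

(** In terms of densities, superposition is $V \mapsto \psi' F(\cdot, V/\psi')$: the factors $\psi'$
    cancel in differences, so the Lipschitz constant stays [L]. *)
Lemma nemytskii_operator (F : R -> R -> R) (L : R) : 0 < L ->
  lipschitz_in_second a b setT F L -> (forall x, L1psi a b psi (F ^~ x)) ->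
  exists Nem : (R -> R) -> R -> R, [/\ forall V, integ V -> integ (Nem V),
    forall V W t, `|Nem V t - Nem W t| <= L * `|V t - W t| &
    {ae mu, forall t, t \in `]a, b[ -> forall V,
      Nem V t = derive1 psi t * F t (V t / derive1 psi t)}].
Proof.
move=> L0 lipF F1.
have [N [mN N0 hN]] := L1psi_seq_density hpsi (fun n => F1 (rat_seq n)).
pose D : set R := `]a, b[ `\` N.
(* Setting [F] to 0 off a common good set makes the Lipschitz bound and measurability hold
   everywhere. *)
pose F0 t x := ((F ^~ x) \_ D) t.
have lipF0 t x y : `|F0 t x - F0 t y| <= L * `|x - y|.
  rewrite /F0 !patchE; case: ifPn => [|_]; last first.
    by rewrite subrr normr0 mulr_ge0// ltW.
  rewrite inE => -[tab _]; apply: lipF => //.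
  by move: tab; rewrite /= !in_itv/= => /andP[-> /ltW].
have mp := measurable_dpsi hpsi; have p0 t := dpsi_ge0 hpsi t.
pose Nem V t := dpsi t * F0 t (V t / dpsi t).
have lipN V W t : `|Nem V t - Nem W t| <= L * `|V t - W t|.
  rewrite /Nem -mulrBr normrM (ger0_norm (p0 t)).
  have [tab|tab] := boolP (t \in `]a, b[); last first.
    by rewrite dpsi_out// mul0r mulr_ge0// ltW.
  have pt := dpsi_gt0 hpsi tab.
  rewrite (le_trans (ler_wpM2l (p0 t) (lipF0 _ _ _)))//.
  by rewrite -mulrBl normrM normfV (gtr0_norm pt) mulrCA [dpsi t * _]mulrC divfK// gt_eqF.
exists Nem; split => //; last first.
  have aeN : {ae mu, forall t, ~ N t} by exists N; split => // t /= /contrapT.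
  apply: filterS aeN => t tN tab V.
  by rewrite /Nem /F0 patchE mem_set ?dpsiE//; split.
move=> V iV; have [mF0 iF0] := hN 0%N.
have mV : measurable_fun setT V by apply/measurable_EFinP; exact: measurable_int iV.
have mNV : measurable_fun setT (Nem V).
  apply: measurable_funM => //; apply: (superposition_measurable L0 lipF0).
    by move=> n; have [] := hN n.
  by apply: measurable_funM => //; exact: measurable_inv_ge0.
pose r0 : R := rat_seq 0.
have i1 := integrable_norm iF0.
have i2 := integrableZl measurableT L (integrable_norm iV).
have i3 := integrableZl measurableT (L * `|r0|) (dpsi_integrable ab hpsi).
have := integrableD measurableT (integrableD measurableT i1 i2) i3.
apply: le_integrable => //; first exact/measurable_EFinP.
move=> t _; rewrite lee_fin /= (le_trans _ (ler_norm _))//.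
(* Integrability by comparison with the constant function [r0], whose image is integrable by
   assumption. *)
have NVE : Nem (fun t => dpsi t * r0) t = dpsi t * F0 t r0.
  have [tab|tab] := boolP (t \in `]a, b[); last by rewrite /Nem dpsi_out// !mul0r.
  by rewrite /Nem [dpsi t * r0]mulrC mulfK// gt_eqF// (dpsi_gt0 hpsi).
have := lipN V (fun t => dpsi t * r0) t; rewrite NVE -/(F0 t r0).
have := ler_normB (V t) (dpsi t * r0); rewrite normrM (ger0_norm (p0 t)).
have := ler_normD (Nem V t - dpsi t * F0 t r0) (dpsi t * F0 t r0); rewrite subrK.
move: (`|V t - _|) => x h1 h2 h3.
rewrite (le_trans h1)// -[leRHS]addrA [leRHS]addrC lerD2r// (le_trans h3)//.
rewrite (le_trans (ler_wpM2l (ltW L0) h2))// mulrDr lerD2l.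
by rewrite -mulrA [dpsi t * _]mulrC.
Qed.

End fixpoint.

Section cauchy_problem.
Context {R : realType} (a b : R) (psi : R -> R) (alpha : R).
Notation mu := (@lebesgue_measure R).
Local Notation integ V := (mu.-integrable setT (EFin \o V)).
Hypothesis ab : a < b.
Hypothesis hpsi : C1_increasing a b psi.
Hypothesis alpha0 : 0 < alpha.
Local Notation n := (nceil alpha).
Local Notation j := n.-1.
Local Notation beta := (n%:R - alpha).
Local Notation sol := (solution_density a b psi beta).
Local Notation prim := (iter_primitive a b psi).
Local Notation rho := (rho psi).

Lemma nceil_fractional : 0 <= beta < 1.
Proof. by have [_ /andP[]] := nceil_itv alpha0; move=> *; apply/andP; split; lra. Qed.

(** Stated for a general order [g] because all the orders $\alpha - k$ leave the same fractional
    integral $I^\beta u$, so that one primitive serves every initial condition. *)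
Lemma RLint_rep_primitive g c H u : integ H -> (0 < nceil g <= n)%N ->
  (nceil g)%:R - g = beta ->
  {ae mu, forall t, t \in `]a, b[ -> RLint a psi beta u t = prim c H j t} ->
  AC_representative a b psi (nceil g) (RLint a psi beta u) (prim c H j) /\
  {in `]a, b[, RLint_rep a b psi g u =1 prim c H j}.
Proof.
move=> iH /andP[m0 mn] gE uE; have nE : n.-1.+1 = n by rewrite prednK// (leq_trans m0).
have P : AC_representative a b psi (nceil g) (RLint a psi beta u) (prim c H j).
  split; first by apply: ACpsi_primitive => //; rewrite m0 nE.
  by apply: filterS uE => t + tab => ->.
split => //; rewrite /RLint_rep gE.
have : AC_representative a b psi (nceil g) (RLint a psi beta u)
    (xget (RLint a psi beta u) [set w | AC_representative a b psi (nceil g)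
       (RLint a psi beta u) w]).
  by apply: (@xgetPex _ (RLint a psi beta u)
    [set w | AC_representative a b psi (nceil g) (RLint a psi beta u) w]); exists (prim c H j).
(* The chosen representative is also an iterated primitive. Two continuous functions that agree
   almost everywhere agree on the whole open interval. *)
move: (xget _ _) => w [ACw wE].
rewrite -(prednK m0) in ACw.
have [c1 [H1 iH1 /(_ _ (leqnn _))]] := primitive_ACpsi ab hpsi ACw.
rewrite subnn /= => w1.
have P1 : {in `]a, b[, prim c1 H1 (nceil g).-1 =1 prim c H j}.
  apply: eq_continuous_ae.
  - exact: iter_primitive_continuous.
  - exact: iter_primitive_continuous.
  - by apply: filterS2 wE uE => t wE uE tab; rewrite -w1// wE// uE.
by move=> t tab; rewrite w1// P1.
Qed.

Lemma nceil_sub k : (k < n)%N -> nceil (alpha - k%:R) = (n - k)%N.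
Proof.
move=> kn; apply: nceil_def; have [_ /andP[h1 h2]] := nceil_itv alpha0.
by rewrite natrB ?(ltnW kn)//; apply/andP; split; lra.
Qed.

Section RLderiv_primitive.
Variables (c : nat -> R) (H u : R -> R).
Hypothesis iH : integ H.
Hypothesis uE : {ae mu, forall t, t \in `]a, b[ -> RLint a psi beta u t = prim c H j t}.

Let n0 : (0 < n)%N. Proof. by case: (nceil_itv alpha0). Qed.

Let near_oo : \forall t \near a^'+, t \in `]a, b[.
Proof.
near=> t; rewrite in_itv/=; apply/andP; split.
  by near: t; exact: nbhs_right_gt.
by near: t; exact: nbhs_right_lt.
Unshelve. all: by end_near. Qed.

Lemma RLint_rep_cvg : RLint_rep a b psi alpha u t @[t --> a^'+] --> c n.
Proof.
have [|_ E] := RLint_rep_primitive (g := alpha) iH _ erefl uE; first by rewrite n0 leqnn.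
have := iter_primitive_cvg (c := c) (j := j) ab hpsi iH; rewrite prednK//; apply: cvg_trans.
by apply: near_eq_cvg; apply: filterS near_oo => t tab; rewrite E.
Qed.

Lemma RLderiv_cvg k : (0 < k < n)%N -> RLderiv a b psi (alpha - k%:R) u t @[t --> a^'+] --> c k.
Proof.
move=> /andP[k0 kn]; have nk := nceil_sub kn.
have [||_ E] := RLint_rep_primitive (g := alpha - k%:R) iH _ _ uE.
- by rewrite nk subn_gt0 kn leq_subr.
- by rewrite nk natrB ?(ltnW kn)//; ring.
(* Differentiating the [n]-fold primitive $n-k$ times leaves index $k-1$, whose limit at [a] is
   [c k]. *)
have kE : (j - (n - k) = k.-1)%N.
  by rewrite -[X in (_ - (X - _))%N](prednK n0) subSn ?subnS ?subKn// -ltnS prednK.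
have := iter_primitive_cvg (c := c) (j := k.-1) ab hpsi iH; rewrite (prednK k0); apply: cvg_trans.
apply: near_eq_cvg; apply: filterS near_oo => t tab.
rewrite /RLderiv nk (eq_iter_rho _ _ E tab) (iter_rho_primitive ab hpsi)//; first by rewrite kE.
by rewrite -ltnS prednK// -subn_gt0 subKn// ltnW.
Qed.

Lemma RLderiv_ae :
  {ae mu, forall t, t \in `]a, b[ -> RLderiv a b psi alpha u t = H t / derive1 psi t}.
Proof.
have [|_ E] := RLint_rep_primitive (g := alpha) iH _ erefl uE; first by rewrite n0 leqnn.
have := rho_primitive_ae ab hpsi c j iH; rewrite prednK//; apply: filterS => t + tab.
by move=> /(_ tab) <-; rewrite /RLderiv (eq_iter_rho _ _ E tab).
Qed.

End RLderiv_primitive.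

Variables (G : set R) (F : R -> R -> R) (c : nat -> R) (u V H : R -> R).
Hypothesis iV : integ V.
Hypothesis iH : integ H.
Hypothesis VE : {ae mu, forall t, t \in `]a, b[ -> V t = derive1 psi t * u t}.
Hypothesis HE : {ae mu, forall t, t \in `]a, b[ -> H t = derive1 psi t * F t (u t)}.

Lemma solution_density_cauchy :
  {ae mu, forall t, t \in `]a, b[ -> G (u t)} ->
  {ae mu, forall t, t \in `]a, b[ -> V t = sol c j H t} ->
  cauchy_solution a b psi alpha G F c u.
Proof.
move=> Gu VS; have n0 : (0 < n)%N by case: (nceil_itv alpha0).
have uE : {ae mu, forall t, t \in `]a, b[ -> RLint a psi beta u t = prim c H j t}.
  have := @RLint_solution_density _ _ _ _ _ ab hpsi nceil_fractional c j _ u iH; apply.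
  by apply: filterS2 VS VE => t VS Vu tab; rewrite -VS// Vu.
have dE := RLderiv_ae iH uE.
have [|hAC _] := RLint_rep_primitive (g := alpha) iH _ erefl uE; first by rewrite n0 leqnn.
have p0 t : t \in `]a, b[ -> derive1 psi t != 0.
  by move=> tab; rewrite gt_eqF// (psi'_gt0 hpsi).
split.
- split; first exact: density_L1psi VE.
    by exists (prim c H j).
  apply: (density_L1psi hpsi iH); apply: filterS dE => t dE tab.
  by rewrite dE// mulrC divfK// p0.
- exact: Gu.
- by apply: filterS2 dE HE => t dE Hu tab; rewrite dE// Hu// mulrC mulKf// p0.
- by move=> k hk; exact: (RLderiv_cvg iH uE hk).
- exact: (RLint_rep_cvg iH uE).
Qed.

Lemma cauchy_solution_density :
  cauchy_solution a b psi alpha G F c u ->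
  {ae mu, forall t, t \in `]a, b[ -> V t = sol c j H t}.
Proof.
move=> [[_ [w [ACw wE]] _] _ uF uk un].
have n0 : (0 < n)%N by case: (nceil_itv alpha0).
have p0 t : t \in `]a, b[ -> derive1 psi t != 0.
  by move=> tab; rewrite gt_eqF// (psi'_gt0 hpsi).
rewrite -(prednK n0) in ACw.
(* The representative comes with its own constants and density; the initial conditions identify the
   former with [c], the equation identifies the latter with [H]. *)
have [c' [H' iH' /(_ _ (leqnn _))]] := primitive_ACpsi ab hpsi ACw.
rewrite subnn /= => w1.
have uE : {ae mu, forall t, t \in `]a, b[ -> RLint a psi beta u t = prim c' H' j t}.
  by apply: filterS wE => t wE tab; rewrite -w1// wE.
have H'H : {ae mu, forall t, t \in `]a, b[ -> H' t = H t}.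
  apply: filterS3 (RLderiv_ae iH' uE) uF HE => t dE uF Hu tab.
  by rewrite Hu// -uF// dE// mulrC divfK// p0.
have c'c k : (0 < k <= j.+1)%N -> c' k = c k.
  rewrite prednK// => /andP[k0]; rewrite leq_eqVlt => /orP[/eqP ->|kn].
    exact: cvg_unique (RLint_rep_cvg iH' uE) un.
  have kn' : (0 < k < n)%N by rewrite k0.
  exact: cvg_unique (RLderiv_cvg iH' uE kn') (uk k kn').
have P := eq_iter_primitive psi c'c H'H.
have := @solution_density_unique _ _ _ _ _ ab hpsi nceil_fractional c j _ _ _ iH iV VE; apply.
by apply: filterS uE => t uE tab; rewrite uE// P.
Qed.

End cauchy_problem.

(** * Lipschitz extension of the right-hand side *)

Section mcshane.
Context {R : realType} (a b : R) (psi : R -> R).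
Notation mu := (@lebesgue_measure R).
Local Notation integ V := (mu.-integrable setT (EFin \o V)).
Hypothesis ab : a < b.
Hypothesis hpsi : C1_increasing a b psi.
Local Notation dpsi := (dpsi a b psi).

Lemma open_dense_seq (G : set R) : open G -> G !=set0 ->
  exists r : nat -> R, (forall n, G (r n)) /\
    forall x e, G x -> 0 < e -> exists n, `|x - r n| < e.
Proof.
move=> oG [x0 Gx0]; exists (fun n => if pselect (G (rat_seq n)) then rat_seq n else x0).
split; first by move=> n; case: pselect.
move=> x e Gx e0; have /nbhs_ballP[d /= d0 dG] : nbhs x G by exact: open_nbhs_nbhs.
have de0 : 0 < Num.min d e by rewrite lt_min d0.
have [n] := rat_seq_dense x de0; rewrite lt_min => /andP[xd xe].
by exists n; case: pselect => // nG; exfalso; apply: nG; exact: dG.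
Qed.

(** The infimum runs over a dense sequence of [G] rather than over [G] itself, so that measurability
    in [t] survives. *)
Lemma lipschitz_extension (G : set R) (f : R -> R -> R) (L : R) :
  0 < L -> open G -> G !=set0 -> lipschitz_in_second a b G f L ->
  (forall x, G x -> L1psi a b psi (f ^~ x)) ->
  exists F, [/\ forall t x, t \in `]a, b] -> G x -> F t x = f t x,
    lipschitz_in_second a b setT F L & forall x, L1psi a b psi (F ^~ x)].
Proof.
move=> L0 oG G0 lipf fL; have [r [Gr rd]] := open_dense_seq oG G0.
pose F t x := infs (fun n => f t (r n) + L * `|x - r n|) 0.
have Ff t x : t \in `]a, b] -> G x -> F t x = f t x.
  move=> tab Gx; apply: lipschitz_inf => //; first by move=> n; exact: lipf.
  by move=> e; exact: rd.
(* The infimum of a set unbounded below would be a default value; the Lipschitz condition provides a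
   lower bound. *)
have lb t x : t \in `]a, b] ->
    lbound (sdrop (fun n => f t (r n) + L * `|x - r n|) 0) (f t (r 0%N) - L * `|x - r 0%N|).
  move=> tab _ [n _ <-]; have := lipf t _ _ tab (Gr 0%N) (Gr n).
  rewrite ler_distl => /andP[_ h1].
  have : L * `|r 0%N - r n| <= L * (`|x - r n| + `|x - r 0%N|).
    by rewrite ler_wpM2l ?(ltW L0)// [leRHS]addrC (distrC x (r 0%N)) ler_distD.
  by move: h1; rewrite mulrDr; lra.
have FL t x y : t \in `]a, b] -> F t x <= F t y + L * `|x - y|.
  move=> tab; rewrite -lerBlDr; apply: lb_le_inf.
    by exists (f t (r 0%N) + L * `|y - r 0%N|), 0%N.
  move=> _ [n _ <-]; rewrite lerBlDr; apply: (@le_trans _ _ (f t (r n) + L * `|x - r n|)).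
    by apply: ge_inf; [exists (f t (r 0%N) - L * `|x - r 0%N|); exact: lb|exists n].
  by rewrite -addrA lerD2l -mulrDr ler_wpM2l ?(ltW L0)// [leRHS]addrC ler_distD.
have lipF : lipschitz_in_second a b setT F L.
  move=> t x y tab _ _; rewrite ler_distl; apply/andP; split; last exact: FL.
  by rewrite lerBlDr [`|x - y|]distrC; exact: FL.
exists F; split => // x.
have [N [mN N0 hN]] := L1psi_seq_density hpsi (fun n => fL _ (Gr n)).
pose D : set R := `]a, b[ `\` N.
have mD : measurable D by exact: measurableD.
pose Fx := (F ^~ x) \_ D.
have mFx : measurable_fun setT Fx.
  pose g t := infs ((fun n t => ((f ^~ (r n)) \_ D) t + L * `|x - r n|) ^~ t) 0.
  have -> : Fx = g \_ D.
    apply/funext => t; rewrite /Fx /g !patchE; case: ifPn => // tD.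
    by congr (infs _ _); apply/funext => n; rewrite patchE tD.
  apply/(measurable_restrictT _ mD); apply: measurable_funTS.
  apply: measurable_fun_infs.
    move=> t _; have [tD|tD] := boolP (t \in D).
      have tab : t \in `]a, b].
        by move: tD; rewrite inE => -[]/=; rewrite !in_itv/= => /andP[-> /ltW].
      exists (f t (r 0%N) - L * `|x - r 0%N|) => _ [n _ <-]; rewrite patchE tD.
      by apply: (lb t x tab); exists n.
    exists 0 => _ [n _ <-]; rewrite patchE (negbTE tD) add0r mulr_ge0// ltW//.
  by move=> n; apply: measurable_funD => //; have [] := hN n.
have [_ i0] := hN 0%N.
have i1 := integrable_norm i0.
have i2 := integrableZl measurableT (L * `|x - r 0%N|) (dpsi_integrable ab hpsi).
have p0 t := dpsi_ge0 hpsi t.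
have iFx : integ (fun t => dpsi t * Fx t).
  have := integrableD measurableT i1 i2; apply: le_integrable => //.
    apply/measurable_EFinP; apply: measurable_funM => //; exact: measurable_dpsi hpsi.
  move=> t _; rewrite lee_fin /= (le_trans _ (ler_norm _))//.
  rewrite !normrM (ger0_norm (p0 t)) mulrC [X in _ + X]mulrC -mulrDr mulrC ler_wpM2l//.
  rewrite /Fx !patchE; case: ifPn => [tD|_]; last first.
    by rewrite normr0 add0r mulr_ge0// ltW.
  have tab : t \in `]a, b].
    by move: tD; rewrite inE => -[]/=; rewrite !in_itv/= => /andP[-> /ltW].
  have := lipF t x (r 0%N) tab I I; rewrite (Ff t (r 0%N) tab (Gr 0%N)).
  have := ler_normD (F t x - f t (r 0%N)) (f t (r 0%N)); rewrite subrK; lra.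
apply: (density_L1psi hpsi iFx).
have aeN : {ae mu, forall t, ~ N t} by exists N; split => // t /= /contrapT.
apply: filterS aeN => t tN tab.
by rewrite /Fx patchE mem_set ?dpsiE//; split.
Qed.

End mcshane.

(** * Existence and uniqueness *)

Section cauchy_lipschitz.
Context {R : realType} (a b : R) (psi : R -> R) (alpha : R).
Notation mu := (@lebesgue_measure R).
Local Notation integ V := (mu.-integrable setT (EFin \o V)).
Hypothesis ab : a < b.
Hypothesis hpsi : C1_increasing a b psi.
Hypothesis alpha0 : 0 < alpha.

Lemma cauchy_solution_setT (F : R -> R -> R) (L : R) (c : nat -> R) : 0 < L ->
  lipschitz_in_second a b setT F L -> (forall x, L1psi a b psi (F ^~ x)) ->
  exists u, cauchy_solution a b psi alpha setT F c u /\
    forall v, cauchy_solution a b psi alpha setT F c v ->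
      \forall t \ae mu, t \in `[a, b] -> v t = u t.
Proof.
move=> L0 lipF F1; have hb := nceil_fractional alpha0.
have [Nem [iNem lipN NemE]] := nemytskii_operator ab hpsi L0 lipF F1.
have [V [iV VE Vu]] := solution_density_fixpoint ab hpsi hb c (nceil alpha).-1 L0 iNem lipN.
have p0 t : t \in `]a, b[ -> derive1 psi t != 0.
  by move=> tab; rewrite gt_eqF// (psi'_gt0 hpsi).
pose u t := V t / derive1 psi t.
have Vpu : {ae mu, forall t, t \in `]a, b[ -> V t = derive1 psi t * u t}.
  by apply: aeW => t tab; rewrite /u mulrC divfK// p0.
exists u; split.
  apply: (solution_density_cauchy ab hpsi alpha0 iV (iNem _ iV)) => //.
  - by apply: filterS NemE => t h tab; rewrite h.
  - exact: aeW.
  - by apply: filterS VE => t VE _.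
move=> v hv; have [[vL _ _] _ _ _ _] := hv.
have [W0 iW0 W0E] := L1psi_density hpsi vL.
(* Uniqueness of the fixed point is stated on the whole line, and solution densities vanish outside
   the interval. *)
pose W := W0 \_ `]a, b[.
have iW : integ W.
  rewrite -restrict_EFin; apply/integrable_restrict => //=; rewrite setTI.
  exact: integrableS iW0.
have WE : {ae mu, forall t, t \in `]a, b[ -> W t = derive1 psi t * v t}.
  by apply: filterS W0E => t h tab; rewrite /W patchE mem_set// h.
have HE : {ae mu, forall t, t \in `]a, b[ -> Nem W t = derive1 psi t * F t (v t)}.
  apply: filterS2 WE NemE => t WE h tab.
  by rewrite h// WE// [_ * v t]mulrC mulfK// p0.
have Wsol := cauchy_solution_density ab hpsi alpha0 iW (iNem _ iW) WE HE hv.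
have WV : {ae mu, forall t, W t = V t}.
  apply: Vu => //; apply: filterS Wsol => t h.
  have [tab|tab] := boolP (t \in `]a, b[); first exact: h.
  by rewrite solution_density_out// /W patchE memNset//; exact/negP.
have wvu : {ae mu, forall t, t \in `]a, b[ -> v t = u t}.
  apply: filterS2 WV WE => t WV WE tab.
  by rewrite /u -WV WE// mulrC mulKf// p0.
apply: filterS3 wvu (ae_neq a) (ae_neq b) => t h ta tb tab; apply: h.
move: tab; rewrite !in_itv/= => /andP[a_t t_b].
by rewrite !lt_neqAle eq_sym ta tb a_t.
Qed.

End cauchy_lipschitz.

Theorem theorem3p12 (R : realType) (a b : R) (psi : R -> R) (alpha : R)
    (G : set R) (f : R -> R -> R) (L : R) (c : nat -> R)
    (ha : 0 <= a) (hab : a < b) (halpha : 0 < alpha)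
    (hpsi : kernel_function a b (nceil alpha) psi)
    (hG : open G)
    (hf : forall x, G x -> L1psi a b psi (f ^~ x))
    (hL : 0 < L) (hLip : lipschitz_in_second a b G f L)
    (hconf : confined a b psi alpha G f L c) :
  exists u : R -> R, cauchy_solution a b psi alpha G f c u /\
    forall v : R -> R, cauchy_solution a b psi alpha G f c v ->
      \forall t \ae @lebesgue_measure R, t \in `[a, b] -> v t = u t.
Proof.
have [n0 _] := nceil_itv halpha; have h1 := kernel_function_C1_increasing hab n0 hpsi.
have [G0|/set0P/negP/negPn/eqP G0] := pselect (G !=set0); last first.
  (* If [G] were empty, the zero function would prolong [f] vacuously. Confinement would then place
     the values of its solution in the empty set on an interval of positive measure. *)
  have F0L : forall x : R, L1psi a b psi ((fun _ _ => 0) ^~ x).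
    move=> x; apply: (density_L1psi h1 (V := cst 0)); first exact: integrable0.
    by apply: aeW => t _; rewrite mulr0.
  have lip0 : lipschitz_in_second a b setT (fun _ _ => 0) L.
    by move=> t x y _ _ _; rewrite subrr normr0 mulr_ge0// ltW.
  have [u [uS _]] := cauchy_solution_setT hab h1 halpha c hL lip0 F0L.
  have [|N [mN N0 hN]] := hconf _ _ F0L lip0 u uS; first by move=> t x _; rewrite G0.
  suff : (@lebesgue_measure R (`]a, b[%classic : set R) <= @lebesgue_measure R N)%E.
    by rewrite N0 lebesgue_measure_itv/= lte_fin hab -EFinB lee_fin subr_le0 leNgt hab.
  rewrite le_measure ?inE//.
  by move=> t tab; apply: hN => /= /(_ tab); rewrite G0.
have [F [Ff lipF FL]] := lipschitz_extension hab h1 hL hG G0 hLip hf.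
have fF v : {ae @lebesgue_measure R, forall t, t \in `]a, b[ -> G (v t)} ->
    {ae @lebesgue_measure R, forall t, t \in `]a, b[ -> F t (v t) = f t (v t)}.
  apply: filterS => t Gv tab; apply: Ff; last exact: Gv.
  by move: tab; rewrite !in_itv/= => /andP[-> /ltW].
have [u [uS uU]] := cauchy_solution_setT hab h1 halpha c hL lipF FL.
(* Confinement brings the solution of the extended problem back to [G], where both right-hand sides
   agree; conversely, any solution with values in [G] solves the extended problem. *)
have Gu := hconf F Ff FL lipF u uS.
exists u; split.
  case: uS => uL _ uF uk un; split => //.
  by apply: filterS2 uF (fF _ Gu) => t h1' h2' tab; rewrite h1'// h2'.
move=> v [vL Gv vf vk vn]; apply: uU; split => //; first exact: aeW.
by apply: filterS2 vf (fF _ Gv) => t h1' h2' tab; rewrite h1'// h2'.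
Qed.
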